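(* Let $0<\omega<\frac{\alpha}{2}$, and let $u,v:\mathbb{R}^3\to(0,\infty)$ satisfy $$\Delta u=u(u^{2}+v^{2}-1)+v(\alpha uv-\omega),\qquad \Delta v=v(u^{2}+v^{2}-1)+u(\alpha uv-\omega)\qquad\text{in }\mathbb{R}^3,$$ with $\frac{\partial u}{\partial x_3}>0>\frac{\partial v}{\partial x_3}$ everywhere in $\mathbb{R}^3$. Then there exists a constant $C>0$ such that $$J(u,v,B_R)\le CR^{2}$$ for all sufficiently large $R$.
   Context: $B_R$ is the ball of radius $R$ centered at the origin in $\mathbb{R}^3$. For a bounded domain $\Omega$, $$J(u,v,\Omega)=\int_\Omega\Big\{\frac{|\nabla u|^2+|\nabla v|^2}{2}+W(u,v)\Big\}dx,\qquad W(u,v)=\tfrac14(1-u^2-v^2)^2+\tfrac{1}{2\alpha}(\omega-\alpha uv)^2 .$$ Solutions are classical. *)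

(* Defs.v *)
From mathcomp Require Import all_boot all_order all_algebra.
From mathcomp Require Import all_classical all_reals all_analysis.

Set Implicit Arguments.
Unset Strict Implicit.
Unset Printing Implicit Defensive.

Import Order.TTheory GRing.Theory Num.Theory.
Import numFieldNormedType.Exports.

Local Open Scope classical_set_scope.
Local Open Scope ring_scope.

(* R^3 is (R * R) * R. Its canonical norm is the sup norm, which gives the usual
   topology and partial derivatives; the Euclidean norm only matters for balls
   and is written out in [ball3]. *)
Notation space3 R := (R * R * R)%type.

Definition basis3 (R : realType) (i : 'I_3) : space3 R :=
  ((i == 0%N :> nat)%:R, (i == 1%N :> nat)%:R, (i == 2%N :> nat)%:R).

Definition pderiv (R : realType) (i : 'I_3) (f : space3 R -> R) : space3 R -> R :=
  fun x => 'D_(basis3 R i) f x.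

(* [ord_max] is the index of the last of the three coordinates, x_3. *)
Definition pderiv3 (R : realType) (f : space3 R -> R) : space3 R -> R :=
  pderiv ord_max f.

(* 'D_v takes a junk value where the limit does not exist, hence the explicit
   derivability condition. *)
Fixpoint Ck (R : realType) (k : nat) (f : space3 R -> R) : Prop :=
  if k is k'.+1 then
    continuous f /\
    forall i, (forall x, derivable f x (basis3 R i)) /\ Ck k' (pderiv i f)
  else continuous f.

Definition laplacian (R : realType) (f : space3 R -> R) (x : space3 R) : R :=
  \sum_(i < 3) pderiv i (pderiv i f) x.

Definition sqr_grad (R : realType) (f : space3 R -> R) (x : space3 R) : R :=
  \sum_(i < 3) pderiv i f x ^+ 2.

Definition ball3 (R : realType) (r : R) : set (space3 R) :=
  [set x | Num.sqrt (x.1.1 ^+ 2 + x.1.2 ^+ 2 + x.2 ^+ 2) < r].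

Notation lebesgue3 R :=
  ((@lebesgue_measure R \x @lebesgue_measure R) \x @lebesgue_measure R)%E.

Definition W (R : realType) (alpha omega a b : R) : R :=
  4^-1 * (1 - a ^+ 2 - b ^+ 2) ^+ 2
  + (2 * alpha)^-1 * (omega - alpha * a * b) ^+ 2.

(* Extended-real valued, so that a finite upper bound is not an artefact of a
   default value for a divergent integral. *)
Definition J (R : realType) (alpha omega : R) (u v : space3 R -> R)
    (Omega : set (space3 R)) : \bar R :=
  (\int[lebesgue3 R]_(x in Omega)
     ((sqr_grad u x + sqr_grad v x) / 2 + W alpha omega (u x) (v x))%:E)%E.

Definition classical_solution (R : realType) (alpha omega : R)
    (u v : space3 R -> R) : Prop :=
  [/\ Ck 2 u, Ck 2 v,
      (forall x, laplacian u x =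
         u x * (u x ^+ 2 + v x ^+ 2 - 1) + v x * (alpha * u x * v x - omega))
    & (forall x, laplacian v x =
         v x * (u x ^+ 2 + v x ^+ 2 - 1) + u x * (alpha * u x * v x - omega))].

(* Main.v *)
(* The linearised system is cooperative where [omega <= (2 + alpha) u v], which
   the maximum principle gives everywhere, and there (d_3 u, - d_3 v) is a
   positive solution of it.  Positivity has two consequences: a stability
   inequality, which bounds the potential energy by the gradient energy, and a
   Caccioppoli inequality for the quotients d_i u / d_3 u, d_i v / d_3 v.

   Vertical derivatives have a sign, hence integrate to boundary terms.  For the
   horizontal ones, integrate d_i (z^2 u b(d_i u)) where b is a smooth sign: the
   error term d_i d_i u is split into a quotient part, which a logarithmic cutoff
   makes negligible on a very high cylinder, and a part controlled by
   |grad d_3 u| / d_3 u.  So the energy is O(a c) on cylinders of radius a and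
   large height c.

   The identity d_3 e = div (d_3 u grad u + d_3 v grad v) for the energy density e,
   multiplied by a horizontal cutoff of radius r and the difference of two ramps
   in x_3 of lengths r and c, bounds the mean of the energy over the height r by
   that over the height c, up to a flux bounded by d_3 u - d_3 v, whose
   integral is again a boundary term. *)

Require Import Defs.
From HB Require Import structures.
From mathcomp Require Import all_boot all_order all_algebra.
From mathcomp Require Import ring lra.
From mathcomp Require Import all_classical all_reals all_analysis.
From mathcomp Require Import measurable_realfun.
Import Order.TTheory GRing.Theory Num.Theory.
Import numFieldNormedType.Exports.
Local Open Scope classical_set_scope.
Local Open Scope ring_scope.

Set Implicit Arguments.
Unset Strict Implicit.
Unset Printing Implicit Defensive.

(** Bounds on [u], [v] and their gradients only give an energy of order a^2 c on a cylinder of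
    radius a and height c; the difficulty is to gain one power of a. The Caccioppoli inequality for
    phi = d_3 u bounds |grad phi|^2 / phi^2 by a multiple of a^2 c, no better. Hence the smooth sign
    b is taken logarithmic: b'(t) is of order 1 / (l |t|) down to the scale exp(-l), the error
    becomes |grad phi| / (l phi), and l of order a supplies the missing power. The regularisation at
    scale exp(-l) costs a factor exp(2 l) in front of the quotient part. It is affordable because
    planar cutoffs can have arbitrarily small Dirichlet energy; in space this forces the height to
    be far larger than the radius, so the estimate has to be brought down to height r afterwards.
    The equations alone do not control W: grad W also vanishes at a saddle with u = v, where W > 0.
    Stability is used there in the direction (1, -1), along which W is concave at the saddle. *)

Lemma eq_ler (R : numDomainType) (x y : R) : x = y -> x <= y.
Proof. by move=> ->. Qed.

(** * Integration over space *)

Section Caratheodory.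
Context d (T : measurableType d) (R : realType).
Variable f : T * R -> R.
Hypothesis mf : forall y, measurable_fun setT (fun x => f (x, y)).
Hypothesis cf : forall x, continuous (fun y => f (x, y)).

Let grid (n : nat) (y : R) : R := (Num.floor (n.+1%:R * y))%:~R / n.+1%:R.

Let grid_cvg (y : R) : grid ^~ y @ \oo --> y.
Proof.
apply/cvgrPdist_le => e e0.
near=> n.
have n0 : 0 < n.+1%:R :> R by rewrite ltr0n.
have -> : y - grid n y = (n.+1%:R * y - (Num.floor (n.+1%:R * y))%:~R) / n.+1%:R.
  by rewrite mulrBl mulrAC divff ?gt_eqF// mul1r.
rewrite normrM normfV (gtr0_norm n0) ler_pdivrMr//.
have h1 : n.+1%:R * y - (Num.floor (n.+1%:R * y))%:~R <= 1.
  by rewrite lerBlDr addrC ltW// (lt_le_trans (floorD1_gt _))// intrD addrC.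
rewrite ger0_norm ?subr_ge0 ?floor_le//.
apply: (le_trans h1); rewrite -ler_pdivrMl// mulr1; near: n.
exists (Num.truncn e^-1) => //= m /= Nm.
rewrite ltW// (lt_le_trans (truncnS_gt _))// ler_nat ltnS//.
Unshelve. all: by end_near. Qed.

Let mgrid (n : nat) : measurable_fun setT (fun z : T * R => f (z.1, grid n z.2)).
Proof.
move=> _ A mA; rewrite setTI.
(* A union over the integers taken by the floor, indexed by naturals through [unpickle]; an index
   that codes no integer contributes [set0]. *)
have -> : (fun z => f (z.1, grid n z.2)) @^-1` A =
  \bigcup_m (if unpickle m is Some k then
      (fun x => f (x, (k : int)%:~R / n.+1%:R)) @^-1` A
        `*` [set y : R | Num.floor (n.+1%:R * y) = k] else set0).
  apply/seteqP; split=> [[x y] /= Axy|[x y] [m _]].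
    by exists (pickle (Num.floor (n.+1%:R * y))); rewrite ?pickleK.
  by case: (unpickle m) => [k|] //= [/= + kE]; rewrite /grid kE.
apply: bigcup_measurable => // m _; case: (unpickle m) => // k.
apply: measurableX.
  by rewrite -[X in measurable X]setTI; exact: mf.
have -> : [set y : R | Num.floor (n.+1%:R * y) = k] =
   `[k%:~R / n.+1%:R, (k + 1)%:~R / n.+1%:R[%classic.
  apply/seteqP; split=> y /=; rewrite in_itv /= ler_pdivrMr ?ltr0n// ltr_pdivlMr ?ltr0n// [y * _]mulrC.
    by move=> <-; rewrite floor_le floorD1_gt.
  by move/floor_def.
exact: measurable_itv.
Qed.

(** Rounding [y] down to a grid of mesh 1/(n+1) leaves only countably many values of [y], so the
    rounded functions are measurable; they converge pointwise by continuity in [y]. Used one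
    variable at a time, this gives measurability for the iterated product sigma-algebra of
    [space3]. *)
Lemma measurable_caratheodory : measurable_fun setT f.
Proof.
apply: (measurable_fun_cvg (h := fun n z => f (z.1, grid n z.2))) => // [[x y] _].
exact: (@cvg_comp _ _ _ (grid^~ y) (fun y => f (x, y)) _ _ _ (@grid_cvg y) (@cf x y)).
Qed.
End Caratheodory.

Lemma cvg_to_pair (T : Type) (U V : topologicalType) (F : set_system T)
    (FF : Filter F) (f : T -> U) (g : T -> V) (a : U) (b : V) :
  f @ F --> a -> g @ F --> b -> (fun t => (f t, g t)) @ F --> (a, b).
Proof. by move=> fa gb; exact: cvg_pair fa gb. Qed.

Lemma continuous_measurable3 (R : realType) (f : space3 R -> R) :
  continuous f -> measurable_fun setT f.
Proof.
move=> cf; apply: measurable_caratheodory => [z|[x y] z].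
  apply: measurable_caratheodory => [y|x y].
    apply: continuous_measurable_fun => x.
    apply: (continuous_comp (f := fun x : R => (x, y, z)) (g := f)); last exact: cf.
    by apply: cvg_to_pair; [apply: cvg_to_pair|]; (exact: cvg_id || exact: cvg_cst).
  apply: (continuous_comp (f := fun y : R => (x, y, z)) (g := f)); last exact: cf.
  by apply: cvg_to_pair; [apply: cvg_to_pair|]; (exact: cvg_id || exact: cvg_cst).
apply: (continuous_comp (f := fun z : R => (x, y, z)) (g := f)); last exact: cf.
by apply: cvg_to_pair; (exact: cvg_id || exact: cvg_cst).
Qed.

Definition box3 (R : realType) (a b c : R) : set (space3 R) :=
  [set x | `|x.1.1| <= a /\ `|x.1.2| <= b /\ `|x.2| <= c].

Lemma box3E (R : realType) (a b c : R) :
  box3 a b c = (`[- a, a] `*` `[- b, b]) `*` `[- c, c].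
Proof.
apply/seteqP; split=> [[[x y] z]|[[x y] z]] /=; rewrite /box3 /= !in_itv /= !ler_norml.
  by move=> [? [? ?]].
by move=> [[? ?] ?].
Qed.

Lemma norm_le_box3 (R : realType) (r : R) (x : space3 R) :
  (`|x| <= r) <-> box3 r r r x.
Proof. by rewrite prod_normE /= prod_normE /= !ge_max /box3 /=; split=> [/andP[/andP[]]|[-> [-> ->]]]. Qed.

Lemma compact_box3 (R : realType) (a b c : R) : compact (box3 a b c).
Proof. by rewrite box3E; do 2?apply: compact_setX; exact: segment_compact. Qed.

Lemma measurable_box3 (R : realType) (a b c : R) : measurable (box3 a b c).
Proof. by rewrite box3E; do 2?apply: measurableX; exact: measurable_itv. Qed.

Lemma continuous_bounded_box3 (R : realType) (f : space3 R -> R) (r : R) :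
  continuous f -> exists2 M : R, 0 < M & forall x, `|x| <= r -> `|f x| <= M.
Proof.
move=> cf.
have /ex_strict_bound_gt0[M M0 hM] : bounded_set (f @` box3 r r r).
  apply/compact_bounded/continuous_compact; last exact: compact_box3.
  exact: continuous_subspaceT.
exists M => // x /norm_le_box3 xr; apply/ltW/hM; by exists x.
Qed.

Lemma lebesgue3_box3 (R : realType) (a b c : R) : 0 <= a -> 0 <= b -> 0 <= c ->
  lebesgue3 R (box3 a b c) = (8 * a * b * c)%:E.
Proof.
move=> a0 b0 c0; rewrite box3E.
have len (d : R) : 0 <= d -> @lebesgue_measure R `[- d, d] = (d * 2)%:E.
  move=> d0; rewrite lebesgue_measure_itv /= lte_fin.
  have [dd|] := ltP (-d) d; first by rewrite -EFinB; congr EFin; ring.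
  by move=> dd; congr EFin; lra.
rewrite product_measure1E; try exact: measurableX; try exact: measurable_itv.
rewrite [X in (X * _)%E]product_measure1E; try exact: measurable_itv.
transitivity ((a * 2)%:E * (b * 2)%:E * (c * 2)%:E)%E.
  by congr (_ * _ * _)%E; exact: len.
by rewrite -!EFinM; congr EFin; ring.
Qed.

Lemma integrable_bounded_support d (T : measurableType d) (R : realType)
    (mu : {measure set T -> \bar R}) (f : T -> R) (A : set T) (M : R) :
  measurable A -> (mu A < +oo)%E -> measurable_fun setT f ->
  (forall x, `|f x| <= M) -> (forall x, ~ A x -> f x = 0) ->
  mu.-integrable setT (EFin \o f).
Proof.
move=> mA muA mf fM f0.
have : mu.-integrable A (EFin \o f).
  apply: measurable_bounded_integrable => //; first exact: measurable_funTS.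
  by exists M; split; rewrite ?num_real// => y My x _ /=; apply: le_trans (fM x) _; exact: ltW.
move=> /(integrable_mkcond _ mA); apply: eq_integrable => // x _.
by rewrite patchE; case: ifPn => //; rewrite notin_setE => /f0 /= ->.
Qed.

(** Continuous with compact support. The real-valued integral is linear and monotone on this class
    with no further integrability condition, so all integral estimates are kept inside it. *)
Definition cc (R : realType) (f : space3 R -> R) : Prop :=
  continuous f /\ exists r, forall x, r < `|x| -> f x = 0.

Definition integral3 (R : realType) (f : space3 R -> R) : R :=
  (\int[lebesgue3 R]_x f x)%R.

Section integral3.
Variable R : realType.
Implicit Types f g : space3 R -> R.
Notation mu := (lebesgue3 R).
Local Notation I := (@integral3 R).

Lemma integrable_indic_box3 (M a b c : R) : 0 <= a -> 0 <= b -> 0 <= c ->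
  mu.-integrable setT (EFin \o (fun x => M * \1_(box3 a b c) x)).
Proof.
move=> a0 b0 c0; have mb := @measurable_box3 R a b c.
apply: (@integrable_bounded_support _ _ _ mu _ (box3 a b c) `|M|) => //.
- by rewrite [X in (X < _)%E]lebesgue3_box3// ltry.
- exact: measurable_funM.
- by move=> x; rewrite indicE normrM; case: (_ \in _); rewrite ?normr1 ?normr0 ?mulr1// mulr0.
- by move=> x xb; rewrite indicE memNset// mulr0.
Qed.

Lemma cc_integrable f : cc f -> mu.-integrable setT (EFin \o f).
Proof.
move=> [cf [r hr]]; have [M M0 hM] := continuous_bounded_box3 `|r| cf.
have hr0 x : ~ box3 `|r| `|r| `|r| x -> f x = 0.
  move=> /norm_le_box3/negP; rewrite -ltNge => rx.
  by apply: hr; rewrite (le_lt_trans _ rx)// ler_norm.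
apply: (@integrable_bounded_support _ _ _ mu _ (box3 `|r| `|r| `|r|) M) => //.
- exact: measurable_box3.
- by rewrite [X in (X < _)%E]lebesgue3_box3// ltry.
- exact: continuous_measurable3.
- move=> x; have [xr|rx] := leP `|x| `|r|; first exact: hM.
  by rewrite hr0 ?normr0 ?ltW// => /norm_le_box3; rewrite leNgt rx.
Qed.

Lemma integral3D f g : cc f -> cc g -> I (fun x => f x + g x) = I f + I g.
Proof. by move=> cf cg; apply: RintegralD => //; exact: cc_integrable. Qed.

Lemma integral3Z (k : R) f : cc f -> I (fun x => k * f x) = k * I f.
Proof. by move=> cf; apply: RintegralZl => //; exact: cc_integrable. Qed.

Lemma le_integral3 f g : cc f -> cc g -> (forall x, f x <= g x) -> I f <= I g.
Proof. by move=> cf cg fg; apply: le_Rintegral => //; exact: cc_integrable. Qed.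

Lemma integral3_le_box3 f (M a b c : R) : 0 <= a -> 0 <= b -> 0 <= c -> cc f ->
  0 <= M -> (forall x, f x <= M) -> (forall x, ~ box3 a b c x -> f x = 0) ->
  I f <= M * (8 * a * b * c).
Proof.
move=> a0 b0 c0 cf M0 fM f0.
apply: (le_trans (y := I (fun x => M * \1_(box3 a b c) x))).
  apply: le_Rintegral => //; [exact: cc_integrable|exact: integrable_indic_box3|].
  move=> x _; rewrite indicE; have [xb|xb] := boolP (x \in _).
    by rewrite mulr1.
  by rewrite mulr0 f0//; move: xb; rewrite notin_setE.
rewrite /integral3 /Rintegral.
under eq_integral do rewrite EFinM.
rewrite integralZl//; last first.
  by apply: (eq_integrable _ _ _ _ (integrable_indic_box3 1 a0 b0 c0)) => // x _; rewrite /= mul1r.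
rewrite integral_indic//; last exact: measurable_box3.
by rewrite setIT [X in (_ * X)%E]lebesgue3_box3// -EFinM.
Qed.

End integral3.

(** * Directional derivatives and C1 functions *)

Section is_derive_line.
Context {R : realType} {V : normedModType R}.
Implicit Types (f : V -> R) (x v : V).

(** Restriction to a line turns directional derivatives into derivatives of one real variable, where
    the chain rule, the mean value theorem and the fundamental theorem of calculus apply. *)
Lemma is_derive_line f x v d : is_derive x v f d <-> is_derive (0 : R) (1 : R) (fun s : R => f (s *: v + x)) d.
Proof.
have E : 'D_v f x = 'D_1 (fun s : R => f (s *: v + x)) 0.
  rewrite /derive; set g1 := fun h => h^-1 *: _; set g2 := fun h => h^-1 *: _.
  suff -> : g1 = g2 by []; apply/funext => h; rewrite /g1 /g2 /=.
  by rewrite addr0 scale0r add0r [_%:A]mulr1.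
by split=> -[df <-]; apply: DeriveDef;
  [exact: (derivable1P f x v).1|rewrite E|exact: (derivable1P f x v).2|rewrite E].
Qed.

End is_derive_line.

Lemma is_derive_along (R : realType) (V : normedModType R) (f df : V -> R) x v (s : R) :
  (forall x, is_derive x v f (df x)) ->
  is_derive s (1 : R) (fun s : R => f (s *: v + x)) (df (s *: v + x)).
Proof.
move=> fdf; apply: (is_derive_line _ s 1 _).2.
rewrite (_ : (fun _ => _) = (fun s0 : R => f (s0 *: v + (s *: v + x)))).
  exact: (is_derive_line f (s *: v + x) v _).1 (fdf _).
by apply/funext => t; rewrite scalerDl addrA [_%:A]mulr1.
Qed.

Lemma is_derive_compR (R : realType) (V : normedModType R) (h : R -> R)
  (f : V -> R) x v d d' :
  is_derive (f x) (1 : R) h d' -> is_derive x v f d ->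
  is_derive x v (fun y => h (f y)) (d' * d).
Proof.
move=> hd fd; apply: (is_derive_line _ x v _).2; move/(is_derive_line f x v d).1 : fd => fd.
apply: (is_derive1_comp (f := h) (g := fun s : R => f (s *: v + x))).
by rewrite scale0r add0r.
Qed.

Section C1.
Variable R : realType.
Implicit Types (f g : space3 R -> R) (df dg : 'I_3 -> space3 R -> R).

(** The gradient is a parameter instead of [pderiv], so that the derivatives of products, quotients
    and cutoffs are explicit expressions on which [ring] and [field] work. *)
Definition C1 f df := [/\ continuous f, forall i, continuous (df i) &
  forall i x, is_derive x (basis3 R i) f (df i x)].

Definition csupp f := exists r, forall x, r < `|x| -> f x = 0.

Lemma C1_cst (c : R) : C1 (fun=> c) (fun _ _ => 0).
Proof.
split; first exact: cst_continuous.
  by move=> i; exact: cst_continuous.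
by move=> i x; exact: is_derive_cst.
Qed.

Lemma C1D f df g dg : C1 f df -> C1 g dg ->
  C1 (fun x => f x + g x) (fun i x => df i x + dg i x).
Proof.
move=> [cf cdf fd] [cg cdg gd]; split.
- by move=> x; apply: cvgD; [exact: cf|exact: cg].
- by move=> i x; apply: cvgD; [exact: cdf|exact: cdg].
- by move=> i x; exact: is_deriveD.
Qed.

Lemma C1N f df : C1 f df -> C1 (fun x => - f x) (fun i x => - df i x).
Proof.
move=> [cf cdf fd]; split.
- by move=> x; apply: cvgN; exact: cf.
- by move=> i x; apply: cvgN; exact: cdf.
- by move=> i x; exact: is_deriveN.
Qed.

Lemma C1M f df g dg : C1 f df -> C1 g dg ->
  C1 (fun x => f x * g x) (fun i x => df i x * g x + f x * dg i x).
Proof.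
move=> [cf cdf fd] [cg cdg gd]; split.
- by move=> x; apply: cvgM; [exact: cf|exact: cg].
- by move=> i x; apply: cvgD; apply: cvgM; [exact: cdf|exact: cg|exact: cf|exact: cdg].
- move=> i x; apply: is_derive_eq.
  by rewrite addrC mulrC.
Qed.

Lemma C1_comp (h h' : R -> R) f df : C1 f df ->
  (forall x, is_derive (f x) (1 : R) h (h' (f x))) ->
  continuous (fun x => h' (f x)) ->
  C1 (fun x => h (f x)) (fun i x => h' (f x) * df i x).
Proof.
move=> [cf cdf fd] hd ch; split.
- move=> x; apply: (continuous_comp (f := f) (g := h)); first exact: cf.
  by apply/differentiable_continuous/derivable1_diffP; case: (hd x).
- by move=> i x; apply: cvgM; [exact: ch|exact: cdf].
- by move=> i x; exact: (is_derive_compR (hd x) (fd i x)).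
Qed.

Lemma C1V f df : C1 f df -> (forall x, f x != 0) ->
  C1 (fun x => (f x)^-1) (fun i x => - (f x) ^- 2 * df i x).
Proof.
move=> [cf cdf fd] f0; split.
- by move=> x; apply: cvgV => //; exact: cf.
- move=> i x; apply: cvgM; [|exact: cdf].
  apply: cvgN; apply: cvgV; first by rewrite expf_neq0.
  by apply: (continuous_comp (f := f) (g := fun y : R => y ^+ 2)); [exact: cf|exact: exprn_continuous].
- move=> i x; apply: (is_derive_compR (h := fun y => y^-1) _ (fd i x)).
  apply: is_derive_eq; first by apply: (@is_deriveV R id (f x)) => //; exact: f0.
  by rewrite [_%:A]mulr1.
Qed.

Lemma eq_C1 f df g dg : C1 f df -> (forall x, f x = g x) -> (forall i x, df i x = dg i x) -> C1 g dg.
Proof.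
move=> Cf fg dfg; have -> : g = f by apply/funext => x; rewrite fg.
by have -> // : dg = df; apply/funext => i; apply/funext => x; rewrite dfg.
Qed.

Lemma csupp_derive f df i : C1 f df -> csupp f -> csupp (df i).
Proof.
move=> [cf cdf fd] [r hr]; exists r => x rx.
have := fd i x; have : is_derive x (basis3 R i) (fun=> 0 : R) 0 by exact: is_derive_cst.
move=> h0 h1.
have h3 : is_derive x (basis3 R i) f 0.
  apply: near_eq_is_derive h0.
  have : \forall y \near x, r < `|y|.
    exact: (cvgr_gt `|x| (@norm_continuous _ _ x) _ rx).
  by apply: filterS => y /hr ->.
by case: h1 => _ <-; case: h3.
Qed.
End C1.

(** * Fubini and the divergence theorem for compact supports *)

Section sigma_finite_product.
Local Open Scope ereal_scope.
Context d1 d2 (T1 : measurableType d1) (T2 : measurableType d2) (R : realType).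
Variable m1 : {sigma_finite_measure set T1 -> \bar R}.
Variable m2 : {sigma_finite_measure set T2 -> \bar R}.

(* The library only infers a sigma-finite structure on a product of
   subprobabilities, hence this explicit copy. *)
Definition product_measure_copy := m1 \x m2.

HB.instance Definition _ := Measure.copy product_measure_copy (m1 \x m2).

Lemma product_measure_copy_sigma_finite : sigma_finite setT product_measure_copy.
Proof.
have /sigma_finiteP[F [TF ndF Foo]] := sigma_finiteT m1.
have /sigma_finiteP[G [TG ndG Goo]] := sigma_finiteT m2.
exists (fun n => F n `*` G n).
  rewrite -setXTT TF TG; apply/seteqP; split=> [[x y] [[n _ Fx] [k _ Gy]]|[x y] [n _ [? ?]]].
    exists (maxn n k) => //; split=> /=.
      by apply: (subsetPset _ _ (ndF _ _ _) x Fx); exact: leq_maxl.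
    by apply: (subsetPset _ _ (ndG _ _ _) y Gy); exact: leq_maxr.
  by split; exists n.
move=> k; have [mF ?] := Foo k; have [mG ?] := Goo k.
split; first exact: measurableX.
rewrite /product_measure_copy [X in X < _](product_measure1E m1 m2 mF mG).
by rewrite lte_mul_pinfty// ge0_fin_numE.
Qed.

HB.instance Definition _ := Measure_isSigmaFinite.Build _ _ _ product_measure_copy
  product_measure_copy_sigma_finite.

End sigma_finite_product.

Section Fubini3.
Local Open Scope ereal_scope.
Context d1 d2 d3 (T1 : measurableType d1) (T2 : measurableType d2)
  (T3 : measurableType d3) (R : realType).
Variable m1 : {sigma_finite_measure set T1 -> \bar R}.
Variable m2 : {sigma_finite_measure set T2 -> \bar R}.
Variable m3 : {sigma_finite_measure set T3 -> \bar R}.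
Variable f : T1 * T2 * T3 -> \bar R.
Hypothesis intf : (product_measure_copy m1 m2 \x m3).-integrable setT f.

Lemma integral_prod3_eq0 : (forall x y, \int[m3]_z f (x, y, z) = 0) ->
  \int[product_measure_copy m1 m2 \x m3]_w f w = 0.
Proof.
move=> f0; apply: etrans (esym (integral12_prod_meas1 intf)) _.
by apply: integral0_eq => -[x y] _; exact: f0.
Qed.

Hypothesis intf2 : forall z, (m1 \x m2).-integrable setT (fun xy => f (xy, z)).

(** For the first two coordinates Fubini is applied twice, on the whole space and on each plane of
    constant z; the second application is what requires [intf2]. *)
Lemma integral_prod1_eq0 : (forall y z, \int[m1]_x f (x, y, z) = 0) ->
  \int[product_measure_copy m1 m2 \x m3]_w f w = 0.
Proof.
move=> f0; apply: etrans (esym (integral21_prod_meas1 intf)) _.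
apply: integral0_eq => z _; apply: etrans (esym (integral21_prod_meas1 (intf2 z))) _.
by apply: integral0_eq => y _; exact: f0.
Qed.

Lemma integral_prod2_eq0 : (forall x z, \int[m2]_y f (x, y, z) = 0) ->
  \int[product_measure_copy m1 m2 \x m3]_w f w = 0.
Proof.
move=> f0; apply: etrans (esym (integral21_prod_meas1 intf)) _.
apply: integral0_eq => z _; apply: etrans (esym (integral12_prod_meas1 (intf2 z))) _.
by apply: integral0_eq => x _; exact: f0.
Qed.
End Fubini3.

Lemma integral_derive_eq0 (R : realType) (g g' : R -> R) (r : R) :
  (forall s, is_derive s (1 : R) g (g' s)) -> continuous g' ->
  (forall s, r < `|s| -> g s = 0) -> (forall s, r < `|s| -> g' s = 0) ->
  (\int[@lebesgue_measure R]_s (g' s)%:E = 0)%E.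
Proof.
move=> gd cg' g0 g'0; pose b := `|r| + 1.
have rb : r < `|b|.
  by rewrite /b (le_lt_trans (ler_norm r))// (lt_le_trans _ (ler_norm _))// ltrDl.
have b0 : 0 < b by rewrite /b ltr_wpDl.
have -> : (\int[@lebesgue_measure R]_s (g' s)%:E =
    \int[@lebesgue_measure R]_(s in `[(- b)%R, b]) (g' s)%:E)%E.
  rewrite [RHS]integral_mkcond; apply: eq_integral => s _; rewrite patchE.
  case: ifPn => //; rewrite notin_setE /= in_itv /= => /negP.
  rewrite -ler_norml -ltNge => bs; rewrite g'0//.
  by rewrite (lt_trans rb)// gtr0_norm.
have cg : continuous g.
  by move=> x; apply/differentiable_continuous/derivable1_diffP; case: (gd x).
rewrite (@continuous_FTC2 R g' g).
- by rewrite !g0 ?normrN// -EFinB subrr.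
- by rewrite (lt_trans _ b0)// oppr_lt0.
- exact: continuous_subspaceT.
- split; first by move=> x _; case: (gd x).
    by apply: cvg_at_right_filter; exact: cg.
  by apply: cvg_at_left_filter; exact: cg.
- by move=> x _; rewrite derive1E; case: (gd x).
Qed.

Section integral3_derive.
Variable R : realType.
Implicit Types (f g : space3 R -> R) (df dg : 'I_3 -> space3 R -> R).

Lemma csupp_bounded f : continuous f -> csupp f ->
  exists2 r, 0 < r & exists2 M, 0 < M & forall x, `|f x| <= M * \1_(box3 r r r) x.
Proof.
move=> cf [r0 hr]; pose r := `|r0| + 1; have r00 : 0 < r by rewrite ltr_wpDl.
have [M M0 hM] := continuous_bounded_box3 r cf.
exists r => //; exists M => // x; rewrite indicE.
have [xr|rx] := leP `|x| r.
  by rewrite mem_set ?mulr1 ?hM//; apply/norm_le_box3.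
rewrite hr ?normr0 ?mulr_ge0// ?ltW//.
by rewrite (lt_trans _ rx)// /r (le_lt_trans (ler_norm r0))// ltrDl.
Qed.

(** Every integration by parts below reduces to this. Fubini with [x_i] innermost leaves integrals
    over lines of derivatives of compactly supported functions; [slice] treats the three directions
    at once. *)
Lemma integral3_derive_eq0 f df i : C1 f df -> csupp f -> integral3 (df i) = 0.
Proof.
move=> Cf cf; have cdf := csupp_derive i Cf cf.
have [c1 cd fd] := Cf.
have int3 : (lebesgue3 R).-integrable setT (EFin \o df i) by exact: cc_integrable.
suff : (\int[lebesgue3 R]_x (df i x)%:E = 0)%E by rewrite /integral3 /Rintegral => ->.
have [r0 hr0] := cf; have [r1 hr1] := cdf.
pose r := Num.max r0 r1.
have hr : forall x, r < `|x| -> f x = 0 /\ df i x = 0.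
  by move=> x; rewrite /r gt_max => /andP[/hr0 -> /hr1 ->].
have nle (x y z : R) : [/\ `|x| <= `|(x, y, z)|, `|y| <= `|(x, y, z)| & `|z| <= `|(x, y, z)|].
  by have /norm_le_box3 [? []] := lexx `|(x, y, z)|.
have slice (g : R -> space3 R) (v : space3 R) : (forall s, g s = s *: basis3 R i + v) ->
    (forall s, `|s| <= `|g s|) -> (\int[@lebesgue_measure R]_s (df i (g s))%:E = 0)%E.
  move=> gE gle; apply: (@integral_derive_eq0 _ (f \o g) _ r).
  - move=> s; have -> : f \o g = (fun s => f (s *: basis3 R i + v)).
      by apply/funext => t /=; rewrite gE.
    by rewrite gE; apply: is_derive_along.
  - have -> : (fun s => df i (g s)) = (df i) \o (fun s => s *: basis3 R i + v).
      by apply/funext => t /=; rewrite gE.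
    move=> s; apply: continuous_comp; last exact: cd.
    by apply: cvgD; [apply: cvgZl; exact: cvg_id|exact: cvg_cst].
  - by move=> s rs; rewrite /= (hr _ (lt_le_trans rs (gle s))).1.
  - by move=> s rs; rewrite (hr _ (lt_le_trans rs (gle s))).2.
have int2 z : (@lebesgue_measure R \x @lebesgue_measure R)%E.-integrable setT
   (EFin \o (fun xy => df i (xy, z))).
  (* Here [M] is the half-side of a box containing the support and [r'] is the bound on the
     function. *)
  have [M M0 [r' r'0 hM]] := csupp_bounded (cd i) cdf.
  pose A : set (R * R) := `[- M, M]%classic `*` `[- M, M]%classic.
  refine (@integrable_bounded_support _ _ R (@lebesgue_measure R \x @lebesgue_measure R)%E (fun xy => df i (xy, z)) A r' _ _ _ _ _) => //.
  - by apply: measurableX; exact: measurable_itv.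
  - rewrite [X in (X < _)%E](_ : _ =
        @lebesgue_measure R `[(- M)%R, M] * @lebesgue_measure R `[(- M)%R, M])%E; last first.
      by apply: product_measure1E; exact: measurable_itv.
    by rewrite !lebesgue_measure_itv; case: ifP => //=; rewrite ?mule0// -?EFinB -?EFinM ltry.
  - apply: (measurableT_comp (continuous_measurable3 (cd i))).
    exact: measurable_pair2.
  - move=> xy; apply: (le_trans (hM _)); rewrite indicE.
    by case: (_ \in _); rewrite ?mulr1// mulr0 ltW.
  - move=> xy xyM; apply/eqP; rewrite -normr_le0.
    rewrite (le_trans (hM _))// indicE memNset ?mulr0// => -[/= xM [yM _]].
    by apply: xyM; split; rewrite /= in_itv /= -ler_norml.
case: i {cdf hr hr1 fd cd} int3 int2 slice => [[|[|[|//]]] ilt] int3 int2 slice.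
- apply: (@integral_prod1_eq0 _ _ _ _ _ _ R (@lebesgue_measure R) (@lebesgue_measure R) (@lebesgue_measure R) (EFin \o df (Ordinal ilt)) int3 int2) => y z.
  apply: (slice (fun x => (x, y, z)) (0, y, z)).
    by move=> s; rewrite /basis3 /=; congr (_, _, _) => /=; rewrite ?[_ *: _]mulr1 ?[_ *: _]mulr0 ?addr0 ?add0r.
  by move=> s; have [] := nle s y z.
- apply: (@integral_prod2_eq0 _ _ _ _ _ _ R (@lebesgue_measure R) (@lebesgue_measure R) (@lebesgue_measure R) (EFin \o df (Ordinal ilt)) int3 int2) => x z.
  apply: (slice (fun y => (x, y, z)) (x, 0, z)).
    by move=> s; rewrite /basis3 /=; congr (_, _, _) => /=; rewrite ?[_ *: _]mulr1 ?[_ *: _]mulr0 ?addr0 ?add0r.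
  by move=> s; have [] := nle x s z.
- apply: (@integral_prod3_eq0 _ _ _ _ _ _ R (@lebesgue_measure R) (@lebesgue_measure R) (@lebesgue_measure R) (EFin \o df (Ordinal ilt)) int3) => x y.
  apply: (slice (fun z => (x, y, z)) (x, y, 0)).
    by move=> s; rewrite /basis3 /=; congr (_, _, _) => /=; rewrite ?[_ *: _]mulr1 ?[_ *: _]mulr0 ?addr0 ?add0r.
  by move=> s; have [] := nle x y s.
Qed.

End integral3_derive.

Section continuity.
Context {T : topologicalType} {R : realType}.
Implicit Types f g : T -> R.

Lemma contD f g : continuous f -> continuous g -> continuous (fun x => f x + g x).
Proof. by move=> cf cg x; apply: cvgD; [exact: cf|exact: cg]. Qed.

Lemma contN f : continuous f -> continuous (fun x => - f x).
Proof. by move=> cf x; apply: cvgN; exact: cf. Qed.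

Lemma contM f g : continuous f -> continuous g -> continuous (fun x => f x * g x).
Proof. by move=> cf cg x; apply: cvgM; [exact: cf|exact: cg]. Qed.

Lemma contX n f : continuous f -> continuous (fun x => f x ^+ n).
Proof.
move=> cf; elim: n => [|n ih]; first exact: cst_continuous.
have -> : (fun x => f x ^+ n.+1) = (fun x => f x * f x ^+ n).
  by apply/funext => x; rewrite exprS.
exact: contM.
Qed.

Lemma contV f : continuous f -> (forall x, f x != 0) -> continuous (fun x => (f x)^-1).
Proof. by move=> cf f0 x; apply: cvgV => //; exact: cf. Qed.

Lemma cont_norm f : continuous f -> continuous (fun x => `|f x|).
Proof. by move=> cf x; apply: cvg_norm; exact: cf. Qed.
End continuity.

Ltac cts := lazymatch goal with
  | |- continuous (fun _ => ?c) => exact: cst_continuous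
  | |- continuous (fun x => @?f x + @?g x) => refine (@contD _ _ f g _ _); cts
  | |- continuous (fun x => - @?f x) => refine (@contN _ _ f _); cts
  | |- continuous (fun x => @?f x * @?g x) => refine (@contM _ _ f g _ _); cts
  | |- continuous (fun x => @?f x ^+ ?n) => refine (@contX _ _ n f _); cts
  | |- continuous (fun x => (@?f x)^-1) => refine (@contV _ _ f _ _); [cts|try assumption]
  | |- continuous (fun x => `|@?f x|) => refine (@cont_norm _ _ f _); cts
  | |- continuous (fun x => ?f x) => cts_leaf f
  | |- continuous ?f => cts_leaf f
  end
with cts_leaf f := match goal with
  | H : continuous f |- _ => exact: H
  | H : forall i, continuous (?g i) |- _ =>
      match f with g ?i => exact: (H i) end
  | |- _ => idtac
  end.

(** * Weak solutions and their test functions *)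

Definition dot3 (R : pzRingType) (a b : 'I_3 -> R) : R :=
  a ord0 * b ord0 + a (inord 1) * b (inord 1) + a ord_max * b ord_max.

Lemma mem_ord3 (i : 'I_3) : i \in [:: ord0; inord 1; ord_max].
Proof. by rewrite !inE -!val_eqE /= inordK//; case: i => -[|[|[|]]]. Qed.

Section weak.
Variable R : realType.
Local Notation I := (@integral3 R).
Implicit Types (f g h z a b phi psi k : space3 R -> R).

Lemma C1_csupp f (df : 'I_3 -> space3 R -> R) : C1 f df -> csupp f ->
  exists r, forall x, r < `|x| -> f x = 0 /\ forall i, df i x = 0.
Proof.
move=> Cf cf; have [r hr] := cf.
have [r0 h0] := csupp_derive ord0 Cf cf.
have [r1 h1] := csupp_derive (inord 1) Cf cf.
have [r2 h2] := csupp_derive ord_max Cf cf.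
exists (Num.max (Num.max r r0) (Num.max r1 r2)) => x.
rewrite !gt_max => /andP[/andP[/hr -> /h0 e0] /andP[/h1 e1 /h2 e2]]; split=> //.
move=> i; have := mem_ord3 i.
by rewrite !inE => /or3P[] /eqP ->.
Qed.

(** The pattern of the integral inequalities below: [h] is a divergence or a tested equation, so its
    integral vanishes, and once it is added the inequality holds pointwise, usually by completing a
    square. *)
Lemma le_integral3_add f g h : cc f -> cc g -> cc h -> I h = 0 ->
  (forall x, f x <= g x + h x) -> I f <= I g.
Proof.
move=> cf cg ch h0 fgh.
have cgh : cc (fun x => g x + h x).
  case: cg ch => cg [r hr] [ch [s hs]]; split; first exact: contD.
  by exists (Num.max r s) => x; rewrite gt_max => /andP[/hr -> /hs ->]; rewrite addr0.
by apply: (le_trans (le_integral3 cf cgh fgh)); rewrite integral3D// h0 addr0.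
Qed.

(** The weak form of Δphi = a phi - b psi. It asks for first derivatives only, because phi will be a
    derivative of a C2 function. *)
Definition weak_solution a b phi psi (dphi : 'I_3 -> space3 R -> R) :=
  forall eta deta, C1 eta deta -> csupp eta ->
  I (fun x => dot3 (dphi^~ x) (deta^~ x) + (a x * phi x - b x * psi x) * eta x) = 0.

(* The weak equations tested with [z^2 g^2 / phi] and [z^2 g]. *)
Lemma weak_quotient_ineq a b phi psi dphi g k dg z dz :
  continuous a -> continuous b -> continuous psi -> continuous k ->
  C1 phi dphi -> C1 g dg -> C1 z dz -> csupp z -> (forall x, 0 < phi x) ->
  weak_solution a b phi psi dphi -> weak_solution a b g k dg ->
  I (fun x => 2^-1 * z x ^+ 2 * (dot3 (fun i => dg i x - g x / phi x * dphi i x)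
                          (fun i => dg i x - g x / phi x * dphi i x))
     + z x ^+ 2 * b x * (g x ^+ 2 * psi x / phi x - g x * k x)) <=
  I (fun x => 2 * g x ^+ 2 * dot3 (dz^~ x) (dz^~ x)).
Proof.
move=> ca cb cpsi ck Cphi Cg Cz sz phi0 wphi wg.
have phin0 x : phi x != 0 by rewrite gt_eqF.
have [r hr] := C1_csupp Cz sz.
have C1e := C1M (C1M Cz Cz) Cg.
have C2e := C1M C1e (C1M Cg (C1V Cphi phin0)).
have s1 : csupp (fun x => z x * z x * g x).
  by exists r => x /hr[-> _]; rewrite !mul0r.
have s2 : csupp (fun x => z x * z x * g x * (g x * (phi x)^-1)).
  by exists r => x /hr[-> _]; rewrite !mul0r.
have i1 := wg _ _ C1e s1; have i2 := wphi _ _ C2e s2.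
have [cphi cdphi _] := Cphi; have [cg cdg _] := Cg; have [cz cdz _] := Cz.
set d1 := (X in C1 _ X) in C1e i1; set d2 := (X in C1 _ X) in C2e i2.
have [_ cd1 _] := C1e; have [_ cd2 _] := C2e.
have [r1 hr1] := C1_csupp C1e s1; have [r2 hr2] := C1_csupp C2e s2.
have cc1 : cc (fun x => dot3 (dg^~ x) (d1^~ x) + (a x * g x - b x * k x) * (z x * z x * g x)).
  split; first by rewrite /dot3 /=; cts.
  by exists r1 => x /hr1[-> d0]; rewrite /dot3 !d0; ring.
have cc2 : cc (fun x => -1 * (dot3 (dphi^~ x) (d2^~ x) + (a x * phi x - b x * psi x) * (z x * z x * g x * (g x * (phi x)^-1)))).
  split; first by rewrite /dot3 /=; cts.
  by exists r2 => x /hr2[-> d0]; rewrite /dot3 !d0; ring.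
pose h1 x := dot3 (dg^~ x) (d1^~ x) + (a x * g x - b x * k x) * (z x * z x * g x).
pose h2 x := -1 * (dot3 (dphi^~ x) (d2^~ x)
  + (a x * phi x - b x * psi x) * (z x * z x * g x * (g x * (phi x)^-1))).
apply: (@le_integral3_add _ _ (fun x => h1 x + h2 x)).
- split; first by rewrite /dot3 /=; cts.
  by exists r => x /hr[-> d0]; rewrite /dot3 ?d0; ring.
- split; first by rewrite /dot3 /=; cts.
  by exists r => x /hr[_ d0]; rewrite /dot3 !d0; ring.
- split; first by apply: contD; [exact: cc1.1|exact: cc2.1].
  case: cc1.2 cc2.2 => [s hs] [t ht]; exists (Num.max s t) => x.
  by rewrite gt_max => /andP[/hs e1 /ht e2]; rewrite /h1 e1 add0r /h2 e2.
- rewrite (integral3D cc1 cc2) i1 (integral3Z _ _) ?i2 ?mulr0 ?addr0//.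
  split; first by rewrite /dot3 /=; cts.
  by exists r2 => x /hr2[-> d0]; rewrite /dot3 !d0; ring.
- move=> x.
  (* With s = dg - (g / phi) dphi, the terms dg d(z^2 g) - dphi d(z^2 g^2 / phi) add up to z^2 s^2 +
     2 z g s dz; half of z^2 s^2 is kept and the other half completes a square with 2 g^2 dz^2. *)
  have key i : 2^-1 * z x ^+ 2 * (dg i x - g x / phi x * dphi i x) ^+ 2
      <= 2 * g x ^+ 2 * dz i x ^+ 2 + dg i x * d1 i x - dphi i x * d2 i x.
    rewrite -subr_ge0; set lhs := (X in 0 <= X).
    have -> : lhs = 2^-1 * (z x * (dg i x - g x / phi x * dphi i x) + 2 * g x * dz i x) ^+ 2.
      by rewrite /lhs /d1 /d2; field.
    by rewrite mulr_ge0 ?invr_ge0// sqr_ge0.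
  have k0 := key ord0; have k1 := key (inord 1); have k2 := key ord_max.
  rewrite -subr_ge0 /h1 /h2 /dot3; set lhs := (X in 0 <= X).
  have -> : lhs = \sum_(i <- [:: ord0; inord 1; ord_max])
     (2 * g x ^+ 2 * dz i x ^+ 2 + dg i x * d1 i x - dphi i x * d2 i x
      - 2^-1 * z x ^+ 2 * (dg i x - g x / phi x * dphi i x) ^+ 2).
    rewrite /lhs !big_cons big_nil; clearbody d1 d2; field; exact: phin0.
  rewrite !big_cons big_nil addr0.
  by apply: addr_ge0; [|apply: addr_ge0]; rewrite subr_ge0.
Qed.

Lemma cc_dom z (dz : 'I_3 -> space3 R -> R) f : C1 z dz -> csupp z -> continuous f ->
  (forall x, z x = 0 -> (forall i, dz i x = 0) -> f x = 0) -> cc f.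
Proof.
move=> Cz sz cf f0; split=> //; have [r hr] := C1_csupp Cz sz.
by exists r => x /hr[z0 dz0]; exact: f0.
Qed.

Section positive_solution.
Variables (a b phi psi : space3 R -> R) (dphi : 'I_3 -> space3 R -> R).
Hypotheses (ca : continuous a) (cb : continuous b) (cpsi : continuous psi).
Hypotheses (Cphi : C1 phi dphi) (phi0 : forall x, 0 < phi x).
Hypothesis wphi : weak_solution a b phi psi dphi.
Variables (z : space3 R -> R) (dz : 'I_3 -> space3 R -> R).
Hypotheses (Cz : C1 z dz) (sz : csupp z).

Let phin0 x : phi x != 0. Proof. by rewrite gt_eqF. Qed.

(** The weak equation tested with z^2 / phi. *)
Let int x := 2 * z x * dot3 (dz^~ x) (dphi^~ x) / phi x
  - z x ^+ 2 * dot3 (dphi^~ x) (dphi^~ x) / phi x ^+ 2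
  + (a x - b x * psi x / phi x) * z x ^+ 2.

Let ccint : cc int.
Proof.
have [cphi cdphi _] := Cphi; have [cz cdz _] := Cz.
apply: (cc_dom Cz sz); first by rewrite /int /dot3 /=; cts; move=> x; rewrite expf_neq0.
by move=> x z0 dz0; rewrite /int z0; ring.
Qed.

Let int0 : I int = 0.
Proof.
have Ce := C1M (C1M Cz Cz) (C1V Cphi phin0).
have se : csupp (fun x => z x * z x * (phi x)^-1).
  by have [r hr] := sz; exists r => x /hr ->; rewrite !mul0r.
rewrite -[RHS](wphi Ce se); congr integral3; apply/funext => x.
by rewrite /int /dot3; field.
Qed.

(** The difference with [int] is the square |dz - z dphi / phi|^2 (Picone's identity). *)
Lemma weak_stability :
  0 <= I (fun x => dot3 (dz^~ x) (dz^~ x) + (a x - b x * psi x / phi x) * z x ^+ 2).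
Proof.
have [cphi cdphi _] := Cphi; have [cz cdz _] := Cz.
rewrite -int0; apply: le_integral3 => //.
  apply: (cc_dom Cz sz); first by rewrite /dot3 /=; cts.
  by move=> x z0 dz0; rewrite /dot3 z0 !dz0; ring.
move=> x; rewrite lerD2r -subr_ge0 /dot3; set lhs := (X in 0 <= X).
have -> : lhs = (dz ord0 x - z x * dphi ord0 x / phi x) ^+ 2
   + (dz (inord 1) x - z x * dphi (inord 1) x / phi x) ^+ 2
   + (dz ord_max x - z x * dphi ord_max x / phi x) ^+ 2.
  by rewrite /lhs; field.
by rewrite !addr_ge0// sqr_ge0.
Qed.

Hypotheses (b0 : forall x, 0 <= b x) (psi0 : forall x, 0 <= psi x).

(** A Caccioppoli inequality for log phi: the coupling term b psi / phi has the favourable sign, so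
    of the zero-order terms only the coefficient [a] reaches the right-hand side. *)
Lemma weak_log_caccioppoli :
  I (fun x => z x ^+ 2 * (dot3 (dphi^~ x) (dphi^~ x) / phi x ^+ 2)) <=
  I (fun x => 4 * dot3 (dz^~ x) (dz^~ x) + 2 * a x * z x ^+ 2).
Proof.
have [cphi cdphi _] := Cphi; have [cz cdz _] := Cz.
apply: (@le_integral3_add _ _ (fun x => -2 * int x)).
- apply: (cc_dom Cz sz); first by rewrite /dot3 /=; cts; move=> x; rewrite expf_neq0.
  by move=> x z0 dz0; rewrite z0; ring.
- apply: (cc_dom Cz sz); first by rewrite /dot3 /=; cts.
  by move=> x z0 dz0; rewrite /dot3 z0 !dz0; ring.
- split; first by have cint := ccint.1; cts.
  by have [r hr] := ccint.2; exists r => x /hr ->; rewrite mulr0.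
- by rewrite integral3Z// int0 mulr0.
- move=> x; rewrite -subr_ge0 /int /dot3; set lhs := (X in 0 <= X).
  have -> : lhs = (z x * dphi ord0 x / phi x - 2 * dz ord0 x) ^+ 2
     + (z x * dphi (inord 1) x / phi x - 2 * dz (inord 1) x) ^+ 2
     + (z x * dphi ord_max x / phi x - 2 * dz ord_max x) ^+ 2
     + 2 * (b x * psi x / phi x * z x ^+ 2).
    by rewrite /lhs; field.
  apply: addr_ge0; first by rewrite !addr_ge0// sqr_ge0.
  by rewrite mulr_ge0// mulr_ge0 ?sqr_ge0// divr_ge0 ?mulr_ge0// ltW.
Qed.
End positive_solution.

End weak.

(** * Symmetry of second derivatives and the differentiated equation *)

Section second_order.
Variable R : realType.
Local Notation I := (@integral3 R).
Implicit Types (f g : space3 R -> R) (df dg : 'I_3 -> space3 R -> R).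

Lemma MVT_line f df (i : 'I_3) (x : space3 R) (h : R) : C1 f df -> 0 < h ->
  exists c, 0 < c < h /\
    f (h *: basis3 R i + x) - f x = h * df i (c *: basis3 R i + x).
Proof.
move=> [cf _ fd] h0.
have fdl s : is_derive s (1 : R) (fun s : R => f (s *: basis3 R i + x)) (df i (s *: basis3 R i + x)).
  by apply: is_derive_along => y; exact: fd.
have cl : {within `[0, h], continuous (fun s : R => f (s *: basis3 R i + x))}.
  apply: continuous_subspaceT => s; apply/differentiable_continuous/derivable1_diffP.
  by case: (fdl s).
have [c] := MVT h0 (fun s _ => fdl s) cl.
rewrite in_itv /= => ch; rewrite scale0r add0r subr0 mulrC => e.
by exists c.
Qed.

Lemma norm_basis3 (i : 'I_3) : `|basis3 R i| = 1.
Proof.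
rewrite /basis3 prod_normE /= prod_normE /=; case: i => -[|[|[|//]]] ilt /=;
by rewrite !(normr0, normr1) !maxEle ?lexx ?ler01 ?ler10 ?lexx ?ler01.
Qed.

Lemma norm_line (i : 'I_3) (c h : R) (x : space3 R) : 0 < c < h ->
  `|c *: basis3 R i + x| <= h + `|x|.
Proof.
move=> /andP[c0 ch]; apply: (le_trans (ler_normD _ _)).
by rewrite normrZ norm_basis3 mulr1 lerD2r gtr0_norm// ltW.
Qed.

Lemma C1_shift f df (v : space3 R) : C1 f df ->
  C1 (fun x => f (v + x)) (fun i x => df i (v + x)).
Proof.
move=> [cf cdf fd].
have csh : continuous (fun x : space3 R => v + x).
  by move=> x; apply: cvgD; [exact: cvg_cst|exact: cvg_id].
split.
- by move=> x; apply: (continuous_comp (g := f)); [exact: csh|exact: cf].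
- by move=> i x; apply: (continuous_comp (g := df i)); [exact: csh|exact: cdf].
- move=> i x; apply: (is_derive_line _ x (basis3 R i) _).2.
  rewrite (_ : (fun _ => _) = (fun s : R => f (s *: basis3 R i + (v + x)))).
    exact: (is_derive_line f (v + x) (basis3 R i) _).1 (fd i (v + x)).
  by apply/funext => s; rewrite addrCA.
Qed.

Variables (f : space3 R -> R) (df : 'I_3 -> space3 R -> R)
  (ddf : 'I_3 -> 'I_3 -> space3 R -> R).
Hypotheses (Cf : C1 f df) (Cdf : forall i, C1 (df i) (ddf i)).

Lemma second_difference (i j : 'I_3) (x : space3 R) (h : R) : 0 < h ->
  exists c d, [/\ 0 < c < h, 0 < d < h &
   f (h *: basis3 R i + (h *: basis3 R j + x)) - f (h *: basis3 R i + x)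
     - (f (h *: basis3 R j + x) - f x) =
   h * (h * ddf i j (d *: basis3 R j + (c *: basis3 R i + x)))].
Proof.
move=> h0.
have Cg := C1D (C1_shift (h *: basis3 R j) Cf) (C1N Cf).
have [c [ch /=]] := MVT_line i x Cg h0.
have [d [dh e]] := MVT_line j (c *: basis3 R i + x) (Cdf i) h0.
rewrite e => eq; exists c, d; split=> //; rewrite -eq.
by rewrite [X in f X - _ - _]addrCA.
Qed.

(** The second difference is symmetric in i and j, and the mean value theorem evaluates it as either
    mixed derivative at a point less than 2 h from x. Hence [h] is a third of the radius on which
    both derivatives are nearly constant. *)
Lemma Schwarz (i j : 'I_3) (x : space3 R) : ddf i j x = ddf j i x.
Proof.
apply/eqP; rewrite -subr_eq0 -normr_le0; apply/ler_addgt0Pl => e e0; rewrite addr0.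
have e2 : 0 < e / 2 by rewrite divr_gt0.
have [cij cji] : continuous (ddf i j) /\ continuous (ddf j i) by split; [case: (Cdf i)|case: (Cdf j)].
have /cvgrPdist_le /(_ _ e2) := cij x.
have /cvgrPdist_le /(_ _ e2) := cji x.
move=> /nbhs_ballP[r1 /= r10 h1] /nbhs_ballP[r2 /= r20 h2].
pose h := Num.min r1 r2 / 3.
have m0 : 0 < Num.min r1 r2 by rewrite lt_min r10.
have h0 : 0 < h by rewrite divr_gt0.
have near c d (k l : 'I_3) : 0 < c < h -> 0 < d < h ->
    `|x - (d *: basis3 R l + (c *: basis3 R k + x))| < Num.min r1 r2.
  move=> /andP[c0 ch] /andP[d0 dh].
  rewrite addrA opprD addrCA subrr addr0 normrN.
  rewrite (le_lt_trans (ler_normD _ _))// !normrZ !norm_basis3 !mulr1 !gtr0_norm//.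
  by rewrite /h in ch dh; lra.
have [c [d [ch dh e1]]] := second_difference i j x h0.
have [c' [d' [ch' dh' e1']]] := second_difference j i x h0.
have {e1 e1'} E : ddf i j (d *: basis3 R j + (c *: basis3 R i + x))
    = ddf j i (d' *: basis3 R i + (c' *: basis3 R j + x)).
  apply: (mulfI (lt0r_neq0 h0)); apply: (mulfI (lt0r_neq0 h0)).
  rewrite -e1 -e1' [h *: basis3 R i + (h *: _ + _)]addrCA; ring.
have n1 := near c d i j ch dh; have n2 := near c' d' j i ch' dh'.
have b2 := h2 (d *: basis3 R j + (c *: basis3 R i + x)).
have b1 := h1 (d' *: basis3 R i + (c' *: basis3 R j + x)).
rewrite -ball_normE /= in b1 b2.
move: n1 n2; rewrite !lt_min => /andP[_ /b2 {}b2] /andP[/b1 {}b1 _].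
rewrite E in b2.
set y := ddf j i (_ + _) in b1 b2.
rewrite (_ : ddf i j x - ddf j i x = (ddf i j x - y) - (ddf j i x - y)); last by ring.
apply: (le_trans (ler_normB _ _)); lra.
Qed.

End second_order.

Section linearised.
Variable R : realType.
Local Notation I := (@integral3 R).

Definition diff_quot (j : 'I_3) (h : R) (f : space3 R -> R) (x : space3 R) : R :=
  h^-1 * (f (h *: basis3 R j + x) - f x).

Lemma diff_quot_bound f df j (r : R) : C1 f df -> exists2 M : R, 0 < M &
  forall h x, 0 < h <= 1 -> `|x| <= r -> `|diff_quot j h f x| <= M.
Proof.
move=> Cf; have [_ cdf _] := Cf.
have [M M0 hM] := continuous_bounded_box3 (1 + r) (cdf j).
exists M => // h x /andP[h0 h1] xr.
have [c [ch e]] := MVT_line j x Cf h0.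
rewrite /diff_quot e mulKf ?gt_eqF//; apply: hM.
by rewrite (le_trans (norm_line _ _ ch))// lerD.
Qed.

Lemma diff_quot_cvg f df j x : C1 f df ->
  (fun n => diff_quot j (n.+1%:R^-1) f x) @ \oo --> df j x.
Proof.
move=> Cf; have [_ cdf _] := Cf.
apply/cvgrPdist_le => e e0.
have /cvgrPdist_le /(_ _ e0) /nbhs_ballP[r /= r0 hr] := cdf j x.
near=> n.
have n0 : 0 < n.+1%:R^-1 :> R by rewrite invr_gt0 ltr0n.
have [c [ch E]] := MVT_line j x Cf n0.
rewrite /diff_quot E mulKf ?gt_eqF//; apply: hr.
rewrite -ball_normE /= opprD addrCA subrr addr0 normrN normrZ norm_basis3 mulr1.
move: ch => /andP[c0 cn]; rewrite gtr0_norm// (lt_le_trans cn)//.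
apply: ltW; near: n; exact: (near_infty_natSinv_lt (PosNum r0)).
Unshelve. all: by end_near. Qed.

Lemma C1_diff_quot f df j h : C1 f df ->
  C1 (diff_quot j h f) (fun i => diff_quot j h (df i)).
Proof.
move=> Cf; apply: (eq_C1 (C1M (C1_cst (h^-1)) (C1D (C1_shift (h *: basis3 R j) Cf) (C1N Cf)))) => //.
by move=> i x; rewrite mul0r add0r.
Qed.

Variables (w g : space3 R -> R) (dw dg : 'I_3 -> space3 R -> R)
  (ddw : 'I_3 -> 'I_3 -> space3 R -> R).
Hypotheses (Cw : C1 w dw) (Cdw : forall i, C1 (dw i) (ddw i)) (Cg : C1 g dg).
Hypothesis laplace_w : forall x,
  ddw ord0 ord0 x + ddw (inord 1) (inord 1) x + ddw ord_max ord_max x = g x.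

(** This differentiates Δw = g although [w] has no third derivatives: the divergence theorem is
    applied to difference quotients of [dw] in direction j, and the step tends to 0 by dominated
    convergence. [Schwarz] identifies the limits d_j (d_i w) with the gradient of [dw j]. *)
Lemma weak_derived_laplace (j : 'I_3) eta deta : C1 eta deta -> csupp eta ->
  I (fun x => dot3 (ddw j ^~ x) (deta ^~ x) + dg j x * eta x) = 0.
Proof.
move=> Ce se.
pose F n x := dot3 (fun i => diff_quot j (n.+1%:R^-1) (dw i) x) (deta ^~ x)
  + diff_quot j (n.+1%:R^-1) g x * eta x.
have [ceta cdeta _] := Ce; have [cg cdg _] := Cg.
have ccF n : cc (F n).
  have cq i : continuous (diff_quot j (n.+1%:R^-1) (dw i)) by case: (C1_diff_quot j n.+1%:R^-1 (Cdw i)).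
  have cqg : continuous (diff_quot j (n.+1%:R^-1) g) by case: (C1_diff_quot j n.+1%:R^-1 Cg).
  apply: (cc_dom Ce se); first by rewrite /F /dot3 /=; cts.
  by move=> x e0 de0; rewrite /F /dot3 e0 !de0; ring.
have IF n : I (F n) = 0.
  pose h : R := n.+1%:R^-1.
  have CV i := C1M (C1_diff_quot j h (Cdw i)) Ce.
  have sV i : csupp (fun x => diff_quot j h (dw i) x * eta x).
    by have [r hr] := se; exists r => x /hr ->; rewrite mulr0.
  have e0 := integral3_derive_eq0 ord0 (CV ord0) (sV ord0).
  have e1 := integral3_derive_eq0 (inord 1) (CV (inord 1)) (sV (inord 1)).
  have e2 := integral3_derive_eq0 ord_max (CV ord_max) (sV ord_max).
  have ccV i k : cc (fun x => diff_quot j h (ddw i k) x * eta x + diff_quot j h (dw i) x * deta k x).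
    split; first by case: (CV i) => _ + _; exact.
    by have := csupp_derive k (CV i) (sV i).
  have ccVV i k i' k' : cc (fun x => (diff_quot j h (ddw i k) x * eta x + diff_quot j h (dw i) x * deta k x) +
     (diff_quot j h (ddw i' k') x * eta x + diff_quot j h (dw i') x * deta k' x)).
    split; first by apply: contD; [exact: (ccV i k).1|exact: (ccV i' k').1].
    have [r hr] := (ccV i k).2; have [s hs] := (ccV i' k').2.
    by exists (Num.max r s) => x; rewrite gt_max => /andP[/hr -> /hs ->]; rewrite addr0.
  transitivity (0 + 0 + 0 : R); last by rewrite !addr0.
  rewrite -{1}e0 -{1}e1 -e2 -integral3D// -integral3D//.
  congr integral3; apply/funext => x; rewrite /F /dot3 /diff_quot -/h -!laplace_w; ring.
have cF x : (fun n => F n x) @ \oo --> dot3 (ddw j ^~ x) (deta ^~ x) + dg j x * eta x.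
  rewrite /F /dot3 !(Schwarz Cw Cdw j).
  by repeat apply: cvgD; apply: cvgM; (exact: cvg_cst || exact: diff_quot_cvg).
have [r hr] := C1_csupp Ce se.
have [M0 M00 hM0] := diff_quot_bound j r (Cdw ord0).
have [M1 M10 hM1] := diff_quot_bound j r (Cdw (inord 1)).
have [M2 M20 hM2] := diff_quot_bound j r (Cdw ord_max).
have [M3 M30 hM3] := diff_quot_bound j r Cg.
pose G x := M0 * `|deta ord0 x| + M1 * `|deta (inord 1) x| + M2 * `|deta ord_max x| + M3 * `|eta x|.
have ccG : cc G.
  apply: (cc_dom Ce se); first by rewrite /G; cts.
  by move=> x e0 de0; rewrite /G e0 !de0 !normr0; ring.
have FG n x : `|F n x| <= G x.
  have h01 : 0 < (n.+1%:R^-1 : R) <= 1.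
    by rewrite invr_gt0 ltr0n invf_le1 ?ltr0n// ler1n.
  have [xr|rx] := leP `|x| r; last first.
    by have [e0 de0] := hr _ rx; rewrite /F /G /dot3 e0 !de0 !normr0 !mulr0 !addr0 normr0.
  rewrite /F /G /dot3.
  apply: (le_trans (ler_normD _ _)); apply: lerD; last by rewrite normrM; apply: ler_wpM2r => //; exact: hM3.
  apply: (le_trans (ler_normD _ _)); apply: lerD; last by rewrite normrM; apply: ler_wpM2r => //; exact: hM2.
  apply: (le_trans (ler_normD _ _)); apply: lerD; last by rewrite normrM; apply: ler_wpM2r => //; exact: hM1.
  by rewrite normrM; apply: ler_wpM2r => //; exact: hM0.
have mF n : measurable_fun setT (EFin \o F n).
  by apply/measurable_EFinP; apply: continuous_measurable3; exact: (ccF n).1.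
have cE x : (setT : set (space3 R)) x -> (EFin \o F n) x @[n --> \oo] -->
    (EFin \o (fun x => dot3 (ddw j ^~ x) (deta ^~ x) + dg j x * eta x)) x.
  by move=> _; apply: cvg_EFin; [exact: nearW|exact: cF].
have cvgF := @dominated_cvg _ _ R (lebesgue3 R) setT measurableT (fun n => EFin \o F n)
  _ (EFin \o G) mF cE (fun _ _ => erefl) (cc_integrable ccG) (fun n x _ => FG n x).
have F0 n : (\int[lebesgue3 R]_x ((EFin \o F n) x) = 0)%E.
  rewrite -[LHS]fineK; last exact: (integrable_fin_num measurableT (cc_integrable (ccF n))).
  by rewrite -[0%E]/((0 : R)%:E) -(IF n).
move: cvgF; under eq_fun do rewrite F0.
rewrite /integral3 /Rintegral => /(cvg_lim (@ereal_hausdorff _)); rewrite lim_cst//.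
by move=> <-.
Qed.

End linearised.

(** * C2 functions at a maximum point *)

Section C2.
Variable R : realType.
Implicit Types (f g : space3 R -> R) (df dg : 'I_3 -> space3 R -> R)
  (ddf ddg : 'I_3 -> 'I_3 -> space3 R -> R).

Definition C2 f df ddf := C1 f df /\ forall i, C1 (df i) (ddf i).

Definition lap3 ddf (x : space3 R) : R :=
  ddf ord0 ord0 x + ddf (inord 1) (inord 1) x + ddf ord_max ord_max x.

Lemma C2_cst (c : R) : C2 (fun=> c) (fun _ _ => 0) (fun _ _ _ => 0).
Proof. by split=> [|i]; exact: C1_cst. Qed.

Lemma C2D f df ddf g dg ddg : C2 f df ddf -> C2 g dg ddg ->
  C2 (fun x => f x + g x) (fun i x => df i x + dg i x) (fun i j x => ddf i j x + ddg i j x).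
Proof. by move=> [? ?] [? ?]; split=> [|i]; exact: C1D. Qed.

Lemma C2N f df ddf : C2 f df ddf ->
  C2 (fun x => - f x) (fun i x => - df i x) (fun i j x => - ddf i j x).
Proof. by move=> [? ?]; split=> [|i]; exact: C1N. Qed.

Lemma C2M f df ddf g dg ddg : C2 f df ddf -> C2 g dg ddg ->
  C2 (fun x => f x * g x) (fun i x => df i x * g x + f x * dg i x)
     (fun i j x => ddf i j x * g x + df i x * dg j x + (df j x * dg i x + f x * ddg i j x)).
Proof. by move=> [? Cdf] [? Cdg]; split=> [|i]; [exact: C1M|apply: C1D; exact: C1M]. Qed.

Lemma C2_shift f df ddf v : C2 f df ddf ->
  C2 (fun x => f (v + x)) (fun i x => df i (v + x)) (fun i j x => ddf i j (v + x)).
Proof. by move=> [? Cdf]; split=> [|i]; exact: C1_shift. Qed.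

Lemma eq_C2 f df ddf g dg ddg : C2 f df ddf -> (forall x, f x = g x) ->
  (forall i x, df i x = dg i x) -> (forall i j x, ddf i j x = ddg i j x) -> C2 g dg ddg.
Proof.
move=> [Cf Cdf] e de dde; split=> [|i]; first exact: eq_C1 Cf e de.
exact: eq_C1 (Cdf i) (de i) (dde i).
Qed.

Lemma local_max f df ddf x0 r (i : 'I_3) : C2 f df ddf -> 0 < r ->
  (forall x, `|x - x0| < r -> f x <= f x0) -> df i x0 = 0 /\ ddf i i x0 <= 0.
Proof.
move=> [Cf Cdf] r0 fx0.
have [_ cdf _] := Cf; have [_ cddf _] := Cdf i.
have pos g : continuous g -> 0 < g x0 ->
    exists2 s, 0 < s & forall x, `|x - x0| < s -> 0 < g x.
  move=> cg g0; have : \forall x \near x0, 0 < g x by exact: (cvgr_gt (g x0) (cg x0) 0 g0).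
    move=> /nbhs_ballP[s /= s0 hs].
  by exists s => // x xs; apply: hs; rewrite -ball_normE /= distrC.
have line c h : 0 < c < h -> `|c *: basis3 R i + x0 - x0| < h.
  by move=> /andP[c0 ch]; rewrite addrK normrZ norm_basis3 mulr1 gtr0_norm.
have d1 : df i x0 <= 0.
  rewrite leNgt; apply/negP => /(pos _ (cdf i))[s s0 hs].
  pose h := Num.min s r / 2.
  have m0 : 0 < Num.min s r by rewrite lt_min s0.
  have h0 : 0 < h by rewrite divr_gt0.
  have [c [ch e]] := MVT_line i x0 Cf h0.
  have hm : h < Num.min s r by rewrite /h ltr_pdivrMr// ltr_pMr// ltr1n.
  have : `|h *: basis3 R i + x0 - x0| < Num.min s r by apply: line; rewrite h0.
  rewrite lt_min => /andP[_ /fx0]; rewrite -subr_le0 e leNgt => /negP; apply.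
  rewrite mulr_gt0//; apply: hs; apply: lt_trans (line _ _ ch) _.
  by move: hm; rewrite lt_min => /andP[].
have d2 : 0 <= df i x0.
  rewrite leNgt; apply/negP; rewrite -oppr_gt0.
  move=> /(pos (fun x => - df i x) (contN (cdf i)))[s s0 hs].
  pose h := Num.min s r / 2.
  have m0 : 0 < Num.min s r by rewrite lt_min s0.
  have h0 : 0 < h by rewrite divr_gt0.
  have hm : h < Num.min s r by rewrite /h ltr_pdivrMr// ltr_pMr// ltr1n.
  have [c [ch e]] := MVT_line i (- h *: basis3 R i + x0) Cf h0.
  have : `|- h *: basis3 R i + x0 - x0| < Num.min s r.
    by rewrite addrK normrZ norm_basis3 mulr1 normrN gtr0_norm.
  rewrite lt_min => /andP[_ /fx0].
  move: e; rewrite addrA -scalerDl subrr scale0r add0r => e.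
  rewrite -subr_ge0 e pmulr_rge0// leNgt -oppr_gt0 => /negP; apply.
  apply: hs; rewrite addrA -scalerDl addrK normrZ norm_basis3 mulr1 distrC.
  move: ch => /andP[c0 ch]; rewrite ger0_norm ?subr_ge0 1?ltW//.
  by move: hm; rewrite lt_min => /andP[hs1 _]; lra.
have d0 : df i x0 = 0 by apply/eqP; rewrite eq_le d1.
split=> //.
rewrite leNgt; apply/negP => /(pos _ (cddf i))[s s0 hs].
pose h := Num.min s r / 2.
have m0 : 0 < Num.min s r by rewrite lt_min s0.
have h0 : 0 < h by rewrite divr_gt0.
have hm : h < Num.min s r by rewrite /h ltr_pdivrMr// ltr_pMr// ltr1n.
have [c [ch e]] := MVT_line i x0 Cf h0.
have c0 : 0 < c by case/andP: ch.
have [d [dc e']] := MVT_line i x0 (Cdf i) c0.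
have : `|h *: basis3 R i + x0 - x0| < Num.min s r by apply: line; rewrite h0.
rewrite lt_min => /andP[_ /fx0]; rewrite -subr_le0 e leNgt => /negP; apply.
move: e'; rewrite d0 subr0 => ->.
rewrite !mulr_gt0//; apply: hs; apply: lt_trans (line _ _ dc) _.
by move: hm ch; rewrite lt_min => /andP[hs1 _] /andP[_ ch]; lra.
Qed.

Lemma local_max_lap f df ddf x0 r : C2 f df ddf -> 0 < r ->
  (forall x, `|x - x0| < r -> f x <= f x0) -> lap3 ddf x0 <= 0.
Proof.
move=> Cf r0 fx0.
have [_ a0] := local_max ord0 Cf r0 fx0; have [_ a1] := local_max (inord 1) Cf r0 fx0.
have [_ a2] := local_max ord_max Cf r0 fx0; rewrite /lap3; lra.
Qed.

Definition coord (i : 'I_3) (x : space3 R) : R :=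
  if i == 0%N :> nat then x.1.1 else if i == 1%N :> nat then x.1.2 else x.2.

Lemma coord_line i j (h : R) x : coord i (h *: basis3 R j + x) = h * (i == j)%:R + coord i x.
Proof.
rewrite /coord /basis3.
by case: i => -[|[|[|n]]] lti //; case: j => -[|[|[|m]]] ltj //.
Qed.

Lemma coord_continuous i : continuous (coord i).
Proof.
have c1 : continuous (fun x : space3 R => x.1.1).
  by move=> x; apply: (continuous_comp (f := fst) (g := fst)); exact: cvg_fst.
have c2 : continuous (fun x : space3 R => x.1.2).
  by move=> x; apply: (continuous_comp (f := fst) (g := snd)); [exact: cvg_fst|exact: cvg_snd].
have c3 : continuous (fun x : space3 R => x.2) by move=> x; exact: cvg_snd.
by rewrite /coord; case: (i == _ :> nat) => //; case: (i == _ :> nat).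
Qed.

Lemma C1_coord i : C1 (coord i) (fun j _ => (i == j)%:R).
Proof.
split; first exact: coord_continuous.
  by move=> j; exact: cst_continuous.
move=> j x; apply: (is_derive_line _ x (basis3 R j) _).2.
rewrite (_ : (fun _ => _) = (fun h : R => h * (i == j)%:R + coord i x)); last first.
  by apply/funext => h; rewrite coord_line.
apply: is_derive_eq; rewrite addr0 -[RHS]mulr1 ?mulr0 ?add0r.
by rewrite scaler0 add0r [_ *: _]mulr1 mulr1.
Qed.

Lemma C2_coord i : C2 (coord i) (fun j _ => (i == j)%:R) (fun _ _ _ => 0).
Proof. by split=> [|j]; [exact: C1_coord|exact: C1_cst]. Qed.

Lemma norm_coord i x : `|coord i x| <= `|x|.
Proof.
have /norm_le_box3 [h1 [h2 h3]] := lexx `|x|.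
by rewrite /coord; case: (i == _ :> nat) => //; case: (i == _ :> nat).
Qed.

(** The Euclidean norm squared: barriers need a smooth function, which the sup norm of [space3] is
    not. *)
Definition sqnorm3 (x : space3 R) : R := coord ord0 x ^+ 2 + coord (inord 1) x ^+ 2 + coord ord_max x ^+ 2.

Lemma C2_sqnorm3 : C2 sqnorm3 (fun i x => 2 * coord i x) (fun i j x => 2 * (i == j)%:R).
Proof.
apply: (eq_C2 (C2D (C2D (C2M (C2_coord ord0) (C2_coord ord0)) (C2M (C2_coord (inord 1)) (C2_coord (inord 1))))
  (C2M (C2_coord ord_max) (C2_coord ord_max)))).
- by move=> x; rewrite /sqnorm3; ring.
- move=> i x; have := mem_ord3 i.
  rewrite !inE => /or3P[] /eqP ->; rewrite -!val_eqE /= !inordK//=; ring.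
- move=> i j x; have := mem_ord3 i.
  rewrite !inE => /or3P[] /eqP ->; rewrite -!val_eqE /= !inordK//=;
  by case: (_ == _); rewrite /=; ring.
Qed.

End C2.

(** * Pointwise bounds from maximum points *)

Section bounds.
Variable R : realType.
Implicit Types (f g w u v : space3 R -> R).

Lemma ball_max f (r : R) : continuous f -> 0 <= r ->
  exists2 x0, `|x0| <= r & forall x, `|x| <= r -> f x <= f x0.
Proof.
move=> cf r0.
have ne : box3 r r r !=set0 by exists 0; apply/norm_le_box3; rewrite normr0.
have [c /set_mem cb hc] := compact_EVT_max ne (@compact_box3 R r r r) (continuous_subspaceT cf).
exists c; first exact/norm_le_box3.
by move=> x xr; apply: hc; apply/mem_set/norm_le_box3.
Qed.

Lemma coord0 i : coord i (0 : space3 R) = 0.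
Proof. by rewrite /coord; do 2?case: ifP. Qed.

Lemma sqr_norm_le_sqnorm3 (x : space3 R) : `|x| ^+ 2 <= sqnorm3 x.
Proof.
have [i ->] : exists i, `|x| = `|coord i x|.
  rewrite prod_normE /= prod_normE /= /coord.
  have [_|_] := leP; last first.
    have [_|_] := leP; first by exists (inord 1); rewrite inordK.
    by exists ord0.
  by exists ord_max.
rewrite real_normK ?num_real// /sqnorm3.
have := mem_ord3 i.
have a0 := sqr_ge0 (coord ord0 x); have a1 := sqr_ge0 (coord (inord 1) x).
have a2 := sqr_ge0 (coord ord_max x).
by rewrite !inE => /or3P[] /eqP ->; lra.
Qed.

(* The maximum of [w (r^2 - |x|^2)] over the ball of radius [r] gives a local
   Keller-Osserman bound, uniform as [r] tends to infinity. *)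
Lemma keller_osserman w dw ddw (k : R) : C2 w dw ddw -> (forall x, 0 < w x) -> 0 <= k ->
  (forall x, w x * (w x ^+ 2 / 2 - k) <= lap3 ddw x) -> w 0 ^+ 2 <= 2 * k.
Proof.
move=> Cw w0 k0 hw.
suff main r : 0 < r -> w 0 ^+ 2 <= 2 * k + 16 / r ^+ 2.
  apply/ler_addgt0Pl => e e0.
  have r0 : 0 < Num.sqrt (16 / e) by rewrite sqrtr_gt0 divr_gt0.
  apply: (le_trans (main _ r0)); rewrite sqr_sqrtr; last by rewrite divr_ge0// ltW.
  by rewrite addrC lerD2r le_eqVlt; apply/orP; left; apply/eqP; field; rewrite gt_eqF.
move=> r0; pose t (x : space3 R) := r ^+ 2 + - sqnorm3 x.
have Ct : C2 t _ _ := C2D (C2_cst (r ^+ 2)) (C2N (@C2_sqnorm3 R)).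
have CF := C2M Cw Ct.
have [cF _ _] := CF.1.
have [x0 x0r hx0] := ball_max cF (ltW r0).
have t0 : t 0 = r ^+ 2.
  by rewrite /t /sqnorm3 !coord0; ring.
have F0 : 0 < w 0 * t 0 by rewrite t0 mulr_gt0// exprn_gt0.
have Fx0 : w 0 * t 0 <= w x0 * t x0 by apply: hx0; rewrite normr0 ltW.
(* [ball_max] works on a sup-norm ball, a cube whose corners lie outside the Euclidean ball where
   [t] is positive. Comparison with the origin gives [t x0 > 0], which makes the maximum point
   interior. *)
have tx0 : 0 < t x0 by rewrite -(pmulr_rgt0 _ (w0 x0)) (lt_le_trans F0).
have x0lt : `|x0| < r.
  rewrite -(@ltr_pXn2r _ 2) ?nnegrE// 1?ltW//.
  by rewrite (le_lt_trans (sqr_norm_le_sqnorm3 _))// -subr_gt0.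
have e0 : 0 < r - `|x0| by rewrite subr_gt0.
have hmax x : `|x - x0| < r - `|x0| -> w x * t x <= w x0 * t x0.
  move=> xx0; apply: hx0; rewrite -(subrK x0 x) (le_trans (ler_normD _ _))//; lra.
have := local_max_lap CF e0 hmax.
have [/= d0 _] := local_max ord0 CF e0 hmax.
have [/= d1 _] := local_max (inord 1) CF e0 hmax.
have [/= d2 _] := local_max ord_max CF e0 hmax.
rewrite /lap3 /= !eqxx !mulr1 => dd.
have hL := hw x0; have wx0 := w0 x0.
have St : sqnorm3 x0 = r ^+ 2 - t x0 by rewrite /t; ring.
rewrite /sqnorm3 in St.
rewrite /lap3 in hL.
set W := w x0 in d0 d1 d2 dd hL wx0 Fx0. set T := t x0 in d0 d1 d2 dd tx0 St Fx0.
set a0 := coord _ _ in d0 dd St; set a1 := coord _ _ in d1 dd St; set a2 := coord _ _ in d2 dd St.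
set L := _ + _ + _ in hL.
(* At the maximum T grad w = 2 W x and T L <= 4 x . grad w + 6 W, hence T^2 L <= W (8 |x|^2 + 6 T)
   with |x|^2 = r^2 - T. The error 16 / r^2 is twice this 8 r^2, divided by r^4. *)
have key : W * ((W ^+ 2 / 2 - k) * T ^+ 2) <= W * (8 * r ^+ 2).
  have h1 : W * ((W ^+ 2 / 2 - k) * T ^+ 2) <= L * T ^+ 2.
    by rewrite mulrA ler_wpM2r ?sqr_ge0.
  have h2 : L * T ^+ 2 <= 4 * (dw ord0 x0 * T * a0 + dw (inord 1) x0 * T * a1
      + dw ord_max x0 * T * a2) + 6 * W * T.
    have -> : L * T ^+ 2 = (L * T) * T by ring.
    rewrite (_ : _ + _ = (4 * (dw ord0 x0 * a0 + dw (inord 1) x0 * a1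
      + dw ord_max x0 * a2) + 6 * W) * T); last by ring.
    rewrite ler_wpM2r ?(ltW tx0)//; rewrite -subr_ge0; move: dd; rewrite -oppr_ge0.
    by congr (0 <= _); rewrite /L; ring.
  have {}d0 : dw ord0 x0 * T = 2 * W * a0 by lra.
  have {}d1 : dw (inord 1) x0 * T = 2 * W * a1 by lra.
  have {}d2 : dw ord_max x0 * T = 2 * W * a2 by lra.
  rewrite d0 d1 d2 in h2; apply: (le_trans h1); apply: (le_trans h2).
  have -> : 4 * (2 * W * a0 * a0 + 2 * W * a1 * a1 + 2 * W * a2 * a2) + 6 * W * T
     = W * (8 * (r ^+ 2 - T) + 6 * T) by rewrite -St; ring.
  by rewrite ler_wpM2l ?ltW//; lra.
rewrite (ler_pM2l wx0) in key.
have Tr : T <= r ^+ 2.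
  by rewrite -subr_ge0 -St !addr_ge0// sqr_ge0.
have r2 : 0 < r ^+ 2 by rewrite exprn_gt0.
have T2 : T ^+ 2 <= (r ^+ 2) ^+ 2 by rewrite ler_pXn2r// nnegrE ltW.
have kT : k * T ^+ 2 <= k * (r ^+ 2) ^+ 2 by rewrite ler_wpM2l.
have : (w 0 * t 0) ^+ 2 <= (W * T) ^+ 2 by rewrite ler_pXn2r// nnegrE ltW// mulr_gt0.
rewrite t0 !exprMn => h.
rewrite -(ler_pM2r (exprn_gt0 2 r2)); apply: (le_trans h).
rewrite [X in _ <= X](_ : _ = 2 * (k * (r ^+ 2) ^+ 2) + 16 * r ^+ 2); last by field; rewrite gt_eqF.
lra.
Qed.

(* At the maximum point of [t^3 / (u v)], [t = 16 - |x|^2], the weights are such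
   that the contribution of [grad u . grad v] is absorbed by completing the square. *)
Lemma product_lower_bound u v du dv ddu ddv (alpha omega : R) :
  C2 u du ddu -> C2 v dv ddv -> (forall x, 0 < u x) -> (forall x, 0 < v x) ->
  0 < alpha -> 0 < omega ->
  (forall x, lap3 ddu x = u x * (u x ^+ 2 + v x ^+ 2 - 1) + v x * (alpha * u x * v x - omega)) ->
  (forall x, lap3 ddv x = v x * (u x ^+ 2 + v x ^+ 2 - 1) + u x * (alpha * u x * v x - omega)) ->
  omega <= (2 + alpha) * (u 0 * v 0).
Proof.
move=> Cu Cv u0 v0 alpha0 omega0 equ eqv.
(* With s in place of 16, the contradiction at the end needs T^2 - 12 T + 3 s > 0 for all T, that is
   s > 12; the square 16 gives the radius 4. *)
pose t (x : space3 R) := 16 + - sqnorm3 x.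
have Ct : C2 t _ _ := C2D (C2_cst 16) (C2N (@C2_sqnorm3 R)).
have cu : continuous u by case: Cu => -[].
have cv : continuous v by case: Cv => -[].
have ct : continuous t by case: Ct => -[].
have uv0 x : 0 < u x * v x by rewrite mulr_gt0.
have uvn0 x : u x * v x != 0 by rewrite gt_eqF.
have cF : continuous (fun x => t x ^+ 3 * (u x * v x)^-1) by cts.
have [x0 x0r hx0] := ball_max cF (ler0n _ 4).
have t0 : t 0 = 16 by rewrite /t /sqnorm3 !coord0; ring.
pose m := t x0 ^+ 3 * (u x0 * v x0)^-1.
have Fx0 : 16 ^+ 3 * (u 0 * v 0)^-1 <= m by rewrite -t0; apply: hx0; rewrite normr0.
have m0 : 0 < m by apply: lt_le_trans Fx0; rewrite mulr_gt0 ?invr_gt0// exprn_gt0.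
have tx0 : 0 < t x0.
  move: m0; rewrite /m pmulr_lgt0 ?invr_gt0// !exprS expr0 mulr1 => h.
  by rewrite ltNge; apply/negP => tl; move: h; rewrite ltNge mulr_le0_ge0// mulr_le0.
have x0lt : `|x0| < 4.
  rewrite -(@ltr_pXn2r _ 2) ?nnegrE//.
  rewrite (le_lt_trans (sqr_norm_le_sqnorm3 _))//; move: tx0; rewrite /t; lra.
have e0 : 0 < 4 - `|x0| by rewrite subr_gt0.
(* The maximum is restated without quotient: t^3 - m u v is nonpositive and vanishes at [x0]. *)
have CG := C2D (C2M Ct (C2M Ct Ct)) (C2N (C2M (C2_cst m) (C2M Cu Cv))).
have hmax x : `|x - x0| < 4 - `|x0| -> t x * (t x * t x) + - (m * (u x * v x)) <=
    t x0 * (t x0 * t x0) + - (m * (u x0 * v x0)).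
  move=> xx0; have x4 : `|x| <= 4.
    rewrite -(subrK x0 x) (le_trans (ler_normD _ _))//; lra.
  rewrite [X in _ <= X](_ : _ = 0); last by rewrite /m; field; rewrite !gt_eqF.
  rewrite subr_le0 -ler_pdivrMr//.
  by have := hx0 _ x4; rewrite -/m !exprS expr0 mulr1.
have := local_max_lap CG e0 hmax.
have [/= d0 _] := local_max ord0 CG e0 hmax.
have [/= d1 _] := local_max (inord 1) CG e0 hmax.
have [/= d2 _] := local_max ord_max CG e0 hmax.
rewrite /lap3 /= !eqxx !mulr1 => dd.
have hu := equ x0; have hv := eqv x0; have ux0 := u0 x0; have vx0 := v0 x0.
have St : sqnorm3 x0 = 16 - t x0 by rewrite /t; ring.
have mE : m * (u x0 * v x0) = t x0 ^+ 3 by rewrite /m mulfVK.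
rewrite /sqnorm3 in St.
rewrite /lap3 in hu hv.
set T := t x0 in d0 d1 d2 dd tx0 St mE.
set a0 := coord _ _ in d0 dd St; set a1 := coord _ _ in d1 dd St; set a2 := coord _ _ in d2 dd St.
set U := u x0 in d0 d1 d2 dd hu hv ux0 mE; set V := v x0 in d0 d1 d2 dd hu hv vx0 mE.
have UV0 : 0 < U * V by rewrite mulr_gt0.
have T16 : T <= 16 by rewrite -subr_ge0 -St !addr_ge0// sqr_ge0.
suff h : omega <= (2 + alpha) * (U * V).
  rewrite (le_trans h)// ler_wpM2l//; first by rewrite addr_ge0// ltW.
  have T3 : T ^+ 3 <= 16 ^+ 3 by rewrite lerXn2r// nnegrE ltW.
  have : 16 ^+ 3 * (u 0 * v 0)^-1 <= 16 ^+ 3 * (U * V)^-1.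
    by apply: (le_trans Fx0); rewrite /m ler_wpM2r ?invr_ge0// ltW.
  by rewrite ler_pM2l ?exprn_gt0// lef_pV2 ?posrE.
rewrite leNgt; apply/negP => hlt.
(* The vanishing first derivative gives m (p V + U q) = -6 T^2 a; with 4 U V p q <= (p V + U q)^2
   and m U V = T^3 this bounds the mixed term m p q. *)
have key (p q a : R) : (0 - 2 * a) * (T * T) + T * ((0 - 2 * a) * T + T * (0 - 2 * a)) -
    (0 * (U * V) + m * (p * V + U * q)) = 0 -> m * (p * q) <= 9 * T * a ^+ 2.
  move=> h; have {}h : m * (p * V + U * q) = - 6 * T ^+ 2 * a.
    by apply/esym/eqP; rewrite -subr_eq0 -h; apply/eqP; ring.
  have h4 : 4 * (m * (U * V)) * (m * (p * q)) <= (m * (p * V + U * q)) ^+ 2.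
    rewrite -subr_ge0 (_ : _ - _ = (m * (p * V - U * q)) ^+ 2) ?sqr_ge0//; ring.
  rewrite h mE in h4.
  have T4 : 0 < 4 * T ^+ 3 by rewrite mulr_gt0// exprn_gt0.
  rewrite -(ler_pM2l T4); apply: (le_trans h4).
  by apply: eq_ler; ring.
have {d0} k0 := key _ _ _ d0; have {d1} k1 := key _ _ _ d1; have {d2} k2 := key _ _ _ d2.
set P0 := m * _ in k0; set P1 := m * _ in k1; set P2 := m * _ in k2.
set Lu := _ + _ + _ in hu; set Lv := _ + _ + _ in hv.
have {}dd : - 18 * T ^+ 2 + 24 * T * (a0 ^+ 2 + a1 ^+ 2 + a2 ^+ 2) - 2 * (P0 + P1 + P2)
    <= m * (V * Lu + U * Lv).
  by rewrite -subr_le0; apply: le_trans dd; apply: eq_ler; rewrite /Lu /Lv /P0 /P1 /P2; ring.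
have h5 : 96 * T - 24 * T ^+ 2 <= m * (V * Lu + U * Lv).
  apply: le_trans dd; rewrite St.
  have : P0 + P1 + P2 <= 9 * T * (16 - T) by rewrite -St; lra.
  by rewrite -subr_ge0 => h; rewrite -subr_ge0; move: h; set A := P0 + P1 + P2; lra.
have h6 : m * (V * Lu + U * Lv) <= - 2 * T ^+ 3.
  rewrite hu hv -mE.
  rewrite (_ : m * _ = - 2 * (m * (U * V)) + m * ((U ^+ 2 + V ^+ 2) * ((2 + alpha) * (U * V) - omega))); last by ring.
  rewrite gerDl pmulr_rle0// pmulr_rle0 ?subr_le0 ?ltW//.
  by rewrite addr_gt0// exprn_gt0.
have : 0 < T * (2 * (T - 6) ^+ 2 + 24) by rewrite mulr_gt0// ltr_wpDl// mulr_ge0// sqr_ge0.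
have := le_trans h5 h6; rewrite -subr_ge0 => h7.
rewrite (_ : T * _ = - (- 2 * T ^+ 3 - (96 * T - 24 * T ^+ 2))); last by ring.
by rewrite oppr_gt0 ltNge h7.
Qed.
End bounds.

(** * Interior gradient bound by reflection and a barrier *)

Section gradient_bound.
Variable R : realType.
Implicit Types (f g w : space3 R -> R).

Definition refl3 (i : 'I_3) (x : space3 R) : space3 R := - (2 * coord i x) *: basis3 R i + x.

Definition refl_sign (i j : 'I_3) : R := 1 - 2 * (i == j)%:R.

Lemma refl3_line i j h x : refl3 i (h *: basis3 R j + x) =
  (refl_sign i j * h) *: basis3 R j + refl3 i x.
Proof.
rewrite /refl3 coord_line /refl_sign; have [->|ij] := eqVneq i j.
  by rewrite addrA [RHS]addrA -!scalerDl; congr (_ *: _ + _); rewrite /=; ring.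
rewrite addrCA; congr (_ + _); last by congr (_ *: _ + _); rewrite /=; ring.
by congr (_ *: _); rewrite /=; ring.
Qed.

Lemma C1_refl i f df : C1 f df ->
  C1 (fun x => f (refl3 i x)) (fun j x => refl_sign i j * df j (refl3 i x)).
Proof.
move=> [cf cdf fd].
have cr : continuous (refl3 i).
  move=> x; apply: cvgD; last exact: cvg_id.
  by apply: cvgZl; apply: cvgN; apply: cvgM; [exact: cvg_cst|exact: coord_continuous].
split.
- by move=> x; apply: (continuous_comp (g := f)); [exact: cr|exact: cf].
- move=> j; apply: contM; first exact: cst_continuous.
  by move=> x; apply: (continuous_comp (g := df j)); [exact: cr|exact: cdf].
- move=> j x; apply: (is_derive_line _ x (basis3 R j) _).2.
  rewrite (_ : (fun _ => _) = (fun s : R => f (s *: basis3 R j + refl3 i x)) \o (fun s => refl_sign i j * s)); last first.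
    by apply/funext => s; rewrite /= refl3_line.
  have h1 : is_derive (0 : R) (1 : R) (fun s : R => refl_sign i j * s) (refl_sign i j).
    by apply: is_derive_eq; rewrite [_ *: 1]mulr1.
  rewrite mulrC; apply: is_derive1_comp; rewrite mulr0.
  exact: (is_derive_line f (refl3 i x) (basis3 R j) _).1 (fd j (refl3 i x)).
Qed.

Lemma lap3_refl i f df ddf : C2 f df ddf ->
  exists dg ddg, C2 (fun x => f (refl3 i x)) dg ddg /\ forall x, lap3 ddg x = lap3 ddf (refl3 i x).
Proof.
move=> [Cf Cdf].
exists (fun j x => refl_sign i j * df j (refl3 i x)).
exists (fun j k x => refl_sign i j * (refl_sign i k * ddf j k (refl3 i x))).
split; first split; first exact: C1_refl.
  move=> j; apply: (eq_C1 (C1M (C1_cst (refl_sign i j)) (C1_refl i (Cdf j)))) => // k x.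
  by rewrite mul0r add0r.
have s1 j : refl_sign i j * refl_sign i j = 1.
  by rewrite /refl_sign; case: (i == j) => /=; ring.
by move=> x; rewrite /lap3 !mulrA !s1 !mul1r.
Qed.

(* Comparison with a quadratic barrier on the half cube, applied to the odd
   part of [w] with respect to [x_i] (Gilbarg-Trudinger, Section 3.4). *)
Lemma odd_part_barrier i w dw ddw (M N : R) : C2 w dw ddw -> 0 <= M -> 0 <= N ->
  (forall x, `|w x| <= M) -> (forall x, `|lap3 ddw x| <= N) ->
  forall s, 0 <= s <= 1 ->
  2^-1 * (w (s *: basis3 R i) - w (- s *: basis3 R i)) <= (3 * M + N + 1) * s.
Proof.
move=> Cw M0 N0 wM lN s s01.
have [dg [ddg [Cg lg]]] := lap3_refl i Cw.
(* The Laplacian 6 of |x|^2 is cancelled by that of 3 (x_i - x_i^2), so Δpsi = -2 (N + 1).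
   Subtracting psi makes the odd part strictly subharmonic; psi is at least M where the sup norm is
   1 and nonnegative where x_i = 0 and the odd part vanishes. *)
pose psi (x : space3 R) := M * (sqnorm3 x + (3 * coord i x + - (3 * (coord i x * coord i x))))
   + (N + 1) * (coord i x + - (coord i x * coord i x)).
have Cpsi := C2D (C2M (C2_cst M) (C2D (@C2_sqnorm3 R) (C2D (C2M (C2_cst 3) (C2_coord R i))
     (C2N (C2M (C2_cst 3) (C2M (C2_coord R i) (C2_coord R i)))))))
   (C2M (C2_cst (N + 1)) (C2D (C2_coord R i) (C2N (C2M (C2_coord R i) (C2_coord R i))))).
have Cphi := C2M (C2_cst (2^-1)) (C2D Cw (C2N Cg)).
have CH := C2D Cphi (C2N Cpsi).
rewrite /= in CH.
set H := (X in C2 X) in CH; set dH := (X in C2 _ X) in CH; set ddH := (X in C2 _ _ X) in CH.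
have lH x : lap3 ddH x = 2^-1 * (lap3 ddw x - lap3 ddw (refl3 i x)) + 2 * (N + 1).
  rewrite -lg /lap3 /ddH.
  have := mem_ord3 i.
  by rewrite !inE => /or3P[] /eqP ->; rewrite -!val_eqE /= !inordK//=; field.
have cH : continuous H by case: CH => -[].
pose D := box3 1 1 1 `&` [set x : space3 R | 0 <= coord i x].
have cD : compact D.
  apply: compact_closedI; first exact: compact_box3.
  exact: (closed_comp (fun x _ => @coord_continuous R i x) (@closed_ge R 0)).
have D0 : D !=set0.
  exists 0; split; first by apply/norm_le_box3; rewrite normr0.
  by rewrite /= coord0.
have [x0 /set_mem [bx0 cx0] hx0] := compact_EVT_max D0 cD (continuous_subspaceT cH).
have HE x : H x = 2^-1 * (w x - w (refl3 i x)) - psi x by [].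
have phiM x : 2^-1 * (w x - w (refl3 i x)) <= M.
  have := wM x; have := wM (refl3 i x); rewrite !ler_norml => /andP[a1 a2] /andP[b1 b2].
  lra.
have c01 : 0 <= coord i x0 <= 1.
  rewrite cx0 (le_trans (ler_norm _))// (le_trans (norm_coord _ _))//.
  exact/norm_le_box3.
have cc0 : 0 <= coord i x0 - coord i x0 * coord i x0.
  by case/andP: c01 => c0 c1; rewrite -{1}[coord i x0]mulr1 -mulrBr mulr_ge0// subr_ge0.
have S0 : 0 <= sqnorm3 x0 by rewrite (le_trans (sqr_ge0 _) (sqr_norm_le_sqnorm3 _)).
have H0 : H x0 <= 0.
  move: bx0 => /norm_le_box3; rewrite le_eqVlt => /orP[/eqP x01|x01].
    rewrite HE subr_le0; apply: (le_trans (phiM _)).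
    have S1 : 1 <= sqnorm3 x0.
      by rewrite -[1](expr1n _ 2) -x01; exact: sqr_norm_le_sqnorm3.
    rewrite /psi -[leLHS]addr0 lerD//; last by rewrite mulr_ge0// addr_ge0.
    by rewrite ler_peMr// -[leLHS]addr0 lerD//; lra.
  move: cx0; rewrite /= le_eqVlt => /orP[/eqP cx00|cx0].
    rewrite HE /psi /refl3 -cx00 !mulr0 oppr0 scale0r add0r subrr !mulr0 sub0r oppr_le0.
    by rewrite !(addr0, mulr0) mulr_ge0.
  exfalso.
  pose r := Num.min (coord i x0) (1 - `|x0|).
  have r0 : 0 < r by rewrite lt_min cx0 subr_gt0.
  have hmax x : `|x - x0| < r -> H x <= H x0.
    rewrite lt_min => /andP[xc xr]; apply: hx0; apply/mem_set; split.
      apply/norm_le_box3; rewrite -(subrK x0 x) (le_trans (ler_normD _ _))//; lra.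
    have := norm_coord i (x - x0).
    have -> : coord i (x - x0) = coord i x - coord i x0.
      by rewrite /coord; case: (i == _ :> nat) => //; case: (i == _ :> nat).
    rewrite /= => /le_lt_trans /(_ xc); rewrite ltr_norml => /andP[h _]; lra.
  have := local_max_lap CH r0 hmax; rewrite lH.
  have := lN x0; have := lN (refl3 i x0); rewrite !ler_norml => /andP[a1 a2] /andP[b1 b2].
  rewrite leNgt => /negP; apply; lra.
have [s0 s1] := andP s01.
have coe k : coord k (s *: basis3 R i) = s * (k == i)%:R.
  by rewrite -[s *: _]addr0 coord_line coord0 addr0.
have Ds : D (s *: basis3 R i).
  split; first by apply/norm_le_box3; rewrite normrZ norm_basis3 mulr1 ger0_norm.
  by rewrite /= coe eqxx mulr1.
have : H (s *: basis3 R i) <= 0 by apply: le_trans H0; apply: hx0; apply/mem_set.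
rewrite HE.
have -> : refl3 i (s *: basis3 R i) = - s *: basis3 R i.
  by rewrite /refl3 coe eqxx mulr1 -scalerDl; congr (_ *: _); ring.
rewrite subr_le0 => h; apply: (le_trans h).
have Se : sqnorm3 (s *: basis3 R i) = s ^+ 2.
  rewrite /sqnorm3 !coe.
  have := mem_ord3 i.
  by rewrite !inE => /or3P[] /eqP ->; rewrite -!val_eqE /= !inordK//=; ring.
rewrite /psi Se coe eqxx mulr1 -subr_ge0.
rewrite (_ : _ - _ = 2 * M * s ^+ 2 + (N + 1) * s ^+ 2); last by ring.
by rewrite addr_ge0// mulr_ge0 ?sqr_ge0// ?mulr_ge0// addr_ge0.
Qed.

(** The odd part of [w] in x_i vanishes at 0 and has slope [dw i 0] there, so the slope 3 M + N + 1
    of the barrier bounds it; applying this to [- w] gives the other sign. *)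
Lemma gradient_bound0 i w dw ddw (M N : R) : C2 w dw ddw -> 0 <= M -> 0 <= N ->
  (forall x, `|w x| <= M) -> (forall x, `|lap3 ddw x| <= N) ->
  `|dw i 0| <= 3 * M + N + 1.
Proof.
move=> Cw M0 N0 wM lN; set K := 3 * M + N + 1.
have half f df ddf : C2 f df ddf -> (forall x, `|f x| <= M) ->
    (forall x, `|lap3 ddf x| <= N) -> df i 0 <= K.
  move=> Cf fM lf; apply/ler_addgt0Pr => e e0.
  have [cf0 cdf _] := Cf.1.
  have /cvgrPdist_le /(_ _ e0) /nbhs_ballP[r /= r0 hr] := cdf i (0 : space3 R).
  pose s := Num.min r 1 / 2.
  have m0 : 0 < Num.min r 1 by rewrite lt_min r0 ltr01.
  have s0 : 0 < s by rewrite divr_gt0.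
  have sm : s < Num.min r 1 by rewrite /s ltr_pdivrMr// ltr_pMr// ltr1n.
  have [sr s1] : s < r /\ s < 1 by move: sm; rewrite lt_min => /andP[].
  have s20 : 0 < 2 * s by rewrite mulr_gt0.
  have [c [/andP[c0 c2] E]] := MVT_line i (- s *: basis3 R i) Cf.1 s20.
  have s01 : 0 <= s <= 1 by rewrite !ltW.
  have := odd_part_barrier i Cf M0 N0 fM lf s01.
  have -> : s *: basis3 R i = (2 * s) *: basis3 R i + - s *: basis3 R i.
    by rewrite -scalerDl; congr (_ *: _); ring.
  rewrite E -/K mulrA mulrA mulVf ?pnatr_eq0// mul1r mulrC (ler_pM2r s0) => h.
  have : ball (0 : space3 R) r (c *: basis3 R i + - s *: basis3 R i).
    rewrite -ball_normE /= sub0r normrN -scalerDl normrZ norm_basis3 mulr1.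
    by rewrite ltr_norml; apply/andP; split; lra.
  move=> /hr; rewrite ler_norml => /andP[h1 h2]; lra.
rewrite ler_norml; apply/andP; split; last exact: half Cw wM lN.
rewrite lerNl; apply: (half _ _ _ (C2N Cw)) => x; first by rewrite normrN.
by rewrite /lap3 -!opprD normrN; exact: lN.
Qed.

Lemma gradient_bound i w dw ddw (M N : R) x : C2 w dw ddw -> 0 <= M -> 0 <= N ->
  (forall x, `|w x| <= M) -> (forall x, `|lap3 ddw x| <= N) ->
  `|dw i x| <= 3 * M + N + 1.
Proof.
move=> Cw M0 N0 wM lN; rewrite -[x]addr0.
apply: (gradient_bound0 i (C2_shift x Cw) M0 N0) => y; [exact: wM|exact: lN].
Qed.

End gradient_bound.

(** * One-dimensional cutoffs *)

Section cutoff1.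
Variable R : realType.
Implicit Types t x : R.

Definition pos_part t : R := Num.max t 0.
(** The building block of all cutoffs: its derivative is continuous, which suffices because cutoffs
    are differentiated only once. *)
Definition sqr_pos t : R := pos_part t ^+ 2.

Lemma pos_part_ge0 t : 0 <= pos_part t. Proof. by rewrite le_max lexx orbT. Qed.
Lemma pos_part_id t : 0 <= t -> pos_part t = t. Proof. by move=> t0; rewrite /pos_part max_l. Qed.
Lemma pos_part_0 t : t <= 0 -> pos_part t = 0. Proof. by move=> t0; rewrite /pos_part max_r. Qed.

Lemma pos_part_continuous : continuous pos_part.
Proof.
move=> t; rewrite /pos_part.
have -> : (fun t : R => Num.max t 0) = (fun t => 2^-1 * (t + `|t|)).
  apply/funext => s; have [s0|s0] := leP s 0; first by rewrite ler0_norm// subrr mulr0.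
  by rewrite gtr0_norm//; field.
by apply: cvgM; [exact: cvg_cst|apply: cvgD; [exact: cvg_id|exact: norm_continuous]].
Qed.

Lemma is_derive_sqr_pos t : is_derive t (1 : R) sqr_pos (2 * pos_part t).
Proof.
have [t0|t0|->] := ltgtP t 0.
- rewrite (pos_part_0 (ltW t0)) mulr0.
  apply: near_eq_is_derive (is_derive_cst (0 : R) t 1).
  have : \forall s \near t, s < 0 by exact: lt_nbhsl.
  by apply: filterS => s s0; rewrite /sqr_pos (pos_part_0 (ltW s0)) expr0n.
- rewrite pos_part_id; last exact: ltW.
  apply: (@near_eq_is_derive _ _ _ (fun s : R => s ^+ 2)).
    have : \forall s \near t, 0 < s by exact: lt_nbhsr.
    by apply: filterS => s s0; rewrite /sqr_pos pos_part_id// ltW.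
  by apply: is_derive_eq; rewrite ![_%:A]mulr1; ring.
- rewrite pos_part_0// mulr0; apply/is_derive1_caratheodory.
  exists pos_part; split.
  + move=> s; rewrite subr0 /sqr_pos [pos_part 0]pos_part_0// expr0n subr0.
    have [s0|s0] := leP s 0; first by rewrite pos_part_0// expr0n mul0r.
    by rewrite pos_part_id 1?ltW// expr2.
  + exact: pos_part_continuous.
  + by rewrite pos_part_0.
Qed.

Lemma sqr_pos_ge0 t : 0 <= sqr_pos t. Proof. exact: sqr_ge0. Qed.
Lemma sqr_pos_0 t : t <= 0 -> sqr_pos t = 0.
Proof. by move=> t0; rewrite /sqr_pos pos_part_0// expr0n. Qed.
Lemma sqr_pos_ge1 t : 1 <= t -> 1 <= sqr_pos t.
Proof.
move=> t1; rewrite /sqr_pos pos_part_id; last exact: le_trans t1.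
have t0 : 0 <= t by apply: le_trans t1.
by rewrite -[1](expr1n _ 2) ler_pXn2r// nnegrE.
Qed.

(** A C1 bump: both inner squares vanish on [-1, 1], and one of them is at least 1 outside (-2,
    2). *)
Definition plateau x : R := sqr_pos (1 - sqr_pos (x - 1) - sqr_pos (- x - 1)).
Definition dplateau x : R := 2 * pos_part (1 - sqr_pos (x - 1) - sqr_pos (- x - 1)) *
  (- (2 * pos_part (x - 1)) + 2 * pos_part (- x - 1)).

Lemma is_derive_plateau x : is_derive x (1 : R) plateau (dplateau x).
Proof.
have h1 : is_derive x (1 : R) (fun x => sqr_pos (x - 1)) (2 * pos_part (x - 1) * 1).
  apply: (is_derive1_comp (f := sqr_pos) (g := fun x : R => x - 1)).
    exact: is_derive_sqr_pos.
  by apply: is_derive_eq; rewrite subr0.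
have h2 : is_derive x (1 : R) (fun x => sqr_pos (- x - 1)) (2 * pos_part (- x - 1) * -1).
  apply: (is_derive1_comp (f := sqr_pos) (g := fun x : R => - x - 1)).
    exact: is_derive_sqr_pos.
  by apply: is_derive_eq; rewrite subr0.
apply: (is_derive1_comp (f := sqr_pos) (g := fun x : R => 1 - sqr_pos (x - 1) - sqr_pos (- x - 1))).
  exact: is_derive_sqr_pos.
by apply: is_derive_eq; ring.
Qed.

Lemma dplateau_continuous : continuous dplateau.
Proof.
have c1 : continuous (fun x : R => x - 1) by apply: contD; [move=> x; exact: cvg_id|exact: cst_continuous].
have c2 : continuous (fun x : R => - x - 1).
  by apply: contD; [apply: contN => x; exact: cvg_id|exact: cst_continuous].
have cp (f : R -> R) : continuous f -> continuous (fun x => pos_part (f x)).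
  by move=> cf x; apply: (continuous_comp (f := f)); [exact: cf|exact: pos_part_continuous].
have p1 := cp _ c1; have p2 := cp _ c2.
have p3 : continuous (fun x => pos_part (1 - sqr_pos (x - 1) - sqr_pos (- x - 1))).
  by apply: cp; rewrite /sqr_pos; cts.
by rewrite /dplateau; cts.
Qed.

Lemma plateau_ge0 x : 0 <= plateau x. Proof. exact: sqr_pos_ge0. Qed.

Lemma plateau_le1 x : plateau x <= 1.
Proof.
rewrite /plateau /sqr_pos -[leRHS](expr1n _ 2) ler_pXn2r ?nnegrE ?pos_part_ge0// ge_max ler01 andbT.
have := sqr_ge0 (pos_part (x - 1)); have := sqr_ge0 (pos_part (- x - 1)); lra.
Qed.

Lemma plateau_eq1 x : `|x| <= 1 -> plateau x = 1.
Proof.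
rewrite ler_norml => /andP[h1 h2]; rewrite /plateau [sqr_pos (x - 1)]sqr_pos_0; last by lra.
rewrite [sqr_pos (- x - 1)]sqr_pos_0; last by lra.
by rewrite !subr0 /sqr_pos pos_part_id// expr1n.
Qed.

Lemma plateau_arg x : 2 <= `|x| -> 1 - sqr_pos (x - 1) - sqr_pos (- x - 1) <= 0.
Proof.
have := sqr_pos_ge0 (x - 1); have := sqr_pos_ge0 (- x - 1).
rewrite ler_normr => a b /orP[h|h].
  have : 1 <= sqr_pos (x - 1) by apply: sqr_pos_ge1; lra.
  lra.
have : 1 <= sqr_pos (- x - 1) by apply: sqr_pos_ge1; lra.
lra.
Qed.

Lemma plateau_eq0 x : 2 <= `|x| -> plateau x = 0.
Proof. by move=> /plateau_arg h; exact: sqr_pos_0. Qed.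

Lemma dplateau_eq0 x : 2 <= `|x| -> dplateau x = 0.
Proof. by move=> /plateau_arg h; rewrite /dplateau pos_part_0// mulr0 mul0r. Qed.

Lemma dplateau_in x : `|x| <= 1 -> dplateau x = 0.
Proof.
rewrite ler_norml => /andP[h1 h2]; rewrite /dplateau [pos_part (x - 1)]pos_part_0; last by lra.
by rewrite [pos_part (- x - 1)]pos_part_0; [rewrite mulr0 oppr0 addr0 mulr0|lra].
Qed.

Lemma dplateau_le4 x : `|dplateau x| <= 4.
Proof.
have [h|h] := leP 2 `|x|; first by rewrite dplateau_eq0// normr0.
rewrite /dplateau normrM (_ : 4 = 2 * 2); last by ring.
have hp : pos_part (1 - sqr_pos (x - 1) - sqr_pos (- x - 1)) <= 1.
  rewrite ge_max ler01 andbT.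
  have := sqr_pos_ge0 (x - 1); have := sqr_pos_ge0 (- x - 1); lra.
move: h; rewrite ltr_norml => /andP[h1 h2].
apply: ler_pM => //.
  rewrite ger0_norm; last by rewrite mulr_ge0// pos_part_ge0.
  lra.
have a0 := pos_part_ge0 (x - 1); have b0 := pos_part_ge0 (- x - 1).
have a1 : pos_part (x - 1) <= 1 by rewrite ge_max ler01 andbT; lra.
have b1 : pos_part (- x - 1) <= 1 by rewrite ge_max ler01 andbT; lra.
by rewrite ler_norml; apply/andP; split; lra.
Qed.

Definition step t : R := 1 - sqr_pos (1 - sqr_pos t).
Definition dstep t : R := 2 * pos_part (1 - sqr_pos t) * (2 * pos_part t).

Lemma is_derive_step t : is_derive t (1 : R) step (dstep t).
Proof.
have h1 : is_derive t (1 : R) (fun s => sqr_pos (1 - sqr_pos s))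
    (2 * pos_part (1 - sqr_pos t) * (- (2 * pos_part t))).
  apply: (is_derive1_comp (f := sqr_pos) (g := fun s : R => 1 - sqr_pos s)).
    exact: is_derive_sqr_pos.
  have h := is_derive_sqr_pos t.
  by apply: is_derive_eq; ring.
by apply: is_derive_eq; rewrite /dstep; ring.
Qed.

Lemma dstep_continuous : continuous dstep.
Proof.
have cp (f : R -> R) : continuous f -> continuous (fun x => pos_part (f x)).
  by move=> cf x; apply: (continuous_comp (f := f)); [exact: cf|exact: pos_part_continuous].
have p1 := pos_part_continuous.
have p3 : continuous (fun x => pos_part (1 - sqr_pos x)) by apply: cp; rewrite /sqr_pos; cts.
by rewrite /dstep; cts.
Qed.

Lemma dstep_ge0 t : 0 <= dstep t.
Proof. by rewrite !mulr_ge0// pos_part_ge0. Qed.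

Lemma step_ge0 t : 0 <= step t.
Proof.
rewrite /step subr_ge0 /sqr_pos -[leRHS](expr1n _ 2) ler_pXn2r ?nnegrE ?pos_part_ge0//.
by rewrite ge_max ler01 andbT lerBlDr lerDl sqr_ge0.
Qed.

Lemma step_le1 t : step t <= 1.
Proof. by rewrite /step lerBlDr lerDl sqr_pos_ge0. Qed.

Lemma step_eq0 t : t <= 0 -> step t = 0.
Proof. by move=> t0; rewrite /step (sqr_pos_0 t0) subr0 /sqr_pos pos_part_id// expr1n subrr. Qed.

Lemma step_eq1 t : 1 <= t -> step t = 1.
Proof. by move=> t1; rewrite /step [sqr_pos (1 - _)]sqr_pos_0 ?subr0// subr_le0 sqr_pos_ge1. Qed.

Lemma dstep_eq0 t : t <= 0 \/ 1 <= t -> dstep t = 0.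
Proof.
rewrite /dstep => -[t0|t1]; first by rewrite (pos_part_0 t0) !mulr0.
by rewrite [pos_part (1 - _)]pos_part_0 ?mulr0 ?mul0r// subr_le0 sqr_pos_ge1.
Qed.

Lemma dstep_le4 t : dstep t <= 4.
Proof.
have [t1|t1] := leP 1 t; first by rewrite dstep_eq0//; right.
have [t0|t0] := leP t 0; first by rewrite dstep_eq0//; left.
rewrite /dstep (_ : 4 = (2 * 1) * (2 * 1)); last by ring.
apply: ler_pM; rewrite ?mulr_ge0 ?pos_part_ge0//; rewrite ler_pM2l// ge_max ler01 andbT.
  by rewrite lerBlDr lerDl sqr_ge0.
exact: ltW.
Qed.

(** The constant is 2 (1 - 9/16) times 2 (1/4). A slope bounded below in the middle of a ramp is
    what will recover the energy itself from its product with that slope. *)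
Lemma dstep_lower t : 4^-1 <= t <= 3 / 4 -> 7 / 16 <= dstep t.
Proof.
move=> /andP[h1 h2]; have t0 : 0 <= t by apply: le_trans h1.
have t2 : t ^+ 2 <= (3 / 4) ^+ 2 by rewrite ler_pXn2r// nnegrE.
have t3 : (3 / 4) ^+ 2 = 9 / 16 :> R by field.
rewrite /dstep /sqr_pos (pos_part_id t0) pos_part_id; last by lra.
have -> : 7 / 16 = 2 * (7 / 16) * (2 * 4^-1) :> R by field.
by apply: ler_pM; lra.
Qed.

End cutoff1.

(** * A sign function smoothed on a logarithmic scale *)

Section smooth_sign.
Variable R : realType.
Variable l : R.
Hypothesis l0 : 0 < l.
Implicit Types t : R.

Let d_gt0 : 0 < expR (- l). Proof. exact: expR_gt0. Qed.

Definition hypot t : R := Num.sqrt (t ^+ 2 + expR (- l) ^+ 2).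

Lemma hypot_arg_gt0 t : 0 < t ^+ 2 + expR (- l) ^+ 2.
Proof. by rewrite ltr_wpDl ?sqr_ge0// exprn_gt0. Qed.

Lemma hypot_gt0 t : 0 < hypot t.
Proof. by rewrite sqrtr_gt0 hypot_arg_gt0. Qed.

Lemma sqr_hypot t : hypot t ^+ 2 = t ^+ 2 + expR (- l) ^+ 2.
Proof. by rewrite sqr_sqrtr// ltW// hypot_arg_gt0. Qed.

Lemma norm_lt_hypot t : `|t| < hypot t.
Proof.
rewrite -(@ltr_pXn2r _ 2) ?nnegrE// ?(ltW (hypot_gt0 _))//.
by rewrite sqr_hypot real_normK ?num_real// ltrDl exprn_gt0.
Qed.

Lemma add_hypot_gt0 t : 0 < t + hypot t.
Proof. by have := norm_lt_hypot t; rewrite ltr_norml => /andP[h _]; lra. Qed.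

(** This is arsinh (exp(l) t) / l. Its variation is spread evenly over the logarithmic scale from
    exp(-l) to 1, so its derivative is at most 1 / (l |t|). *)
Definition smooth_sign t : R := 1 + ln (t + hypot t) / l.
Definition dsmooth_sign t : R := (l * hypot t)^-1.

Lemma hypot_continuous : continuous hypot.
Proof.
move=> t; apply: (continuous_comp (f := fun t : R => t ^+ 2 + expR (- l) ^+ 2) (g := Num.sqrt)).
  by apply: cvgD; [exact: exprn_continuous|exact: cvg_cst].
exact: sqrt_continuous.
Qed.

Lemma dsmooth_sign_continuous : continuous dsmooth_sign.
Proof.
move=> t; apply: cvgV; first by rewrite gt_eqF// mulr_gt0// hypot_gt0.
by apply: cvgM; [exact: cvg_cst|exact: hypot_continuous].
Qed.

Lemma is_derive_smooth_sign t : is_derive t (1 : R) smooth_sign (dsmooth_sign t).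
Proof.
have h1 : is_derive t (1 : R) (fun t : R => t ^+ 2 + expR (- l) ^+ 2) (2 * t).
  by apply: is_derive_eq; rewrite addr0 ![_%:A]mulr1; ring.
have h2 : is_derive t (1 : R) hypot ((2 * hypot t)^-1 * (2 * t)).
  apply: (is_derive1_comp (f := Num.sqrt) (g := fun t : R => t ^+ 2 + expR (- l) ^+ 2)) => //.
  exact: is_derive1_sqrt (hypot_arg_gt0 t).
have h3 : is_derive t (1 : R) (fun t : R => ln (t + hypot t)) ((t + hypot t)^-1 * (1 + (2 * hypot t)^-1 * (2 * t))).
  apply: (is_derive1_comp (f := @ln R) (g := fun t : R => t + hypot t)).
  exact: is_derive1_ln (add_hypot_gt0 t).
have hn := hypot_gt0 t; have yn := add_hypot_gt0 t.
apply: is_derive_eq; rewrite /dsmooth_sign scaler0 add0r add0r -[_ *: _]/(_ * _).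
by field; rewrite !gt_eqF.
Qed.

Lemma smooth_signN t : smooth_sign (- t) = - smooth_sign t.
Proof.
have yn := add_hypot_gt0 t.
have hN : hypot (- t) = hypot t by rewrite /hypot sqrrN.
rewrite /smooth_sign hN.
have -> : - t + hypot t = expR (- l) ^+ 2 / (t + hypot t).
  apply: (mulIf (lt0r_neq0 yn)); rewrite divfK ?gt_eqF//.
  by rewrite (_ : _ * _ = hypot t ^+ 2 - t ^+ 2); [rewrite sqr_hypot; ring|ring].
rewrite ln_div ?posrE ?exprn_gt0// lnXn// expRK.
by field; rewrite gt_eqF.
Qed.

Lemma smooth_sign_ge0 t : 0 <= t -> 0 <= smooth_sign t.
Proof.
move=> t0; have yn := add_hypot_gt0 t.
have dy : expR (- l) <= t + hypot t.
  have : expR (- l) <= hypot t.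
    rewrite -(@ler_pXn2r _ 2) ?nnegrE ?expR_ge0 ?(ltW (hypot_gt0 t))//.
    by rewrite sqr_hypot lerDr sqr_ge0.
  lra.
have : ln (expR (- l)) <= ln (t + hypot t) by rewrite ler_ln ?posrE.
rewrite expRK => h; rewrite /smooth_sign.
have : - 1 <= ln (t + hypot t) / l by rewrite ler_pdivlMr// mulN1r.
lra.
Qed.

(** Above exp(-l / 2), the middle of the logarithmic scale, the smooth sign is at least 1/2; below
    it, |t| is itself within the error term. *)
Lemma le_norm_smooth_sign t : `|t| <= 2 * (t * smooth_sign t) + expR (- l / 2).
Proof.
wlog t0 : t / 0 <= t => [wl|].
  have [t0|t0] := leP 0 t; first exact: wl.
  rewrite -normrN -[t * smooth_sign t]mulrNN -smooth_signN; apply: wl; lra.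
rewrite ger0_norm//.
have [td|dt] := leP t (expR (- l / 2)).
  apply: (le_trans td); rewrite lerDr mulr_ge0// mulr_ge0//; exact: smooth_sign_ge0.
have tp : 0 < t by apply: lt_trans dt; exact: expR_gt0.
have : ln (expR (- l / 2)) <= ln (t + hypot t).
  rewrite ler_ln ?posrE ?expR_gt0// ?add_hypot_gt0//.
  by have := hypot_gt0 t; lra.
rewrite expRK => h.
have : - 2^-1 <= ln (t + hypot t) / l.
  by rewrite ler_pdivlMr//; lra.
rewrite /smooth_sign => h2.
have : t <= 2 * (t * (1 + ln (t + hypot t) / l)).
  by rewrite mulrCA ler_peMr//; lra.
have := expR_gt0 (- l / 2); lra.
Qed.

(** For 0 <= t <= M the argument of the logarithm is at most 2 M + 1 <= l, and ln y < y. *)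
Lemma smooth_sign_le2 t (M : R) : `|t| <= M -> 2 * M + 1 <= l -> `|smooth_sign t| <= 2.
Proof.
wlog t0 : t / 0 <= t => [wl|].
  have [t0|t0] := leP 0 t; first exact: wl.
  rewrite -normrN -[`|smooth_sign t|]normrN -smooth_signN; apply: wl; lra.
rewrite ger0_norm// => tM Ml; rewrite ger0_norm ?smooth_sign_ge0//.
have yn := add_hypot_gt0 t.
have d1 : expR (- l) <= 1 by rewrite expR_le1 oppr_le0 ltW.
have hy : hypot t <= t + 1.
  rewrite -(@ler_pXn2r _ 2) ?nnegrE ?addr_ge0 ?(ltW (hypot_gt0 t))// sqr_hypot.
  have : expR (- l) ^+ 2 <= 1 by rewrite expr_le1 ?expR_ge0.
  by rewrite sqrrD1; lra.
have hl : ln (t + hypot t) <= l by have := ln_sublinear yn; lra.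
have : ln (t + hypot t) / l <= 1 by rewrite ler_pdivrMr// mul1r.
rewrite /smooth_sign; lra.
Qed.

Lemma sqr_dsmooth_sign t : dsmooth_sign t ^+ 2 = (l ^+ 2 * (t ^+ 2 + expR (- l) ^+ 2))^-1.
Proof. by rewrite /dsmooth_sign exprVn exprMn sqr_hypot. Qed.

End smooth_sign.

(** * Quotients of solutions and integrals of derivatives *)

Section quotient.
Variable R : realType.
Local Notation I := (@integral3 R).
Implicit Types (f g h z a b c phi psi k : space3 R -> R).

Lemma ccD f g : cc f -> cc g -> cc (fun x => f x + g x).
Proof.
move=> [cf [r hr]] [cg [s hs]]; split; first exact: contD.
by exists (Num.max r s) => x; rewrite gt_max => /andP[/hr -> /hs ->]; rewrite addr0.
Qed.

Lemma ccZ (r : R) f : cc f -> cc (fun x => r * f x).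
Proof.
move=> [cf [s hs]]; split; first by apply: contM => //; exact: cst_continuous.
by exists s => x /hs ->; rewrite mulr0.
Qed.

(** The product of [phi] with the gradient of g / phi. *)
Definition quot_grad phi (dphi : 'I_3 -> space3 R -> R) g dg x (i : 'I_3) : R :=
  dg i x - g x / phi x * dphi i x.

(** In the sum of the two quotient inequalities the coupling terms combine into b (g psi - k phi)^2
    / (phi psi); this is where the sign of [b], cooperativity, is used. *)
Lemma quotient_bound a b c phi psi g k (dphi dpsi dg dk : 'I_3 -> space3 R -> R) z dz :
  continuous a -> continuous b -> continuous c ->
  C1 phi dphi -> C1 psi dpsi -> C1 g dg -> C1 k dk -> C1 z dz -> csupp z ->
  (forall x, 0 <= b x) -> (forall x, 0 < phi x) -> (forall x, 0 < psi x) ->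
  weak_solution a b phi psi dphi -> weak_solution c b psi phi dpsi ->
  weak_solution a b g k dg -> weak_solution c b k g dk ->
  I (fun x => z x ^+ 2 * dot3 (quot_grad phi dphi g dg x) (quot_grad phi dphi g dg x)) <=
  4 * I (fun x => (g x ^+ 2 + k x ^+ 2) * dot3 (dz ^~ x) (dz ^~ x)).
Proof.
move=> ca cb ccn Cphi Cpsi Cg Ck Cz sz b0 phi0 psi0 wphi wpsi wg wk.
have [cphi cdphi _] := Cphi; have [cpsi cdpsi _] := Cpsi.
have [cg cdg _] := Cg; have [ck cdk _] := Ck; have [cz cdz _] := Cz.
have phin0 x : phi x != 0 by rewrite gt_eqF.
have psin0 x : psi x != 0 by rewrite gt_eqF.
have i1 := weak_quotient_ineq ca cb cpsi ck Cphi Cg Cz sz phi0 wphi wg.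
have i2 := weak_quotient_ineq ccn cb cphi cg Cpsi Ck Cz sz psi0 wpsi wk.
set A1 := (X in I X <= _) in i1; set A2 := (X in I X <= _) in i2.
set B1 := (X in _ <= I X) in i1; set B2 := (X in _ <= I X) in i2.
have cA1 : cc A1.
  apply: (cc_dom Cz sz); first by rewrite /A1 /dot3 /=; cts.
  by move=> x z0 _; rewrite /A1 z0; ring.
have cA2 : cc A2.
  apply: (cc_dom Cz sz); first by rewrite /A2 /dot3 /=; cts.
  by move=> x z0 _; rewrite /A2 z0; ring.
have cB1 : cc B1.
  apply: (cc_dom Cz sz); first by rewrite /B1 /dot3 /=; cts.
  by move=> x _ dz0; rewrite /B1 /dot3 !dz0; ring.
have cB2 : cc B2.
  apply: (cc_dom Cz sz); first by rewrite /B2 /dot3 /=; cts.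
  by move=> x _ dz0; rewrite /B2 /dot3 !dz0; ring.
have cL : cc (fun x => z x ^+ 2 * dot3 (quot_grad phi dphi g dg x) (quot_grad phi dphi g dg x)).
  apply: (cc_dom Cz sz); first by rewrite /quot_grad /dot3 /=; cts.
  by move=> x z0 _; rewrite z0; ring.
have cR : cc (fun x => (g x ^+ 2 + k x ^+ 2) * dot3 (dz ^~ x) (dz ^~ x)).
  apply: (cc_dom Cz sz); first by rewrite /dot3 /=; cts.
  by move=> x _ dz0; rewrite /dot3 !dz0; ring.
have h1 : 2^-1 * I (fun x => z x ^+ 2 * dot3 (quot_grad phi dphi g dg x) (quot_grad phi dphi g dg x)) <=
    I A1 + I A2.
  rewrite -integral3Z// -integral3D//; apply: le_integral3; [exact: ccZ|exact: ccD|].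
  move=> x; rewrite -subr_ge0 /A1 /A2 /=.
  set ZZ := dot3 (quot_grad phi dphi g dg x) _.
  set YY := dot3 _ _.
  rewrite (_ : _ - _ = 2^-1 * z x ^+ 2 * YY + z x ^+ 2 * b x * ((g x * psi x - k x * phi x) ^+ 2 / (phi x * psi x))); last by field; rewrite phin0 psin0.
  have YY0 : 0 <= YY by rewrite /YY /dot3 !addr_ge0// -expr2 sqr_ge0.
  apply: addr_ge0; first by rewrite mulr_ge0// mulr_ge0 ?sqr_ge0// invr_ge0.
  apply: mulr_ge0; first by rewrite mulr_ge0 ?sqr_ge0.
  by apply: divr_ge0; [exact: sqr_ge0|rewrite mulr_ge0// ltW].
have h2 : I B1 + I B2 = 2 * I (fun x => (g x ^+ 2 + k x ^+ 2) * dot3 (dz ^~ x) (dz ^~ x)).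
  rewrite -integral3Z// -integral3D//; congr integral3; apply/funext => x.
  by rewrite /B1 /B2; ring.
have := le_trans h1 (lerD i1 i2); rewrite h2 -ler_pdivlMl ?invr_gt0// invrK mulrA.
by rewrite (_ : 2 * 2 = 4); last by ring.
Qed.

(* Integrate d_i (z^2 w b) with [b = smooth_sign l (dw i)]. Writing [dg i] as a
   quotient gradient plus [dw i / phi * dphi i], the factor [b'] of order
   [1 / (l |dw i|)] absorbs [dw i] in the second part, so that the large factor
   [expR (2 l)] only multiplies the first one. *)
Lemma abs_derive_bound w dw (i : 'I_3) dg phi dphi z dz (M l kappa : R) :
  C1 w dw -> C1 (dw i) dg -> C1 phi dphi -> C1 z dz -> csupp z ->
  (forall x, 0 < phi x) -> (forall x, `|w x| <= M) -> (forall x, `|dw i x| <= M) ->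
  0 < kappa -> 2 * M + 1 <= l ->
  I (fun x => z x ^+ 2 * `|dw i x|) <=
  I (fun x => 8 * M * (`|z x| * `|dz i x|) + ((M / kappa + expR (- l / 2)) * z x ^+ 2
     + (2 * M * kappa / l ^+ 2) * (expR (- l) ^- 2 * (z x ^+ 2 * dot3 (quot_grad phi dphi (dw i) dg x) (quot_grad phi dphi (dw i) dg x))
     + z x ^+ 2 * (dot3 (dphi ^~ x) (dphi ^~ x) / phi x ^+ 2)))).
Proof.
move=> Cw Cg Cphi Cz sz phi0 wM gM k0 Ml.
have M0 : 0 <= M by apply: le_trans (wM 0).
have l0 : 0 < l by lra.
have [cphi cdphi _] := Cphi; have [cw cdw _] := Cw.
have [cg cdg _] := Cg; have [cz cdz _] := Cz.
have phin0 x : phi x != 0 by rewrite gt_eqF.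
have dn0 : expR (- l) != 0 by rewrite gt_eqF// expR_gt0.
have Cb := C1_comp (h := smooth_sign l) (h' := dsmooth_sign l) Cg
  (fun x => is_derive_smooth_sign l0 (dw i x))
  (fun x => continuous_comp (cg x) (dsmooth_sign_continuous l0 (x := dw i x))).
have CF := C1M (C1M Cz Cz) (C1M Cw Cb).
have sF : csupp (fun x => z x * z x * (w x * smooth_sign l (dw i x))).
  by have [r hr] := sz; exists r => x /hr ->; rewrite !mul0r.
have F0 := integral3_derive_eq0 i CF sF; have cdF := csupp_derive i CF sF.
have [_ cF _] := CF.
set dF := (X in C1 _ X) in CF; rewrite -/dF in F0.
have cdFi : cc (dF i) by split=> //; exact: cF.
apply: (@le_integral3_add _ _ _ (fun x => 2 * dF i x)).
- apply: (cc_dom Cz sz); first by cts.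
  by move=> x z0 _; rewrite z0; ring.
- apply: (cc_dom Cz sz); first by rewrite /quot_grad /dot3 /=; cts; move=> x; rewrite expf_neq0.
  by move=> x z0 dz0; rewrite z0 dz0 normr0; ring.
- exact: ccZ.
- by rewrite integral3Z// F0 mulr0.
- move=> x.
  set Z := quot_grad phi dphi (dw i) dg x; set B := smooth_sign l (dw i x).
  set b' := dsmooth_sign l (dw i x).
  have dFE : dF i x = 2 * z x * dz i x * w x * B + z x ^+ 2 * (dw i x * B) + z x ^+ 2 * w x * b' * dg i x.
    rewrite /dF /B /b'; ring.
  have hB : `|B| <= 2 := smooth_sign_le2 l0 (gM x) Ml.
  have hg : `|dw i x| <= 2 * (dw i x * B) + expR (- l / 2) := le_norm_smooth_sign l0 (dw i x).
  have z20 : 0 <= z x ^+ 2 := sqr_ge0 _.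
  have ZZ : Z i ^+ 2 <= dot3 Z Z.
    have a0 := sqr_ge0 (Z ord0); have a1 := sqr_ge0 (Z (inord 1)); have a2 := sqr_ge0 (Z ord_max).
    have := mem_ord3 i.
    by rewrite /dot3 -!expr2 !inE => /or3P[] /eqP ->; lra.
  have PP : dphi i x ^+ 2 <= dot3 (dphi ^~ x) (dphi ^~ x).
    have a0 := sqr_ge0 (dphi ord0 x); have a1 := sqr_ge0 (dphi (inord 1) x); have a2 := sqr_ge0 (dphi ord_max x).
    have := mem_ord3 i.
    by rewrite /dot3 -!expr2 !inE => /or3P[] /eqP ->; lra.
  (* b'^2 is 1 / (l^2 (G^2 + d^2)) with G = [dw i x] and d = exp(-l). Against the quotient part it
     is bounded through G^2 + d^2 >= d^2, against the part carrying G^2 through G^2 / (G^2 + d^2) <=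
     1. *)
  have hb : b' ^+ 2 * dg i x ^+ 2 <= 2 / l ^+ 2 * (expR (- l) ^- 2 * dot3 Z Z + dot3 (dphi ^~ x) (dphi ^~ x) / phi x ^+ 2).
    have gE : dg i x = Z i + dw i x * (dphi i x / phi x) by rewrite /Z /quot_grad; field.
    have g2 : dg i x ^+ 2 <= 2 * (Z i ^+ 2 + dw i x ^+ 2 * (dphi i x / phi x) ^+ 2).
      rewrite gE -subr_ge0 (_ : _ - _ = (Z i - dw i x * (dphi i x / phi x)) ^+ 2); last by ring.
      exact: sqr_ge0.
    rewrite /b' sqr_dsmooth_sign// mulrC ler_pdivrMr ?mulr_gt0 ?exprn_gt0 ?hypot_arg_gt0//.
    apply: (le_trans g2).
    set G := dw i x; set d := expR (- l); set P := (dphi i x / phi x) ^+ 2.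
    set D := dot3 Z Z; set E := _ / phi x ^+ 2.
    have dn : d != 0 := dn0; have ln : l != 0 by rewrite gt_eqF.
    have PE : P <= E by rewrite /P /E exprMn exprVn ler_wpM2r// invr_ge0 sqr_ge0.
    rewrite (_ : _ * (l ^+ 2 * _) = 2 * (d ^- 2 * D + E) * (G ^+ 2 + d ^+ 2)); last by field; rewrite ?dn ?ln.
    rewrite -mulrA ler_pM2l//.
    have d2 : 0 < d ^+ 2 by rewrite exprn_gt0// expR_gt0.
    have E0 : 0 <= E by apply: le_trans PE; exact: sqr_ge0.
    have D0 : 0 <= D by apply: le_trans ZZ; exact: sqr_ge0.
    rewrite (_ : (_ + E) * _ = (D + G ^+ 2 * E) + (d ^- 2 * D * G ^+ 2 + E * d ^+ 2)); last by field; rewrite ?dn ?ln.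
    rewrite -[leLHS]addr0 lerD//; first by rewrite lerD// ler_wpM2l ?sqr_ge0.
    rewrite addr_ge0//; last by rewrite mulr_ge0// ltW.
    by rewrite mulr_ge0 ?sqr_ge0// mulr_ge0// invr_ge0 ltW.
  have t1 : - (2 * (2 * z x * dz i x * w x * B)) <= 8 * M * (`|z x| * `|dz i x|).
    rewrite (le_trans (ler_norm _))// normrN !normrM [`|2|]ger0_norm//.
    rewrite (_ : 2 * (2 * _ * _ * _ * _) = 4 * (`|z x| * `|dz i x|) * (`|w x| * `|B|)); last by ring.
    rewrite (_ : 8 * M * _ = 4 * (`|z x| * `|dz i x|) * (M * 2)); last by ring.
    by rewrite ler_wpM2l ?mulr_ge0// ler_pM.
  (* Young's inequality with weight [kappa] makes the error quadratic, the form in which the two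
     Caccioppoli estimates control it. *)
  have t2 : - (2 * (w x * b' * dg i x)) <= M / kappa + M * kappa * (b' ^+ 2 * dg i x ^+ 2).
    rewrite (le_trans (ler_norm _))// normrN !normrM [`|2|]ger0_norm//.
    set X := `|b'| * `|dg i x|.
    rewrite (_ : b' ^+ 2 * _ = X ^+ 2); last by rewrite /X -normrM real_normK ?num_real// exprMn.
    rewrite (_ : 2 * _ = `|w x| * (2 * X)); last by rewrite /X; ring.
    apply: (le_trans (y := M * (2 * X))); first by rewrite ler_wpM2r// mulr_ge0// mulr_ge0.
    rewrite -mulrA -mulrDr ler_wpM2l// -subr_ge0.
    rewrite (_ : _ - _ = (1 - kappa * X) ^+ 2 / kappa); last by field; rewrite gt_eqF.
    by rewrite divr_ge0 ?sqr_ge0// ltW.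
  rewrite dFE.
  have t3 := ler_wpM2l z20 hg; have t4 := ler_wpM2l z20 t2.
  have Mk0 : 0 <= M * kappa by rewrite mulr_ge0// ltW.
  have t5 := ler_wpM2l (mulr_ge0 z20 Mk0) hb.
  have -> : 2 * M * kappa / l ^+ 2 * (expR (- l) ^- 2 * (z x ^+ 2 * dot3 Z Z) +
     z x ^+ 2 * (dot3 (dphi^~ x) (dphi^~ x) / phi x ^+ 2)) =
     z x ^+ 2 * (M * kappa) * (2 / l ^+ 2 * (expR (- l) ^- 2 * dot3 Z Z + dot3 (dphi ^~ x) (dphi ^~ x) / phi x ^+ 2)).
    by ring.
  set Q := z x ^+ 2 * (M * kappa) * (2 / _ * _) in t5 *.
  move: t1 t3 t4 t5; set z2 := z x ^+ 2; set e := expR (- l / 2); set S := M / kappa.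
  move=> t1 t3 t4 t5.
  have E4 : z2 * (S + M * kappa * (b' ^+ 2 * dg i x ^+ 2)) = z2 * S + z2 * (M * kappa) * (b' ^+ 2 * dg i x ^+ 2) by ring.
  rewrite E4 in t4.
  apply: (le_trans t3).
  move: t1 t4 t5; set u1 := z2 * (M * kappa) * _; set u2 := 2 * _ * _ * w x * B.
  move=> t1 t4 t5.
  have -> : 2 * (u2 + z2 * (dw i x * B) + z2 * w x * b' * dg i x) = 2 * u2 + 2 * (z2 * (dw i x * B)) + z2 * (2 * (w x * b' * dg i x)) by ring.
  have -> : z2 * (2 * (dw i x * B) + e) = 2 * (z2 * (dw i x * B)) + z2 * e by ring.
  rewrite mulrN in t4.
  move: t1 t4; set v1 := 8 * M * _; set v2 := z2 * (2 * (w x * b' * dg i x)) => t1 t4.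
  have -> : (S + e) * z2 = z2 * S + z2 * e by ring.
  lra.
Qed.
End quotient.

(* [th^2 (W_uu + W_vv - 2 W_uv)], [th = alpha u v - omega], vanishes at the two
   minima of [W] and is negative at the saddle point [u = v], the only zero of
   [grad W] with [u, v > 0] which is not a minimum. *)
Lemma potential_le (R : realType) (alpha omega M : R) :
  0 < omega -> omega < alpha / 2 -> 1 <= M ->
  exists2 K, 0 <= K & exists2 k, 0 <= k & forall a b : R,
    0 < a <= M -> 0 < b <= M -> omega <= (2 + alpha) * (a * b) ->
    let S := a ^+ 2 + b ^+ 2 - 1 in let th := alpha * a * b - omega in
    W alpha omega a b <= K * ((a * S + b * th) ^+ 2 + (b * S + a * th) ^+ 2)
      - k * (th ^+ 2 * (2 * S - 2 * th + (2 + alpha) * (a - b) ^+ 2)).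
Proof.
move=> o0 oa M1.
have a0 : 0 < alpha by lra.
have a2 : 0 < 2 + alpha by lra.
(* The value of [th] at the saddle, where a = b and S = - th; it is positive because omega < alpha /
   2. *)
pose th0 := (alpha - 2 * omega) / (2 + alpha).
have th00 : 0 < th0 by rewrite divr_gt0//; lra.
pose kap := alpha / (2 + alpha); have kap0 : 0 < kap by rewrite divr_gt0.
pose p0 := omega / (2 + alpha); have p00 : 0 < p0 by rewrite divr_gt0.
(* Chosen so that 4 k th0 = 2: since th = th0 + kap (m - d), the cubic term 4 k th^3 then yields 2
   th^2. *)
pose k := (2 * th0)^-1; have k0 : 0 < k by rewrite invr_gt0 mulr_gt0.
pose c1 := 4 * k * kap - 2 * k; pose c2 := 4 * k * kap + k * (2 + alpha).
have c20 : 0 <= c2 by apply: addr_ge0; apply: mulr_ge0; rewrite ?(ltW kap0) ?(ltW k0) ?(ltW a2)// mulr_ge0// ltW.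
pose T := alpha * M ^+ 2 + omega.
(* [c2] absorbs the term in d th^2. The second summand absorbs the terms in m^2, among them the one
   left by Young's inequality with |th| <= T; its denominator comes from the lower bound [p0] on a
   b. *)
pose K := c2 + (c1 ^+ 2 * T ^+ 2 + 1) / (4 * p0).
have q0 : 0 <= (c1 ^+ 2 * T ^+ 2 + 1) / (4 * p0).
  by apply: divr_ge0; [rewrite addr_ge0// mulr_ge0 ?sqr_ge0|rewrite mulr_ge0// ltW].
have K0 : 0 <= K by rewrite addr_ge0.
(* Then C0 (m^2 + th^2) / 2 dominates W = S^2 / 4 + th^2 / (2 alpha), where S = m - th. *)
pose C0 := 1 + alpha^-1.
have C00 : 0 < C0 by rewrite addr_gt0// invr_gt0.
exists (C0 * K); first by rewrite mulr_ge0// ltW.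
exists (C0 * k); first by rewrite mulr_ge0// ltW.
move=> a b /andP[pa aM] /andP[pb bM] pab. set S := _ - 1; set th := alpha * a * b - omega; move=> /=.
pose d := (a - b) ^+ 2; pose m := S + th; pose p := a * b.
have d0 : 0 <= d by exact: sqr_ge0.
have pp0 : p0 <= p by rewrite ler_pdivrMr// mulrC.
have thE : th = th0 + kap * (m - d).
  by rewrite /th0 /kap /m /d /S /th; field; rewrite !gt_eqF.
(* |grad W|^2 in terms of d, p, m: as p is bounded below, it vanishes only for S = th = 0, the
   minima, or d = m = 0, the saddle. *)
have GE : (a * S + b * th) ^+ 2 + (b * S + a * th) ^+ 2 = d * (S ^+ 2 + th ^+ 2) + 2 * p * m ^+ 2.
  by rewrite /d /m /p; ring.
have NE : - (k * (th ^+ 2 * (2 * S - 2 * th + (2 + alpha) * d))) =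
    2 * th ^+ 2 + c1 * (th ^+ 2 * m) - c2 * (d * th ^+ 2).
  have kth : 4 * k * th0 = 2 by rewrite /k; field; rewrite !gt_eqF.
  have -> : - (k * (th ^+ 2 * (2 * S - 2 * th + (2 + alpha) * d))) =
    4 * k * th * th ^+ 2 - 2 * k * (th ^+ 2 * m) - k * (2 + alpha) * (d * th ^+ 2) by rewrite /m; ring.
  rewrite {1}thE (_ : 4 * k * (th0 + _) = 4 * k * th0 + 4 * k * kap * (m - d)); last by ring.
  by rewrite kth /c1 /c2; ring.
have thT : `|th| <= T.
  rewrite (le_trans (ler_normB _ _))// (gtr0_norm o0) /T lerD2r.
  rewrite -mulrA normrM (gtr0_norm a0) ler_wpM2l ?(ltW a0)// gtr0_norm ?mulr_gt0//.
  by rewrite expr2 ler_pM// ltW.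
have h1 : c1 * (th ^+ 2 * m) >= - (2^-1 * th ^+ 2 + 2^-1 * (c1 ^+ 2 * T ^+ 2) * m ^+ 2).
  have T2 : th ^+ 2 <= T ^+ 2.
    by rewrite -(real_normK (num_real th)) ler_pXn2r// nnegrE// (le_trans _ thT).
  have h2 : 2^-1 * (c1 ^+ 2 * th ^+ 2) * m ^+ 2 <= 2^-1 * (c1 ^+ 2 * T ^+ 2) * m ^+ 2.
    by rewrite ler_wpM2r ?sqr_ge0// ler_wpM2l// ler_wpM2l// sqr_ge0.
  have h3 : 0 <= 2^-1 * th ^+ 2 + 2^-1 * (c1 ^+ 2 * th ^+ 2) * m ^+ 2 + c1 * (th ^+ 2 * m).
    rewrite (_ : _ + _ = 2^-1 * (th + c1 * th * m) ^+ 2); last by field.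
    by rewrite mulr_ge0 ?sqr_ge0.
  lra.
have h4 : c2 * (d * th ^+ 2) <= K * (d * (S ^+ 2 + th ^+ 2)).
  apply: ler_pM => //; first by rewrite mulr_ge0// sqr_ge0.
    by rewrite lerDl.
  by rewrite ler_wpM2l// lerDr sqr_ge0.
have h5 : (2^-1 * (c1 ^+ 2 * T ^+ 2) + 2^-1) * m ^+ 2 <= K * (2 * p * m ^+ 2).
  rewrite [K * _]mulrA ler_wpM2r ?sqr_ge0//.
  have -> : 2^-1 * (c1 ^+ 2 * T ^+ 2) + 2^-1 = (c1 ^+ 2 * T ^+ 2 + 1) / (4 * p0) * (2 * p0).
    by field; rewrite gt_eqF.
  apply: ler_pM => //; first by rewrite mulr_ge0// ltW.
    by rewrite /K lerDr.
  by rewrite ler_pM2l.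
have main : 2^-1 * m ^+ 2 + 2^-1 * th ^+ 2 <= K * ((a * S + b * th) ^+ 2 + (b * S + a * th) ^+ 2)
      - k * (th ^+ 2 * (2 * S - 2 * th + (2 + alpha) * d)).
  have {}h5 : 2^-1 * (c1 ^+ 2 * T ^+ 2) * m ^+ 2 + 2^-1 * m ^+ 2 <= K * (2 * p * m ^+ 2).
    by rewrite -[X in X <= _]mulrDl.
  rewrite NE GE [K * (_ + _)]mulrDr.
  have := sqr_ge0 th.
  move: h1 h4 h5.
  set x1 := c1 * (_ * m); set x2 := c2 * _; set x3 := K * (d * _); set x4 := K * (2 * p * _).
  by set x5 := 2^-1 * (_ * _) * _; lra.
have -> : C0 * K * ((a * S + b * th) ^+ 2 + (b * S + a * th) ^+ 2)
    - C0 * k * (th ^+ 2 * (2 * S - 2 * th + (2 + alpha) * (a - b) ^+ 2)) =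
   C0 * (K * ((a * S + b * th) ^+ 2 + (b * S + a * th) ^+ 2)
      - k * (th ^+ 2 * (2 * S - 2 * th + (2 + alpha) * d))) by rewrite /d; ring.
apply: le_trans (ler_wpM2l (ltW C00) main).
have WE : W alpha omega a b = 4^-1 * S ^+ 2 + 2^-1 * alpha^-1 * th ^+ 2.
  by rewrite /W /S /th; field; rewrite gt_eqF.
rewrite WE -subr_ge0.
have -> : C0 * (2^-1 * m ^+ 2 + 2^-1 * th ^+ 2) - (4^-1 * S ^+ 2 + 2^-1 * alpha^-1 * th ^+ 2) =
   2^-1 * alpha^-1 * m ^+ 2 + 4^-1 * (m + th) ^+ 2.
  by rewrite /m /C0; field; rewrite gt_eqF.
by rewrite addr_ge0// mulr_ge0 ?sqr_ge0// mulr_ge0// invr_ge0 ltW.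
Qed.

Section laplace_square.
Variable R : realType.
Local Notation I := (@integral3 R).

(** One of the two factors h is Δw, and the divergence of z^2 h grad w has zero integral. For h =
    W_u or W_v this trades the square of h for products of first derivatives. *)
Lemma integral3_sqr_laplace (w h z : space3 R -> R) (dw dh dz : 'I_3 -> space3 R -> R) ddw :
  C2 w dw ddw -> C1 h dh -> C1 z dz -> csupp z -> (forall x, lap3 ddw x = h x) ->
  I (fun x => z x ^+ 2 * h x ^+ 2) =
  I (fun x => -1 * (dot3 (fun i => 2 * z x * dz i x * h x + z x ^+ 2 * dh i x) (dw ^~ x))).
Proof.
move=> [Cw Cdw] Ch Cz sz lw.
have [cw cdw _] := Cw; have [ch cdh _] := Ch; have [cz cdz _] := Cz.
have CV i := C1M (C1M (C1M Cz Cz) Ch) (Cdw i).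
have sV i : csupp (fun x => z x * z x * h x * dw i x).
  by have [r hr] := sz; exists r => x /hr ->; rewrite !mul0r.
have e i := integral3_derive_eq0 i (CV i) (sV i).
have cV i : cc (fun x => ((dz i x * z x + z x * dz i x) * h x + z x * z x * dh i x) * dw i x + z x * z x * h x * ddw i i x).
  by split; [case: (CV i) => _ + _; exact|exact: csupp_derive (CV i) (sV i)].
have cB : cc (fun x => -1 * (dot3 (fun i => 2 * z x * dz i x * h x + z x ^+ 2 * dh i x) (dw ^~ x))).
  apply: (cc_dom Cz sz); first by rewrite /dot3 /=; cts.
  by move=> x z0 dz0; rewrite /dot3 z0 !dz0; ring.
have sum0 := integral3D (cV ord0) (cV (inord 1)).
have sum1 := integral3D (ccD (cV ord0) (cV (inord 1))) (cV ord_max).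
have sum2 := integral3D cB (ccD (ccD (cV ord0) (cV (inord 1))) (cV ord_max)).
rewrite sum1 sum0 !e !addr0 in sum2; rewrite -sum2.
congr integral3; apply/funext => x; rewrite /dot3 -lw /lap3; ring.
Qed.
End laplace_square.

(** * Cutoffs on cylinders *)

Section cut.
Variable R : realType.
Local Notation I := (@integral3 R).
Implicit Types (a c : R) (x : space3 R).

Lemma C1_coord_comp (f f' : R -> R) (i : 'I_3) (b a : R) :
  (forall t, is_derive t (1 : R) f (f' t)) -> continuous f' ->
  C1 (fun x : space3 R => f ((coord i x + b) / a))
     (fun j x => f' ((coord i x + b) / a) * ((i == j)%:R / a)).
Proof.
move=> fd cf'.
have Ci : C1 (fun x : space3 R => (coord i x + b) / a) (fun j x => (i == j)%:R / a).
  apply: (eq_C1 (C1M (C1D (C1_coord R i) (C1_cst b)) (C1_cst a^-1))) => //.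
  by move=> j x; ring.
apply: (C1_comp (h := f) (h' := f') Ci (fun x => fd _)) => x.
apply: (@continuous_comp _ _ _ (fun x : space3 R => (coord i x + b) / a) f'); last exact: cf'.
by case: Ci => h _ _; exact: h.
Qed.

(** The summand 0 matches the shape of [C1_coord_comp], whose shift serves the ramps. *)
Definition pl (i : 'I_3) a x : R := plateau ((coord i x + 0) / a).
Definition dpl (i : 'I_3) a x : R := dplateau ((coord i x + 0) / a) / a.

Lemma C1_pl i a : C1 (pl i a) (fun j x => dpl i a x * (i == j)%:R).
Proof.
apply: (eq_C1 (C1_coord_comp i 0 a (@is_derive_plateau R) (@dplateau_continuous R))) => //.
by move=> j x; rewrite /dpl; ring.
Qed.

Lemma pl_ge0 i a x : 0 <= pl i a x. Proof. exact: plateau_ge0. Qed.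
Lemma pl_le1 i a x : pl i a x <= 1. Proof. exact: plateau_le1. Qed.

Lemma norm_div (t a : R) : 0 < a -> `|(t + 0) / a| = `|t| / a.
Proof. by move=> a0; rewrite addr0 normrM normfV (gtr0_norm a0). Qed.

Lemma pl_eq1 i a x : 0 < a -> `|coord i x| <= a -> pl i a x = 1.
Proof. by move=> a0 h; apply: plateau_eq1; rewrite norm_div// ler_pdivrMr// mul1r. Qed.

Lemma pl_eq0 i a x : 0 < a -> 2 * a <= `|coord i x| -> pl i a x = 0.
Proof. by move=> a0 h; apply: plateau_eq0; rewrite norm_div// ler_pdivlMr. Qed.

Lemma dpl_eq0 i a x : 0 < a -> 2 * a <= `|coord i x| -> dpl i a x = 0.
Proof. by move=> a0 h; rewrite /dpl dplateau_eq0 ?mul0r// norm_div// ler_pdivlMr. Qed.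

Lemma dpl_in i a x : 0 < a -> `|coord i x| <= a -> dpl i a x = 0.
Proof. by move=> a0 h; rewrite /dpl dplateau_in ?mul0r// norm_div// ler_pdivrMr// mul1r. Qed.

Lemma dpl_le i a x : 0 < a -> `|dpl i a x| <= 4 / a.
Proof.
move=> a0; rewrite /dpl normrM normfV (gtr0_norm a0) ler_pM2r ?invr_gt0//.
exact: dplateau_le4.
Qed.

Definition cut a c x := pl ord0 a x * pl (inord 1) a x * pl ord_max c x.
Definition dcut a c (j : 'I_3) x :=
  dpl ord0 a x * (ord0 == j)%:R * pl (inord 1) a x * pl ord_max c x
  + pl ord0 a x * (dpl (inord 1) a x * (inord 1 == j)%:R) * pl ord_max c x
  + pl ord0 a x * pl (inord 1) a x * (dpl ord_max c x * (ord_max == j)%:R).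

Lemma C1_cut a c : C1 (cut a c) (dcut a c).
Proof.
apply: (eq_C1 (C1M (C1M (C1_pl ord0 a) (C1_pl (inord 1) a)) (C1_pl ord_max c))) => //.
by move=> j x; rewrite /dcut; ring.
Qed.

Lemma inord1_coord x : coord (inord 1) x = x.1.2.
Proof. by rewrite /coord inordK. Qed.

Lemma box3_coord (a b c : R) x : box3 a b c x <->
  [/\ `|coord ord0 x| <= a, `|coord (inord 1) x| <= b & `|coord ord_max x| <= c].
Proof. by rewrite inord1_coord /coord /=; split=> [[? [? ?]]|[]]. Qed.

Lemma cut_eq1 a c x : 0 < a -> 0 < c -> box3 a a c x -> cut a c x = 1.
Proof. by move=> a0 c0 /box3_coord[h0 h1 h2]; rewrite /cut !pl_eq1// !mulr1. Qed.

Lemma notin_box3 (a b c : R) x : ~ box3 a b c x ->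
  [\/ a <= `|coord ord0 x|, b <= `|coord (inord 1) x| | c <= `|coord ord_max x|].
Proof.
move=> h; have [h0|h0] := leP a `|coord ord0 x|; first by constructor 1.
have [h1|h1] := leP b `|coord (inord 1) x|; first by constructor 2.
have [h2|h2] := leP c `|coord ord_max x|; first by constructor 3.
by exfalso; apply: h; apply/box3_coord; split; apply: ltW.
Qed.

Lemma cut_eq0 a c x : 0 < a -> 0 < c -> ~ box3 (2 * a) (2 * a) (2 * c) x ->
  cut a c x = 0 /\ forall j, dcut a c j x = 0.
Proof.
move=> a0 c0 /notin_box3 [] h; rewrite /cut /dcut;
by rewrite ?(pl_eq0 a0 h) ?(pl_eq0 c0 h) ?(dpl_eq0 a0 h) ?(dpl_eq0 c0 h);
  split=> [|j]; rewrite ?(dpl_eq0 a0 h) ?(dpl_eq0 c0 h); ring.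
Qed.

Lemma csupp_box3 (f : space3 R -> R) (a b c : R) : (forall x, ~ box3 a b c x -> f x = 0) -> csupp f.
Proof.
move=> f0; exists (Num.max a (Num.max b c)) => x; rewrite ltNge => /negP xr.
apply: f0 => /box3_coord[h0 h1 h2]; apply: xr.
apply/norm_le_box3/box3_coord; rewrite !le_max h0 h1 h2 !orbT //.
Qed.

Lemma csupp_cut a c : 0 < a -> 0 < c -> csupp (cut a c).
Proof. by move=> a0 c0; apply: csupp_box3 => x /(cut_eq0 a0 c0)[]. Qed.

Lemma cc_cut a c : 0 < a -> 0 < c -> cc (cut a c).
Proof. by move=> a0 c0; split; [case: (C1_cut a c)|exact: csupp_cut]. Qed.

Lemma cut_ge0 a c x : 0 <= cut a c x.
Proof. by rewrite /cut mulr_ge0 ?pl_ge0// mulr_ge0 ?pl_ge0. Qed.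

Lemma cut_le1 a c x : cut a c x <= 1.
Proof.
have p i b : [/\ 0 <= pl i b x & pl i b x <= 1] by rewrite pl_ge0 pl_le1.
have [p0 p1] := p ord0 a; have [q0 q1] := p (inord 1) a; have [r0 r1] := p ord_max c.
by apply: mulr_ile1 => //; [apply: mulr_ge0|apply: mulr_ile1].
Qed.

Lemma integral3_cut a c : 0 < a -> 0 < c -> I (cut a c) <= 64 * a ^+ 2 * c.
Proof.
move=> a0 c0.
have a2 : 0 <= 2 * a by rewrite mulr_ge0// ltW.
have c2 : 0 <= 2 * c by rewrite mulr_ge0// ltW.
have h := integral3_le_box3 a2 a2 c2 (cc_cut a0 c0) ler01 (cut_le1 a c)
  (fun x h => (cut_eq0 a0 c0 h).1).
by apply: (le_trans h); apply: eq_ler; ring.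
Qed.

(** Bounding the gradient by the cutoff of doubled size, not by an indicator, keeps both sides
    continuous and reduces every gradient integral to [integral3_cut]. *)
Lemma dcut_le a c j x : 0 < a -> 0 < c ->
  `|dcut a c j x| <= 4 / (if j == ord_max then c else a) * cut (2 * a) (2 * c) x.
Proof.
move=> a0 c0.
have [h|h] := pselect (box3 (2 * a) (2 * a) (2 * c) x); last first.
  rewrite (cut_eq0 a0 c0 h).2 normr0 mulr_ge0 ?cut_ge0// divr_ge0//.
  by case: ifP; rewrite ltW.
rewrite cut_eq1 ?mulr_gt0// mulr1.
have b3 (p q r e : R) : 0 < e -> `|p| <= 4 / e -> 0 <= q <= 1 -> 0 <= r <= 1 -> `|p * q * r| <= 4 / e.
  move=> e0 hp /andP[q0 q1] /andP[r0 r1]; rewrite !normrM !(ger0_norm q0) !(ger0_norm r0).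
  by rewrite -[leRHS]mulr1 -[X in _ <= X * _]mulr1; apply: ler_pM; rewrite ?mulr_ge0//; apply: ler_pM.
have q i d : 0 <= pl i d x <= 1 by rewrite pl_ge0 pl_le1.
have := mem_ord3 j.
rewrite !inE => /or3P[] /eqP ->; rewrite /dcut -!val_eqE /= !inordK//= !(mulr1, mulr0, mul0r, addr0, add0r).
- exact: b3 (dpl_le _ _ a0) _ _.
- by rewrite [pl ord0 a x * _]mulrC; exact: b3 (dpl_le _ _ a0) _ _.
- by rewrite mulrC mulrA; exact: b3 (dpl_le _ _ c0) _ _.
Qed.

(** The slope is at most 4 / a in each direction, since a <= c, on a volume of order a^2 c. The
    constant 48 is 3 * 4^2, and 512 a^2 c, here and below, is the bound of [integral3_cut] at the
    doubled sizes. *)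
Lemma integral3_dcut_sqr a c : 0 < a -> a <= c ->
  I (fun x => dot3 (dcut a c ^~ x) (dcut a c ^~ x)) <= 48 * 512 * c.
Proof.
move=> a0 ac; have c0 : 0 < c by apply: lt_le_trans ac.
have [_ cd _] := C1_cut a c.
have cck : cc (cut (2 * a) (2 * c)) by apply: cc_cut; rewrite mulr_gt0.
apply: (le_trans (y := I (fun x => 48 / a ^+ 2 * cut (2 * a) (2 * c) x))).
  apply: le_integral3; [|exact: ccZ|].
    split; first by rewrite /dot3 /=; cts.
    apply: (@csupp_box3 _ (2 * a) (2 * a) (2 * c)) => x h; rewrite /dot3 !(cut_eq0 a0 c0 h).2; ring.
  move=> x.
  have key j : dcut a c j x ^+ 2 <= 16 / a ^+ 2 * cut (2 * a) (2 * c) x.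
    set k := cut _ _ x; have k0 : 0 <= k by exact: cut_ge0.
    have k1 : k <= 1 by exact: cut_le1.
    have h : `|dcut a c j x| <= 4 / a * k.
      apply: (le_trans (dcut_le j x a0 c0)); rewrite ler_wpM2r// ler_pM2l//.
      by case: ifP => // _; rewrite lef_pV2 ?posrE.
    rewrite -(real_normK (num_real (dcut a c j x))).
    apply: (le_trans (y := (4 / a * k) ^+ 2)).
      by rewrite ler_pXn2r// nnegrE mulr_ge0// divr_ge0// ltW.
    rewrite (_ : (4 / a * k) ^+ 2 = 16 / a ^+ 2 * (k * k)); last by field; rewrite gt_eqF.
    by rewrite ler_wpM2l ?divr_ge0 ?sqr_ge0// ler_piMr.
  have := lerD (lerD (key ord0) (key (inord 1))) (key ord_max).
  by rewrite /dot3 -!expr2 => /le_trans; apply; apply: eq_ler; field; rewrite gt_eqF.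
rewrite integral3Z//.
have := @integral3_cut (2 * a) (2 * c); rewrite !mulr_gt0// => /(_ isT isT) h.
apply: (le_trans (ler_wpM2l _ h)); first by rewrite divr_ge0 ?sqr_ge0.
by apply: eq_ler; field; rewrite gt_eqF.
Qed.

(** The derivative moves to the cutoff, whose vertical slope 4 / c cancels the height in the volume
    a^2 c: the bound does not depend on [c]. *)
Lemma integral3_cut_derive (w : space3 R -> R) dw (s M a c : R) : C1 w dw -> `|s| <= 1 ->
  (forall x, `|w x| <= M) -> 0 < a -> 0 < c ->
  I (fun x => cut a c x * (s * dw ord_max x)) <= 4 * 512 * M * a ^+ 2.
Proof.
move=> Cw s1 wM a0 c0; have M0 : 0 <= M by apply: le_trans (wM 0).
have CF := C1M (C1_cut a c) (C1M (C1_cst s) Cw).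
have sF : csupp (fun x => cut a c x * (s * w x)).
  by apply: csupp_box3 => x /(cut_eq0 a0 c0)[-> _]; rewrite mul0r.
have F0 := integral3_derive_eq0 ord_max CF sF.
have [_ cF _] := CF; have ccF : cc _ := conj (cF ord_max) (csupp_derive ord_max CF sF).
have [cw cdw _] := Cw; have [cx cdx _] := C1_cut a c.
have cck : cc (cut (2 * a) (2 * c)) by apply: cc_cut; rewrite mulr_gt0.
apply: (le_trans (y := I (fun x => 4 / c * M * cut (2 * a) (2 * c) x))).
  apply: (@le_integral3_add _ _ _ _ _ _ ccF F0); [|exact: ccZ|].
    split; first by cts.
    by apply: csupp_box3 => x /(cut_eq0 a0 c0)[-> _]; rewrite mul0r.
  move=> x; rewrite /=.
  have := @dcut_le a c ord_max x a0 c0; rewrite eqxx => h.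
  have h2 : - (dcut a c ord_max x * (s * w x)) <= 4 / c * M * cut (2 * a) (2 * c) x.
    rewrite (le_trans (ler_norm _))// normrN normrM mulrAC.
    apply: ler_pM => //; rewrite normrM -[leRHS]mul1r; exact: ler_pM.
  rewrite mul0r add0r; move: h2; set p := dcut _ _ _ _ * _; set q := cut _ _ _ * _; lra.
rewrite integral3Z//.
have := @integral3_cut (2 * a) (2 * c); rewrite !mulr_gt0// => /(_ isT isT) h.
apply: (le_trans (ler_wpM2l _ h)); first by rewrite mulr_ge0// divr_ge0// ltW.
by apply: eq_ler; field; rewrite gt_eqF.
Qed.

End cut.

(** * Logarithmic cutoffs in the horizontal directions *)

Section log_cutoff.
Variable R : realType.
Local Notation I := (@integral3 R).
Implicit Types (a c r : R) (x : space3 R).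

Definition cyl r x := pl ord0 r x * pl (inord 1) r x.
Definition dcyl r (j : 'I_3) x :=
  dpl ord0 r x * (ord0 == j)%:R * pl (inord 1) r x
  + pl ord0 r x * (dpl (inord 1) r x * (inord 1 == j)%:R).

Lemma C1_cyl r : C1 (cyl r) (dcyl r).
Proof.
by apply: (eq_C1 (C1M (C1_pl ord0 r) (C1_pl (inord 1) r))) => // j x; rewrite /dcyl; ring.
Qed.

Lemma dcyl_max r x : dcyl r ord_max x = 0.
Proof. by rewrite /dcyl -!val_eqE /= inordK//=; ring. Qed.

Definition radius x := Num.max `|coord ord0 x| `|coord (inord 1) x|.

Lemma cyl_ge0 r x : 0 <= cyl r x. Proof. by rewrite mulr_ge0 ?pl_ge0. Qed.

Lemma cyl_eq1 r x : 0 < r -> radius x <= r -> cyl r x = 1.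
Proof. by move=> r0; rewrite ge_max => /andP[h0 h1]; rewrite /cyl !pl_eq1// mulr1. Qed.

Lemma cyl_eq0 r x : 0 < r -> 2 * r <= radius x -> cyl r x = 0 /\ forall j, dcyl r j x = 0.
Proof.
move=> r0; rewrite le_max => /orP[] h; rewrite /cyl /dcyl.
  by rewrite (pl_eq0 r0 h) (dpl_eq0 r0 h); split=> [|j]; ring.
by rewrite (pl_eq0 r0 h) (dpl_eq0 r0 h); split=> [|j]; ring.
Qed.

Lemma dcyl_in r j x : 0 < r -> radius x <= r -> dcyl r j x = 0.
Proof.
by move=> r0; rewrite ge_max => /andP[h0 h1]; rewrite /dcyl !dpl_in//; ring.
Qed.

(** The sum of K planar cutoffs at the radii 2 a, ..., 2^K a. Divided by K it is a discrete
    logarithmic cutoff, which loses 1 / K over each dyadic shell. *)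
Fixpoint layers a (K : nat) x :=
  if K is K'.+1 then layers a K' x + cyl (2 ^+ K * a) x else 0.
Fixpoint dlayers a (K : nat) (j : 'I_3) x :=
  if K is K'.+1 then dlayers a K' j x + dcyl (2 ^+ K * a) j x else 0.

Lemma C1_layers a K : C1 (layers a K) (dlayers a K).
Proof.
elim: K => [|K IH]; first exact: (eq_C1 (C1_cst (0 : R))).
by apply: (eq_C1 (C1D IH (C1_cyl (2 ^+ K.+1 * a)))).
Qed.

Lemma layers_le a K x : 0 < a -> 0 <= layers a K x <= K%:R * cyl (2 ^+ K.+1 * a) x.
Proof.
move=> a0; elim: K => [|K /andP[IH0 IH1]] /=; first by rewrite mul0r lexx.
set r := 2 ^+ K.+1 * a; have r0 : 0 < r by rewrite mulr_gt0// exprn_gt0.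
have er : 2 ^+ K.+2 * a = 2 * r by rewrite exprS mulrA.
rewrite addr_ge0 ?cyl_ge0//= er.
have [h|h] := leP (2 * r) (radius x).
  have h0 := (cyl_eq0 r0 h).1.
  rewrite h0 addr0; apply: (le_trans IH1); rewrite -/r h0 mulr0 mulr_ge0 ?cyl_ge0//.
rewrite (@cyl_eq1 (2 * r)) ?mulr_gt0// ?(ltW h)//.
have c1 : cyl r x <= 1 by apply: mulr_ile1; rewrite ?pl_ge0 ?pl_le1.
rewrite mulr1 -(@natr1 R); apply: lerD => //; apply: (le_trans IH1); rewrite -/r.
by rewrite ler_piMr.
Qed.

Lemma layers_in a K x : 0 < a -> radius x <= 2 * a -> layers a K x = K%:R.
Proof.
move=> a0 h; elim: K => //= K ->; rewrite cyl_eq1 ?natr1// ?mulr_gt0 ?exprn_gt0//.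
apply: (le_trans h); rewrite ler_pM2r// exprS ler_peMr// exprn_ege1//; lra.
Qed.

Lemma dlayers_max a K x : dlayers a K ord_max x = 0.
Proof. by elim: K => //= K ->; rewrite dcyl_max addr0. Qed.

Lemma dlayers_out a K j x : 0 < a -> 2 ^+ K.+1 * a <= radius x -> dlayers a K j x = 0.
Proof.
move=> a0; elim: K => //= K IH h.
have e : 2 ^+ K.+2 * a = 2 * (2 ^+ K.+1 * a) by rewrite exprS mulrA.
have r0 : 0 < 2 ^+ K.+1 * a by rewrite mulr_gt0// exprn_gt0.
rewrite e in h; rewrite IH ?(cyl_eq0 r0 h).2 ?addr0//.
by apply: le_trans h; rewrite ler_peMl ?ltW//; lra.
Qed.

(* Consecutive layers vary on disjoint shells. *)
Lemma dlayersS_sqr a K j x : 0 < a ->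
  dlayers a K.+1 j x ^+ 2 = dlayers a K j x ^+ 2 + dcyl (2 ^+ K.+1 * a) j x ^+ 2.
Proof.
move=> a0 /=; have r0 : 0 < 2 ^+ K.+1 * a by rewrite mulr_gt0// exprn_gt0.
have [h|h] := leP (2 ^+ K.+1 * a) (radius x).
  by rewrite dlayers_out//; ring.
by rewrite (dcyl_in j r0 (ltW h)); ring.
Qed.

Lemma cut_cyl a c x : cut a c x = cyl a x * pl ord_max c x. Proof. by []. Qed.

Lemma dcut_cyl a c j x : j != ord_max -> dcut a c j x = dcyl a j x * pl ord_max c x.
Proof. by move=> jm; rewrite /dcut /dcyl [ord_max == j]eq_sym (negbTE jm) /=; ring. Qed.

Lemma dcyl_le r j x : 0 < r -> j != ord_max -> `|dcyl r j x| <= 4 / r.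
Proof.
(* A height at which the vertical factor of the cutoff equals 1 at [x], so that [dcut_le]
   applies. *)
move=> r0 jm; pose c := Num.max 1 `|coord ord_max x|.
have c0 : 0 < c by rewrite lt_max ltr01.
have := dcut_le j x r0 c0; rewrite (negbTE jm) dcut_cyl// pl_eq1 ?le_max ?lexx ?orbT//.
rewrite mulr1 => /le_trans; apply.
by rewrite ler_piMr ?cut_le1// divr_ge0// ltW.
Qed.

Lemma C1_pl_max c : C1 (pl ord_max c) (fun j x => dpl ord_max c x * (ord_max == j)%:R :> R).
Proof. exact: C1_pl. Qed.

(** The Dirichlet energy of a planar cutoff is scale invariant, so each shell contributes the same
    order c; since the shells are disjoint, the total is of order K c and not K^2 c. *)
Lemma integral3_dlayers a c K : 0 < a -> 2 ^+ K * a <= c ->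
  I (fun x => (dlayers a K ord0 x ^+ 2 + dlayers a K (inord 1) x ^+ 2) * pl ord_max c x ^+ 2)
  <= 48 * 512 * K%:R * c.
Proof.
move=> a0; elim: K => [|K IH] h.
  rewrite /= (_ : (fun x => _) = (fun x => 0 * cut 1 1 x)); last by apply/funext => x; ring.
  by rewrite integral3Z ?mul0r ?mulr0 ?mul0r//; exact: cc_cut.
have r0 : 0 < 2 ^+ K.+1 * a by rewrite mulr_gt0// exprn_gt0.
have c0 : 0 < c by exact: lt_le_trans h.
have {}IH := IH (le_trans _ h).
have {}IH : I (fun x => (dlayers a K ord0 x ^+ 2 + dlayers a K (inord 1) x ^+ 2) * pl ord_max c x ^+ 2)
  <= 48 * 512 * K%:R * c.
  by apply: IH; rewrite ler_pM2r// exprS ler_peMl ?exprn_ge0//; lra.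
have [_ cdl _] := C1_layers a K; have [_ cdl' _] := C1_layers a K.+1.
have [_ cdc _] := C1_cut (2 ^+ K.+1 * a) c.
have [cpl _ _] := C1_pl_max c.
have csl k : csupp (fun x => (dlayers a k ord0 x ^+ 2 + dlayers a k (inord 1) x ^+ 2) * pl ord_max c x ^+ 2).
  apply: (@csupp_box3 _ _ (2 ^+ k.+1 * a) (2 ^+ k.+1 * a) (2 * c)) => x /notin_box3[] hx.
  - by rewrite !dlayers_out ?le_max ?hx ?orbT//; ring.
  - by rewrite !dlayers_out ?le_max ?hx ?orbT//; ring.
  - by rewrite (pl_eq0 c0 hx); ring.
have ccl : cc (fun x => (dlayers a K ord0 x ^+ 2 + dlayers a K (inord 1) x ^+ 2) * pl ord_max c x ^+ 2).
  by split; [cts|exact: csl].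
have ccc : cc (fun x => dot3 (dcut (2 ^+ K.+1 * a) c ^~ x) (dcut (2 ^+ K.+1 * a) c ^~ x)).
  apply: (cc_dom (C1_cut (2 ^+ K.+1 * a) c)) => //; first exact: csupp_cut.
    by rewrite /dot3 /=; cts.
  by move=> x _ h0; rewrite /dot3 !h0; ring.
apply: (le_trans (y := I (fun x => (dlayers a K ord0 x ^+ 2 + dlayers a K (inord 1) x ^+ 2) * pl ord_max c x ^+ 2
   + dot3 (dcut (2 ^+ K.+1 * a) c ^~ x) (dcut (2 ^+ K.+1 * a) c ^~ x)))).
  apply: le_integral3; [|exact: ccD|].
    by split; [cts; exact: cdl'|exact: csl].
  move=> x; have i1m : inord 1 != ord_max :> 'I_3 by rewrite -val_eqE /= inordK.
  have i0m : ord0 != ord_max :> 'I_3 by [].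
  rewrite !dlayersS_sqr// /dot3 (dcut_cyl _ _ _ i0m) (dcut_cyl _ _ _ i1m).
  have := sqr_ge0 (dcut (2 ^+ K.+1 * a) c ord_max x); lra.
rewrite integral3D//; apply: (le_trans (lerD IH (integral3_dcut_sqr r0 h))).
by rewrite -(@natr1 R); lra.
Qed.

(* A logarithmic cutoff in the two horizontal directions: the energy gained is
   the factor [1 / K], at the price of a height [c] that is large with respect
   to [2 ^+ K * a]. *)
Lemma log_cutoff a (K : nat) : 0 < a -> (0 < K)%N ->
  exists c0, forall c, c0 <= c -> 0 < c -> exists z dz,
    [/\ C1 z dz, csupp z, forall x, cut a c x <= z x
      & I (fun x => dot3 (dz ^~ x) (dz ^~ x)) <= 100 * 512 * (c / K%:R)].
Proof.
move=> a0 K0; have K1 : 1 <= K%:R :> R by rewrite ler1n.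
have Kp : 0 < K%:R :> R by lra.
set r := 2 ^+ K.+1 * a; have r0 : 0 < r by rewrite mulr_gt0// exprn_gt0.
(* Makes the contribution of the vertical slope, 64^2 r^2 / c, at most c / K. *)
exists (64 * r * K%:R) => c hc c0.
have rK : r <= 64 * r * K%:R by rewrite mulrAC ler_peMl ?(ltW r0)//; lra.
have rc : r <= c by exact: le_trans hc.
have c20 : 0 < 2 * c by rewrite mulr_gt0.
have Cz := C1M (C1M (C1_cst K%:R^-1) (C1_layers a K)) (C1_pl_max (2 * c)).
(* The inner radius 2 a and the inner height 2 c make this equal to 1 on the support of
   [cut a c]. *)
exists (fun x => K%:R^-1 * layers a K x * pl ord_max (2 * c) x).
set dz := (X in C1 _ X) in Cz; exists dz.
have sz : csupp (fun x => K%:R^-1 * layers a K x * pl ord_max (2 * c) x).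
  apply: (@csupp_box3 _ _ (2 * r) (2 * r) (2 * (2 * c))) => x hx.
  have [h|h] := ltP (radius x) (2 * r).
    move/notin_box3: hx => -[] hx.
    - by move: h; rewrite gt_max ltNge hx.
    - by move: h; rewrite gt_max [X in _ && X]ltNge hx andbF.
    - by rewrite (pl_eq0 c20 hx) mulr0.
  have := layers_le K x a0; rewrite (cyl_eq0 r0 h).1 mulr0 => hl.
  have -> : layers a K x = 0 by apply/le_anti; rewrite andbC.
  by rewrite mulr0 mul0r.
split=> //.
  move=> x; have z0 : 0 <= K%:R^-1 * layers a K x * pl ord_max (2 * c) x.
    have /andP[l0 _] := layers_le K x a0.
    by apply: mulr_ge0 (pl_ge0 _ _ _); apply: mulr_ge0; rewrite ?invr_ge0.
  have [h|h] := pselect (box3 (2 * a) (2 * a) (2 * c) x); last by rewrite (cut_eq0 a0 c0 h).1.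
  move/box3_coord : h => [h0 h1 h2].
  by rewrite layers_in// ?ge_max ?h0// pl_eq1// mulVf ?gt_eqF// mulr1 cut_le1.
have [_ cdz _] := Cz; have [cl cdl _] := C1_layers a K; have [cp _ _] := C1_pl_max (2 * c).
have [_ cdc _] := C1_cut r (2 * c).
have ccH : cc (fun x => (dlayers a K ord0 x ^+ 2 + dlayers a K (inord 1) x ^+ 2) * pl ord_max (2 * c) x ^+ 2).
  split; first by cts.
  apply: (@csupp_box3 _ _ r r (2 * (2 * c))) => x /notin_box3[] hx.
  - by rewrite !dlayers_out ?le_max ?hx ?orbT//; ring.
  - by rewrite !dlayers_out ?le_max ?hx ?orbT//; ring.
  - by rewrite (pl_eq0 c20 hx); ring.
have cck : cc (cut (2 * r) (2 * (2 * c))) by apply: cc_cut; rewrite mulr_gt0.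
apply: (le_trans (y := I (fun x => K%:R ^- 2 * ((dlayers a K ord0 x ^+ 2 + dlayers a K (inord 1) x ^+ 2) * pl ord_max (2 * c) x ^+ 2)
   + 4 / c ^+ 2 * cut (2 * r) (2 * (2 * c)) x))).
  apply: le_integral3; [|by apply: ccD; exact: ccZ|].
    apply: (cc_dom Cz) => //; first by rewrite /dot3 /=; cts.
    by move=> x _ h0; rewrite /dot3 !h0; ring.
  move=> x; rewrite /dot3.
  have i1m : (ord_max == inord 1 :> 'I_3) = false by rewrite -val_eqE /= inordK.
  have -> : dz ord0 x = K%:R^-1 * dlayers a K ord0 x * pl ord_max (2 * c) x.
    by rewrite /dz /=; ring.
  have -> : dz (inord 1) x = K%:R^-1 * dlayers a K (inord 1) x * pl ord_max (2 * c) x.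
    by rewrite /dz /= i1m (_ : false%:R = 0)//; ring.
  have -> : dz ord_max x = K%:R^-1 * layers a K x * dpl ord_max (2 * c) x.
    by rewrite /dz /= dlayers_max; ring.
  have /andP[l0 l1] := layers_le K x a0.
  have hv : K%:R^-1 * layers a K x * `|dpl ord_max (2 * c) x| <= 2 / c * cut (2 * r) (2 * (2 * c)) x.
    apply: (le_trans (y := cyl r x * `|dpl ord_max (2 * c) x|)).
      by rewrite ler_wpM2r// ler_pdivrMl.
    have := dcut_le ord_max x r0 c20; rewrite eqxx.
    rewrite {1}/dcut eqxx -!val_eqE /= !inordK//= !(mulr0, mul0r, add0r, mulr1) normrM.
    rewrite (ger0_norm (cyl_ge0 r x)) => /le_trans; apply.
    by apply: eq_ler; field; rewrite gt_eqF.
  have hv2 : (K%:R^-1 * layers a K x * dpl ord_max (2 * c) x) ^+ 2 <= 4 / c ^+ 2 * cut (2 * r) (2 * (2 * c)) x.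
    set w := cut _ _ x in hv *; have w0 : 0 <= w by exact: cut_ge0.
    have w1 : w <= 1 by exact: cut_le1.
    rewrite exprMn -(real_normK (num_real (dpl _ _ _))) -exprMn.
    apply: (le_trans (y := (2 / c * w) ^+ 2)).
      rewrite ler_pXn2r// nnegrE mulr_ge0// ?divr_ge0 ?(ltW c0)//.
      by rewrite mulr_ge0 ?invr_ge0// ltW.
    rewrite (_ : (2 / c * w) ^+ 2 = 4 / c ^+ 2 * (w * w)); last by field; rewrite gt_eqF.
    by rewrite ler_wpM2l ?divr_ge0 ?sqr_ge0// ler_piMr.
  move: hv2; set q := _ * cut _ _ _ => hv2.
  rewrite -exprVn.
  move: hv2; set k := K%:R^-1; set s := _ * dpl _ _ _ => hv2.
  have -> : s * s = s ^+ 2 by ring.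
  move: hv2; set s2 := s ^+ 2; set d0 := dlayers _ _ _ _; set d1 := dlayers _ _ _ _; lra.
rewrite integral3D ?integral3Z//; [|exact: ccZ|exact: ccZ].
have h1 := @integral3_dlayers a (2 * c) K a0.
have {}h1 : I (fun x => (dlayers a K ord0 x ^+ 2 + dlayers a K (inord 1) x ^+ 2) * pl ord_max (2 * c) x ^+ 2)
  <= 48 * 512 * K%:R * (2 * c).
  apply: h1; apply: (le_trans (y := r)); last by lra.
  by rewrite ler_pM2r// exprS ler_peMl ?exprn_ge0//; lra.
have h2 : I (cut (2 * r) (2 * (2 * c))) <= 64 * (2 * r) ^+ 2 * (2 * (2 * c)).
  by apply: integral3_cut; rewrite mulr_gt0.
have e1 : K%:R ^- 2 * (48 * 512 * K%:R * (2 * c)) = 96 * 512 * (c / K%:R).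
  by field; rewrite gt_eqF.
have e2 : 4 / c ^+ 2 * (64 * (2 * r) ^+ 2 * (2 * (2 * c))) = 64 ^+ 2 * r ^+ 2 / c.
  by field; rewrite gt_eqF.
have p1 : 0 <= K%:R ^- 2 :> R by rewrite invr_ge0 sqr_ge0.
have p2 : 0 <= 4 / c ^+ 2 by rewrite divr_ge0 ?sqr_ge0.
have h3 : 64 ^+ 2 * r ^+ 2 / c <= c / K%:R.
  rewrite ler_pdivrMr// [leRHS]mulrAC ler_pdivlMr//.
  apply: (le_trans (y := (64 * r * K%:R) ^+ 2)).
    rewrite !exprMn; apply: ler_wpM2l; first by apply: mulr_ge0 (sqr_ge0 _) _; apply: mulr_ge0; exact: sqr_ge0.
    by rewrite expr2 ler_peMl ?(ltW Kp).
  by rewrite -expr2 ler_pXn2r// nnegrE ?mulr_ge0 ?(ltW c0) ?(ltW r0)// ltW.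
have := lerD (ler_wpM2l p1 h1) (ler_wpM2l p2 h2); rewrite e1 e2 => /le_trans; apply.
have p3 : 0 <= c / K%:R by rewrite divr_ge0// ltW.
move: h3 p3; set p := c / _; set q := _ / c; lra.
Qed.

End log_cutoff.

(** * Horizontal derivatives on high cylinders *)

Section cut_bounds.
Variable R : realType.
Local Notation I := (@integral3 R).
Implicit Types (a c : R) (x : space3 R).

Lemma ccM_cut f a c : 0 < a -> 0 < c -> continuous f -> cc (fun x => cut a c x ^+ 2 * f x).
Proof.
move=> a0 c0 cf; have [cz _ _] := C1_cut a c; split; first by cts.
by apply: (@csupp_box3 _ _ (2 * a) (2 * a) (2 * c)) => x /(cut_eq0 a0 c0)[-> _]; ring.
Qed.

Lemma integral3_cut_sqr a c : 0 < a -> 0 < c -> I (fun x => cut a c x ^+ 2) <= 64 * a ^+ 2 * c.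
Proof.
move=> a0 c0; apply: le_trans (integral3_cut a0 c0); apply: le_integral3 (cc_cut a0 c0) _.
  rewrite (_ : (fun x => _) = fun x => cut a c x ^+ 2 * 1); last by apply/funext => x; rewrite mulr1.
  by apply: ccM_cut => //; exact: cst_continuous.
by move=> x; rewrite expr2 ler_piMl ?cut_ge0 ?cut_le1.
Qed.

Lemma integral3_cut_dcut a c j : 0 < a -> 0 < c -> j != ord_max ->
  I (fun x => `|cut a c x| * `|dcut a c j x|) <= 4 * 512 * a * c.
Proof.
move=> a0 c0 jm; have [cz cdz _] := C1_cut a c.
have cck : cc (cut (2 * a) (2 * c)) by apply: cc_cut; rewrite mulr_gt0.
apply: (le_trans (y := I (fun x => 4 / a * cut (2 * a) (2 * c) x))).
  apply: le_integral3; [|exact: ccZ|].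
    split; first by cts.
    by apply: (@csupp_box3 _ _ (2 * a) (2 * a) (2 * c)) => x /(cut_eq0 a0 c0)[-> _]; rewrite normr0 mul0r.
  move=> x; have := dcut_le j x a0 c0; rewrite (negbTE jm); apply: le_trans.
  by rewrite ler_piMl// ger0_norm ?cut_ge0 ?cut_le1.
rewrite integral3Z//.
have := @integral3_cut R (2 * a) (2 * c); rewrite !mulr_gt0// => /(_ isT isT) h.
apply: (le_trans (ler_wpM2l _ h)); first by rewrite divr_ge0// ltW.
by apply: eq_ler; field; rewrite gt_eqF.
Qed.

(* [abs_derive_bound] with [kappa = a] and [l] of order [a]; the factor
   [expR (2 l)] is compensated by [K >= expR (2 l)] layers in [log_cutoff]. *)
Lemma cut_abs_derive (p b q w phi psi k : space3 R -> R)
    (dw dg dphi dpsi dk : 'I_3 -> space3 R -> R) (i : 'I_3) (M A : R) :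
  [/\ continuous p, continuous b & continuous q] ->
  C1 w dw -> C1 (dw i) dg -> C1 k dk -> C1 phi dphi -> C1 psi dpsi ->
  (forall x, 0 <= b x) -> (forall x, 0 < phi x) -> (forall x, 0 < psi x) ->
  weak_solution p b phi psi dphi -> weak_solution q b psi phi dpsi ->
  weak_solution p b (dw i) k dg -> weak_solution q b k (dw i) dk ->
  1 <= M -> (forall x, `|w x| <= M) -> (forall x, `|dw i x| <= M) -> (forall x, `|k x| <= M) ->
  0 <= A -> (forall x, p x <= A) -> i != ord_max ->
  exists C, forall a, 1 <= a -> exists c0, forall c, c0 <= c -> a <= c ->
    I (fun x => cut a c x ^+ 2 * `|dw i x|) <= C * (a * c).
Proof.
move=> [cp cb cq] Cw Cg Ck Cphi Cpsi b0 phi0 psi0 wphi wpsi wg wk M1 wM gM kM A0 pA im.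
(* The three summands come from [g1], [g2] and [g4]. *)
exists (8 * M * (4 * 512) + (M + 1) * 64 + M / 2 * (8 * M ^+ 2 * (100 * 512) + (4 * (48 * 512) + 2 * A * 64))).
move=> a a1; have a0 : 0 < a by lra.
(* 2 M + 1 <= l keeps the smooth sign bounded by 2; 2 a <= l gives exp(-l / 2) <= 1 / a and 2 M a /
   l^2 <= M / (2 a). *)
pose l := 2 * a + 2 * M + 1.
have l0 : 0 < l by rewrite /l; lra.
pose K := Num.bound (expR l ^+ 2).
have hK : expR l ^+ 2 < K%:R by apply: archi_boundP; rewrite sqr_ge0.
have K0 : (0 < K)%N by rewrite -(ltr_nat R); apply: le_lt_trans hK; rewrite sqr_ge0.
have [c0 hc0] := log_cutoff a0 K0; exists c0 => c c0c ac.
have cp0 : 0 < c by apply: lt_le_trans ac.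
have [z [dz [Cz sz zge hz]]] := hc0 c c0c cp0.
have Cx := C1_cut a c; have sx := csupp_cut a0 cp0.
have [cw cdw _] := Cw; have [cg cdg _] := Cg; have [ck cdk _] := Ck.
have [cphi cdphi _] := Cphi; have [cpsi cdpsi _] := Cpsi.
have [cx cdx _] := Cx; have [cz cdz _] := Cz.
have phin0 x : phi x != 0 by rewrite gt_eqF.
set ZZ := fun x => dot3 (quot_grad phi dphi (dw i) dg x) (quot_grad phi dphi (dw i) dg x).
have cZZ : continuous ZZ by rewrite /ZZ /quot_grad /dot3 /=; cts.
have ZZ0 x : 0 <= ZZ x by rewrite /ZZ /dot3 !addr_ge0// -expr2 sqr_ge0.
set LL := fun x => dot3 (dphi ^~ x) (dphi ^~ x) / phi x ^+ 2.
have cLL : continuous LL.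
  by rewrite /LL /dot3 /=; cts; move=> x; rewrite expf_neq0.
have cc1 : cc (fun x => `|cut a c x| * `|dcut a c i x|).
  by apply: (cc_dom Cx sx); [cts|move=> x -> _; rewrite normr0 mul0r].
have cc2 : cc (fun x => cut a c x ^+ 2).
  by apply: (cc_dom Cx sx); [cts|move=> x -> _; rewrite expr0n].
have cc3 : cc (fun x => cut a c x ^+ 2 * ZZ x) by apply: ccM_cut.
have cc4 : cc (fun x => cut a c x ^+ 2 * LL x) by apply: ccM_cut.
(* [cut a c] is replaced by the larger [z], whose gradient energy is smaller. *)
have i3 : I (fun x => cut a c x ^+ 2 * ZZ x) <= 8 * M ^+ 2 * (100 * 512 * (c / K%:R)).
  apply: (le_trans (y := I (fun x => z x ^+ 2 * ZZ x))).
    apply: le_integral3 => //.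
      by apply: (cc_dom Cz sz); [cts|move=> x -> _; rewrite expr0n mul0r].
    move=> x; rewrite ler_wpM2r// ler_pXn2r// nnegrE ?cut_ge0//.
    exact: le_trans (cut_ge0 a c x) (zge x).
  apply: (le_trans (quotient_bound cp cb cq Cphi Cpsi Cg Ck Cz sz b0 phi0 psi0 wphi wpsi wg wk)).
  have ccd : cc (fun x => dot3 (dz ^~ x) (dz ^~ x)).
    by apply: (cc_dom Cz sz); [rewrite /dot3 /=; cts|move=> x _ h; rewrite /dot3 !h; ring].
  have h : I (fun x => (dw i x ^+ 2 + k x ^+ 2) * dot3 (dz ^~ x) (dz ^~ x)) <=
     2 * M ^+ 2 * I (fun x => dot3 (dz ^~ x) (dz ^~ x)).
    rewrite -integral3Z//; apply: le_integral3; [|exact: ccZ|].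
      by apply: (cc_dom Cz sz); [rewrite /dot3 /=; cts|move=> x _ h; rewrite /dot3 !h; ring].
    move=> x; apply: ler_wpM2r; first by rewrite /dot3 !addr_ge0// -expr2 sqr_ge0.
    have sM t : `|t| <= M -> t ^+ 2 <= M ^+ 2.
      by move=> tM; rewrite -(real_normK (num_real t)) ler_pXn2r// nnegrE; lra.
    by have := lerD (sM _ (gM x)) (sM _ (kM x)); lra.
  have := ler_wpM2l (_ : 0 <= 2 * M ^+ 2) hz; rewrite mulr_ge0 ?sqr_ge0// => /(_ isT).
  by move: h; set p1 := I _; set p2 := I _; set p3 := c / _; lra.
(* Only of order a^2 c; the factor 2 M a / l^2 in front of it will remove one power of a. *)
have i4 : I (fun x => cut a c x ^+ 2 * LL x) <= 4 * (48 * 512 * c) + 2 * A * (64 * a ^+ 2 * c).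
  have psi0' x : 0 <= psi x by exact: ltW.
  apply: (le_trans (weak_log_caccioppoli cp cb cpsi Cphi phi0 wphi Cx sx b0 psi0')).
  have ccd : cc (fun x => dot3 (dcut a c ^~ x) (dcut a c ^~ x)).
    by apply: (cc_dom Cx sx); [rewrite /dot3 /=; cts|move=> x _ h; rewrite /dot3 !h; ring].
  apply: (le_trans (y := I (fun x => 4 * dot3 (dcut a c ^~ x) (dcut a c ^~ x) + 2 * A * cut a c x ^+ 2))).
    apply: le_integral3; [|by apply: ccD; exact: ccZ|].
      apply: (cc_dom Cx sx); first by rewrite /dot3 /=; cts.
      by move=> x h0 h; rewrite h0 /dot3 !h; ring.
    move=> x; rewrite lerD2l ler_wpM2r ?sqr_ge0//; have := pA x; lra.
  rewrite integral3D; [|exact: ccZ|exact: ccZ]; rewrite !integral3Z//.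
  have h1 := integral3_dcut_sqr a0 ac.
  have h2 := integral3_cut_sqr a0 cp0.
  have A2 : 0 <= 2 * A by lra.
  have := ler_wpM2l A2 h2.
  move: h1; set p1 := I _; set p2 := I _; lra.
have hl : 2 * M + 1 <= l by rewrite /l; lra.
apply: (le_trans (abs_derive_bound Cw Cg Cphi Cx sx phi0 wM gM a0 hl)).
rewrite -/ZZ.
have -> : (fun x => 8 * M * (`|cut a c x| * `|dcut a c i x|) +
   ((M / a + expR (- l / 2)) * cut a c x ^+ 2 + 2 * M * a / l ^+ 2 *
    (expR (- l) ^- 2 * (cut a c x ^+ 2 * dot3 (quot_grad phi dphi (dw i) dg x) (quot_grad phi dphi (dw i) dg x)) +
     cut a c x ^+ 2 * (dot3 (dphi^~ x) (dphi^~ x) / phi x ^+ 2)))) =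
  (fun x => 8 * M * (`|cut a c x| * `|dcut a c i x|) +
   ((M / a + expR (- l / 2)) * cut a c x ^+ 2 + 2 * M * a / l ^+ 2 *
    (expR (- l) ^- 2 * (cut a c x ^+ 2 * ZZ x) + cut a c x ^+ 2 * LL x))) by [].
have cc34 : cc (fun x => expR (- l) ^- 2 * (cut a c x ^+ 2 * ZZ x) + cut a c x ^+ 2 * LL x).
  by apply: ccD => //; exact: ccZ.
rewrite integral3D; [|exact: ccZ|by apply: ccD; exact: ccZ].
rewrite integral3D; [|exact: ccZ|exact: ccZ].
rewrite !integral3Z// integral3D//; last exact: ccZ.
rewrite integral3Z//.
have i1 := integral3_cut_dcut a0 cp0 im.
have i2 := integral3_cut_sqr a0 cp0.
move: i1 i2 i3 i4; set i1 := I _; set i2 := I _; set i3 := I _; set i4 := I _ => h1 h2 h3 h4.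
have g1 : 8 * M * i1 <= 8 * M * (4 * 512) * (a * c).
  rewrite -[X in _ <= X]mulrA; apply: ler_wpM2l; first lra.
  by apply: le_trans h1 _; rewrite mulrA.
have e1 : expR (- l / 2) <= a^-1.
  rewrite mulNr expRN lef_pV2 ?posrE ?expR_gt0//.
  by apply: le_trans (expR_ge1Dx _); rewrite /l; lra.
have g2 : (M / a + expR (- l / 2)) * i2 <= (M + 1) * 64 * (a * c).
  apply: (le_trans (y := (M / a + a^-1) * (64 * a ^+ 2 * c))).
    apply: (le_trans (y := (M / a + expR (- l / 2)) * (64 * a ^+ 2 * c))).
      by apply: ler_wpM2l h2; rewrite addr_ge0 ?expR_ge0// divr_ge0//; lra.
    apply: ler_wpM2r; last by rewrite lerD2l.
    by rewrite mulr_ge0 ?(ltW cp0)// mulr_ge0 ?sqr_ge0.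
  by apply: eq_ler; field; rewrite gt_eqF.
have t1 : 2 * M * a / l ^+ 2 <= M / 2 * a^-1.
  rewrite ler_pdivrMr ?exprn_gt0//.
  have -> : 2 * M * a = M / 2 * a^-1 * (2 * a) ^+ 2 by field; rewrite gt_eqF.
  apply: ler_wpM2l; first by rewrite mulr_ge0 ?invr_ge0 ?(ltW a0)// divr_ge0//; lra.
  by rewrite ler_pXn2r // ?nnegrE /l; lra.
have N0 : 0 <= 8 * M ^+ 2 * (100 * 512) by have := sqr_ge0 M; lra.
have g3 : expR (- l) ^- 2 * i3 <= 8 * M ^+ 2 * (100 * 512) * c.
  have eK : expR (- l) ^- 2 <= K%:R by rewrite expRN exprVn invrK ltW.
  have Kp : 0 < K%:R :> R by rewrite ltr0n.
  have B0 : 0 <= 8 * M ^+ 2 * (100 * 512 * (c / K%:R)).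
    rewrite mulrA; apply: mulr_ge0 N0 _.
    exact: divr_ge0 (ltW cp0) (ltW Kp).
  apply: (le_trans (y := expR (- l) ^- 2 * (8 * M ^+ 2 * (100 * 512 * (c / K%:R))))).
    by apply: ler_wpM2l h3; rewrite invr_ge0 sqr_ge0.
  apply: (le_trans (ler_wpM2r B0 eK)).
  by apply: eq_ler; field; rewrite gt_eqF.
have g4 : 2 * M * a / l ^+ 2 * (expR (- l) ^- 2 * i3 + i4) <=
    M / 2 * (8 * M ^+ 2 * (100 * 512) + (4 * (48 * 512) + 2 * A * 64)) * (a * c).
  have t0 : 0 <= 2 * M * a / l ^+ 2.
    by apply: divr_ge0; [apply: mulr_ge0; lra|exact: sqr_ge0].
  apply: (le_trans (ler_wpM2l t0 (lerD g3 h4))).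
  set BB := _ + _; have BB0 : 0 <= BB.
    apply: addr_ge0.
      exact: mulr_ge0 (ltW cp0).
    apply: addr_ge0; first by move: cp0; lra.
    by apply: mulr_ge0; [lra|apply: mulr_ge0 (ltW cp0); apply: mulr_ge0; rewrite ?sqr_ge0].
  apply: (le_trans (ler_wpM2r BB0 t1)); rewrite -!(mulrA (M / 2)).
  apply: ler_wpM2l; first lra.
  rewrite ler_pdivrMl// /BB.
  have a2 : 1 <= a ^+ 2 by rewrite exprn_ege1.
  have k0 : 0 <= (8 * M ^+ 2 * (100 * 512) + 4 * (48 * 512)) * c.
    by apply: mulr_ge0 (ltW cp0); move: N0; lra.
  have -> : a * ((8 * M ^+ 2 * (100 * 512) + (4 * (48 * 512) + 2 * A * 64)) * (a * c)) =
    (8 * M ^+ 2 * (100 * 512) + 4 * (48 * 512)) * c * a ^+ 2 + 2 * A * (64 * a ^+ 2 * c) by ring.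
  have -> : 8 * M ^+ 2 * (100 * 512) * c + (4 * (48 * 512 * c) + 2 * A * (64 * a ^+ 2 * c)) =
    (8 * M ^+ 2 * (100 * 512) + 4 * (48 * 512)) * c + 2 * A * (64 * a ^+ 2 * c) by ring.
  by rewrite lerD2r ler_peMr.
rewrite !(mulrDl _ _ (a * c)) -addrA; apply: lerD g1 _; exact: lerD g2 g4.
Qed.

End cut_bounds.

(** * Vertical ramps *)

Section ramp.
Variable R : realType.
Implicit Types (b : R) (x : space3 R).

Definition ramp b x := step ((coord ord_max x + b) / (2 * b)).
Definition dramp b x := dstep ((coord ord_max x + b) / (2 * b)) / (2 * b).

Lemma C1_ramp b : C1 (ramp b) (fun j x => dramp b x * (ord_max == j)%:R).
Proof.
apply: (eq_C1 (C1_coord_comp ord_max b (2 * b) (@is_derive_step R) (@dstep_continuous R))) => //.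
by move=> j x; rewrite /dramp; ring.
Qed.

Lemma ramp_bound b x : 0 <= ramp b x <= 1.
Proof. by rewrite /ramp step_ge0 step_le1. Qed.

Lemma dramp_bound b x : 0 < b -> 0 <= dramp b x <= 2 / b.
Proof.
move=> b0; rewrite /dramp divr_ge0 ?dstep_ge0 ?mulr_ge0 ?(ltW b0)//=.
have -> : 2 / b = 4 / (2 * b) by field; rewrite gt_eqF.
by rewrite ler_wpM2r ?dstep_le4// invr_ge0 mulr_ge0// ltW.
Qed.

(** Beyond height b the ramp is the indicator of x_3 >= 0 whatever b is, so the difference of two
    ramps vanishes at large heights. *)
Lemma ramp_out b x : 0 < b -> b <= `|coord ord_max x| ->
  ramp b x = (0 <= coord ord_max x)%R%:R /\ dramp b x = 0.
Proof.
move=> b0; have b2 : 0 < 2 * b by lra.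
rewrite /ramp /dramp; case: ger0P => h hb.
  have t1 : 1 <= (coord ord_max x + b) / (2 * b) by rewrite ler_pdivlMr//; lra.
  by rewrite step_eq1// dstep_eq0 ?mul0r//; right.
have t0 : (coord ord_max x + b) / (2 * b) <= 0 by rewrite ler_pdivrMr// mul0r; lra.
by rewrite step_eq0// dstep_eq0 ?mul0r//; left.
Qed.

Lemma dramp_lower b x : 0 < b -> `|coord ord_max x| <= b / 2 -> 7 / 32 / b <= dramp b x.
Proof.
move=> b0; rewrite ler_norml => /andP[h1 h2]; have b2 : 0 < 2 * b by lra.
have : 7 / 16 <= dstep ((coord ord_max x + b) / (2 * b)).
  apply: dstep_lower; rewrite ler_pdivlMr// ler_pdivrMr//; apply/andP; split; lra.
rewrite /dramp => h; have -> : 7 / 32 / b = 7 / 16 / (2 * b) by field; rewrite gt_eqF.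
by rewrite ler_wpM2r// invr_ge0 ltW.
Qed.

End ramp.


(** * Energy estimates for the nonlinear system *)

Section system.
Variables (R : realType) (alpha omega M : R).
Variables (u v : space3 R -> R) (du dv : 'I_3 -> space3 R -> R)
  (ddu ddv : 'I_3 -> 'I_3 -> space3 R -> R).
Local Notation I := (@integral3 R).

Let S x := u x ^+ 2 + v x ^+ 2 - 1.
Let th x := alpha * u x * v x - omega.
Let Wu x := u x * S x + v x * th x.
Let Wv x := v x * S x + u x * th x.
Let Wuu x := S x + 2 * u x ^+ 2 + alpha * v x ^+ 2.
Let Wvv x := S x + 2 * v x ^+ 2 + alpha * u x ^+ 2.
Let Wuv x := 2 * u x * v x + alpha * u x * v x + th x.

Hypotheses (Cu : C2 u du ddu) (Cv : C2 v dv ddv).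
Hypotheses (u_gt0 : forall x, 0 < u x) (v_gt0 : forall x, 0 < v x).
Hypotheses (equ : forall x, lap3 ddu x = Wu x) (eqv : forall x, lap3 ddv x = Wv x).
Hypotheses (du3_gt0 : forall x, 0 < du ord_max x) (dv3_lt0 : forall x, dv ord_max x < 0).
Hypotheses (omega_gt0 : 0 < omega) (omega_lt : omega < alpha / 2).
Hypotheses (M_ge1 : 1 <= M) (uM : forall x, u x <= M) (vM : forall x, v x <= M).
Hypotheses (duM : forall i x, `|du i x| <= M) (dvM : forall i x, `|dv i x| <= M).
Hypothesis uv_low : forall x, omega <= (2 + alpha) * (u x * v x).

Let a_gt0 : 0 < alpha. Proof. by move: omega_gt0 omega_lt; lra. Qed.
Let cu : continuous u. Proof. by case: Cu => -[]. Qed.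
Let cv : continuous v. Proof. by case: Cv => -[]. Qed.
Let cdu i : continuous (du i). Proof. by case: Cu => -[_ + _] _; exact. Qed.
Let cdv i : continuous (dv i). Proof. by case: Cv => -[_ + _] _; exact. Qed.
Let cS : continuous S. Proof. by rewrite /S; cts. Qed.
Let cth : continuous th. Proof. by rewrite /th; cts. Qed.
Let cWu : continuous Wu. Proof. by rewrite /Wu; cts. Qed.
Let cWv : continuous Wv. Proof. by rewrite /Wv; cts. Qed.
Let cWuu : continuous Wuu. Proof. by rewrite /Wuu; cts. Qed.
Let cWvv : continuous Wvv. Proof. by rewrite /Wvv; cts. Qed.
Let cWuv : continuous Wuv. Proof. by rewrite /Wuv; cts. Qed.

Let CS : C1 S (fun i x => 2 * (u x * du i x + v x * dv i x)).
Proof.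
apply: (eq_C1 (C1D (C1D (C1M Cu.1 Cu.1) (C1M Cv.1 Cv.1)) (C1N (C1_cst 1)))).
  by move=> x; rewrite /S; ring.
by move=> i x /=; ring.
Qed.

Let Cth : C1 th (fun i x => alpha * (u x * dv i x + v x * du i x)).
Proof.
apply: (eq_C1 (C1D (C1M (C1_cst alpha) (C1M Cu.1 Cv.1)) (C1N (C1_cst omega)))).
  by move=> x; rewrite /th; ring.
by move=> i x /=; ring.
Qed.

Let CWu : C1 Wu (fun i x => Wuu x * du i x + Wuv x * dv i x).
Proof.
apply: (eq_C1 (C1D (C1M Cu.1 CS) (C1M Cv.1 Cth))) => // i x.
by rewrite /Wuu /Wuv /th /S; ring.
Qed.

Let CWv : C1 Wv (fun i x => Wuv x * du i x + Wvv x * dv i x).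
Proof.
apply: (eq_C1 (C1D (C1M Cv.1 CS) (C1M Cu.1 Cth))) => // i x.
by rewrite /Wvv /Wuv /th /S; ring.
Qed.

Let Wuv_ge0 x : 0 <= Wuv x.
Proof.
have := uv_low x; have : 0 <= alpha * (u x * v x) by rewrite !mulr_ge0// ltW.
rewrite /Wuv /th => h1 h2.
rewrite (_ : _ + _ = ((2 + alpha) * (u x * v x) - omega) + alpha * (u x * v x)); last by ring.
by rewrite addr_ge0// subr_ge0.
Qed.

Let weak_u i : weak_solution Wuu Wuv (du i) (fun x => - dv i x) (ddu i).
Proof.
move=> eta deta Ce se.
rewrite -[RHS](weak_derived_laplace Cu.1 Cu.2 CWu equ i Ce se).
by congr integral3; apply/funext => x; congr (_ + _ * _); ring.
Qed.

Let weak_v i : weak_solution Wvv Wuv (fun x => - dv i x) (du i) (fun j x => - ddv i j x).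
Proof.
move=> eta deta Ce se.
have e := weak_derived_laplace Cv.1 Cv.2 CWv eqv i Ce se.
transitivity (-1 * I (fun x => dot3 (ddv i ^~ x) (deta ^~ x) + (Wuv x * du i x + Wvv x * dv i x) * eta x)); last by rewrite e mulr0.
rewrite -integral3Z.
  by congr integral3; apply/funext => x; rewrite /dot3; ring.
have [ce cde _] := Ce; have cddv j : continuous (ddv i j) by case: (Cv.2 i).
apply: (cc_dom Ce se); first by rewrite /dot3 /=; cts.
by move=> x e0 de0; rewrite /dot3 e0 !de0; ring.
Qed.

Let CNdv i : C1 (fun x => - dv i x) (fun j x => - ddv i j x).
Proof. exact: C1N (Cv.2 i). Qed.

Let psi_gt0 x : 0 < - dv ord_max x. Proof. by rewrite oppr_gt0. Qed.

Definition grad_sqr x := dot3 (du ^~ x) (du ^~ x) + dot3 (dv ^~ x) (dv ^~ x).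

Let cgrad : continuous grad_sqr.
Proof. by rewrite /grad_sqr /dot3 /=; cts. Qed.

(** The common right-hand side of the potential estimates: localised gradient energy plus the energy
    of the cutoff. *)
Definition test_energy (z : space3 R -> R) (dz : 'I_3 -> space3 R -> R) x :=
  z x ^+ 2 * grad_sqr x + dot3 (dz ^~ x) (dz ^~ x).

Lemma cc_test_energy z dz : C1 z dz -> csupp z -> cc (test_energy z dz).
Proof.
move=> Cz sz; have [cz cdz _] := Cz; rewrite /test_energy.
apply: (cc_dom Cz sz); first by rewrite /dot3 /=; cts.
by move=> x z0 dz0; rewrite /dot3 z0 !dz0; ring.
Qed.

(** Crude constants: [dnorm] bounds [S], [th] and the second derivatives of W along the solution,
    and [D] its first derivatives as well. *)
Let dnorm := M ^+ 2 * (10 + 10 * alpha) + omega + 1.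
Let H := M * dnorm.

Let SM x : `|S x| <= dnorm /\ `|th x| <= dnorm.
Proof.
have M0 : 0 <= M by apply: le_trans M_ge1.
have M2 : 1 <= M ^+ 2 by rewrite expr_ge1.
have u2 : u x ^+ 2 <= M ^+ 2 by rewrite ler_pXn2r// nnegrE// ltW.
have v2 : v x ^+ 2 <= M ^+ 2 by rewrite ler_pXn2r// nnegrE// ltW.
have uv2 : u x * v x <= M ^+ 2 by rewrite expr2 ler_pM// ltW.
have uv0 : 0 <= u x * v x by rewrite mulr_ge0// ltW.
have auv : alpha * (u x * v x) <= alpha * M ^+ 2 by rewrite ler_wpM2l// ltW.
have auv0 : 0 <= alpha * (u x * v x) by rewrite mulr_ge0// ltW.
have aM0 : 0 <= alpha * M ^+ 2 by rewrite mulr_ge0// ?sqr_ge0// ltW.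
have := sqr_ge0 (u x); have := sqr_ge0 (v x) => v20 u20.
have dE : dnorm = 10 * M ^+ 2 + 10 * (alpha * M ^+ 2) + omega + 1 by rewrite /dnorm; ring.
have o0 := omega_gt0.
by split; rewrite ler_norml /S /th dE -?[alpha * _ * _]mulrA; apply/andP; split; lra.
Qed.

Let D := 2 * M * dnorm.

Let M0 : 0 <= M. Proof. exact: le_trans M_ge1. Qed.

Let dD : dnorm <= D.
Proof.
rewrite /D ler_peMl//; last by have := M_ge1; lra.
by apply: le_trans (SM 0).1.
Qed.

Let WuD x : `|Wu x| <= D /\ `|Wv x| <= D.
Proof.
have [hS ht] := SM x.
have u1 : `|u x| <= M by rewrite ger0_norm// ltW.
have v1 : `|v x| <= M by rewrite ger0_norm// ltW.
have -> : D = M * dnorm + M * dnorm by rewrite /D; ring.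
by split; rewrite (le_trans (ler_normD _ _))// !normrM lerD// ler_pM.
Qed.

Let WuuD x : [/\ `|Wuu x| <= D, `|Wvv x| <= D & `|Wuv x| <= D].
Proof.
have M2 : 1 <= M ^+ 2 by rewrite expr_ge1.
have u2 : u x ^+ 2 <= M ^+ 2 by rewrite ler_pXn2r// nnegrE// ltW.
have v2 : v x ^+ 2 <= M ^+ 2 by rewrite ler_pXn2r// nnegrE// ltW.
have uv2 : u x * v x <= M ^+ 2 by rewrite expr2 ler_pM// ltW.
have uv0 : 0 <= u x * v x by rewrite mulr_ge0// ltW.
have auv : alpha * (u x * v x) <= alpha * M ^+ 2 by rewrite ler_wpM2l// ltW.
have auv0 : 0 <= alpha * (u x * v x) by rewrite mulr_ge0// ltW.
have aM0 : 0 <= alpha * M ^+ 2 by rewrite mulr_ge0// ?sqr_ge0// ltW.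
have au : alpha * u x ^+ 2 <= alpha * M ^+ 2 by rewrite ler_wpM2l// ltW.
have av : alpha * v x ^+ 2 <= alpha * M ^+ 2 by rewrite ler_wpM2l// ltW.
have au0 : 0 <= alpha * u x ^+ 2 by rewrite mulr_ge0 ?sqr_ge0// ltW.
have av0 : 0 <= alpha * v x ^+ 2 by rewrite mulr_ge0 ?sqr_ge0// ltW.
have := sqr_ge0 (u x); have := sqr_ge0 (v x) => v20 u20.
have o0 := omega_gt0.
have dE : dnorm = 10 * M ^+ 2 + 10 * (alpha * M ^+ 2) + omega + 1 by rewrite /dnorm; ring.
split; apply: le_trans dD; rewrite ler_norml dE.
- by rewrite /Wuu /S; apply/andP; split; lra.
- by rewrite /Wvv /S; apply/andP; split; lra.
- rewrite /Wuv /th (_ : 2 * u x * v x + _ + _ = 2 * (u x * v x) + 2 * (alpha * (u x * v x)) - omega); last by ring.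
  by apply/andP; split; lra.
Qed.

(** Stated for both equations at once, with ([hu], [hv]) a row of the Hessian of W. After
    [integral3_sqr_laplace], Young's inequality on the term with [dz] gives 1 and D^2, and the
    bounded Hessian gives 2 D. *)
Let sqr_laplace_bound w dw ddw h (hu hv : space3 R -> R) z dz :
  C2 w dw ddw -> C1 h (fun i x => hu x * du i x + hv x * dv i x) -> C1 z dz -> csupp z ->
  (forall x, lap3 ddw x = h x) -> (forall i x, dw i x ^+ 2 <= du i x ^+ 2 + dv i x ^+ 2) ->
  continuous hu -> continuous hv ->
  (forall x, `|h x| <= D) -> (forall x, `|hu x| <= D) -> (forall x, `|hv x| <= D) ->
  I (fun x => z x ^+ 2 * h x ^+ 2) <= (1 + 2 * D + D ^+ 2) * I (test_energy z dz).
Proof.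
move=> Cw Ch Cz sz lw dwle chu chv hD huD hvD.
have cE := cc_test_energy Cz sz.
have D0 : 0 <= D by apply: le_trans (hD 0).
rewrite (integral3_sqr_laplace Cw Ch Cz sz lw) -integral3Z//.
have [cz cdz _] := Cz; have [ch cdh _] := Ch; have [cw cdw _] := Cw.1.
apply: le_integral3; [|exact: ccZ|].
  apply: (cc_dom Cz sz); last by move=> x z0 dz0; rewrite /dot3 z0 !dz0; ring.
  rewrite /dot3 /=.
  by cts.
move=> x.
pose Lf i := - (2 * z x * dz i x * h x + z x ^+ 2 * (hu x * du i x + hv x * dv i x)) * dw i x.
have key i : Lf i <=
   D ^+ 2 * dz i x ^+ 2 + (1 + 2 * D) * (z x ^+ 2 * (du i x ^+ 2 + dv i x ^+ 2)).
  have h2 : h x ^+ 2 <= D ^+ 2 by rewrite -(real_normK (num_real (h x))) ler_pXn2r// nnegrE.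
  have k1 : - (2 * z x * dz i x * h x) * dw i x <= D ^+ 2 * dz i x ^+ 2 + z x ^+ 2 * (du i x ^+ 2 + dv i x ^+ 2).
    apply: (le_trans (y := h x ^+ 2 * dz i x ^+ 2 + z x ^+ 2 * dw i x ^+ 2)).
      rewrite -subr_ge0 (_ : _ - _ = (h x * dz i x + z x * dw i x) ^+ 2) ?sqr_ge0//; ring.
    by rewrite lerD// ?ler_wpM2r ?sqr_ge0// ler_wpM2l// sqr_ge0.
  have k2 : - ((hu x * du i x + hv x * dv i x) * dw i x) <= 2 * D * (du i x ^+ 2 + dv i x ^+ 2).
    rewrite (le_trans (ler_norm _))// normrN normrM.
    have b1 : `|hu x * du i x + hv x * dv i x| <= D * (`|du i x| + `|dv i x|).
      by rewrite (le_trans (ler_normD _ _))// !normrM mulrDr lerD// ler_wpM2r.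
    apply: (le_trans (ler_wpM2r (normr_ge0 _) b1)).
    rewrite (_ : D * _ * _ = D * ((`|du i x| + `|dv i x|) * `|dw i x|)); last by ring.
    rewrite (_ : 2 * D * _ = D * (2 * (du i x ^+ 2 + dv i x ^+ 2))); last by ring.
    rewrite ler_wpM2l//.
    have := dwle i x; rewrite -(real_normK (num_real (dw i x))) -(real_normK (num_real (du i x)))
      -(real_normK (num_real (dv i x))).
    set p := `|du i x|; set q := `|dv i x|; set r := `|dw i x| => hr.
    have : (p + q) * r <= 2^-1 * (p + q) ^+ 2 + 2^-1 * r ^+ 2.
      by rewrite -subr_ge0 (_ : _ - _ = 2^-1 * (p + q - r) ^+ 2); [rewrite mulr_ge0 ?sqr_ge0|field].
    have : (p + q) ^+ 2 <= 2 * (p ^+ 2 + q ^+ 2).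
      by rewrite -subr_ge0 (_ : _ - _ = (p - q) ^+ 2); [rewrite sqr_ge0|ring].
    by have := sqr_ge0 p; have := sqr_ge0 q; set pq := (p + q) ^+ 2; lra.
  have k3 := ler_wpM2l (sqr_ge0 (z x)) k2.
  rewrite (_ : Lf i = - (2 * z x * dz i x * h x) * dw i x + z x ^+ 2 * - ((hu x * du i x + hv x * dv i x) * dw i x)); last by rewrite /Lf; ring.
  rewrite (_ : _ + (1 + 2 * D) * _ = D ^+ 2 * dz i x ^+ 2 + z x ^+ 2 * (du i x ^+ 2 + dv i x ^+ 2) + z x ^+ 2 * (2 * D * (du i x ^+ 2 + dv i x ^+ 2))); last by ring.
  exact: lerD.
have e0 := key ord0; have e1 := key (inord 1); have e2 := key ord_max.
rewrite (_ : -1 * _ = Lf ord0 + Lf (inord 1) + Lf ord_max); last by rewrite /Lf /dot3; ring.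
apply: (le_trans (lerD (lerD e0 e1) e2)).
rewrite [X in X <= _](_ : _ = (1 + 2 * D) * (z x ^+ 2 * grad_sqr x) + D ^+ 2 * dot3 (dz ^~ x) (dz ^~ x)); last by rewrite /grad_sqr /dot3; ring.
have g0 : 0 <= z x ^+ 2 * grad_sqr x by rewrite mulr_ge0 ?sqr_ge0// /grad_sqr /dot3 !addr_ge0// -expr2 sqr_ge0.
have g1 : 0 <= dot3 (dz ^~ x) (dz ^~ x) by rewrite /dot3 !addr_ge0// -expr2 sqr_ge0.
rewrite /test_energy [X in _ <= X]mulrDr; apply: lerD; rewrite ler_wpM2r//; have := sqr_ge0 D; lra.
Qed.

(** W_uu + W_vv - 2 W_uv, the second derivative of W in the direction (1, -1). *)
Let N x := 2 * S x - 2 * th x + (2 + alpha) * (u x - v x) ^+ 2.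

(* [weak_stability] with the test function [z (alpha u v - omega)]. *)
Let stability_bound z dz : C1 z dz -> csupp z ->
  - (2 * (2 * D ^+ 2 + 4 * alpha ^+ 2 * M ^+ 2) * I (test_energy z dz)) <=
  I (fun x => z x ^+ 2 * (th x ^+ 2 * N x)).
Proof.
move=> Cz sz; set C := _ + _.
have Cxi := C1M Cz Cth.
have sxi : csupp (fun x => z x * th x) by have [r hr] := sz; exists r => x /hr ->; rewrite mul0r.
have cE := cc_test_energy Cz sz.
have [cz cdz _] := Cz; have [cxi cdxi _] := Cxi.
have phin0 x : du ord_max x != 0 by rewrite gt_eqF.
have psin0 x : - dv ord_max x != 0 by rewrite gt_eqF// oppr_gt0.
have cdv' i : continuous (fun x => - dv i x) by apply: contN; exact: cdv.
have i1 := weak_stability (@cWuu) (@cWuv) (cdv' ord_max) (Cu.2 ord_max) du3_gt0 (@weak_u ord_max) Cxi sxi.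
have i2 := weak_stability (@cWvv) (@cWuv) (@cdu ord_max) (@CNdv ord_max) psi_gt0 (@weak_v ord_max) Cxi sxi.
rewrite /= in i1 i2.
set A1 := (X in I X) in i1; set A2 := (X in I X) in i2.
have dxi0 x : z x = 0 -> (forall i, dz i x = 0) ->
    forall i, dz i x * th x + z x * (alpha * (u x * dv i x + v x * du i x)) = 0.
  by move=> z0 dz0 i; rewrite z0 dz0 !mul0r addr0.
have cA1 : cc A1.
  apply: (cc_dom Cz sz); first by rewrite /A1 /dot3 /=; cts.
  by move=> x z0 dz0; rewrite /A1 /dot3 !dxi0// z0; ring.
have cA2 : cc A2.
  apply: (cc_dom Cz sz); first by rewrite /A2 /dot3 /=; cts.
  by move=> x z0 dz0; rewrite /A2 /dot3 !dxi0// z0; ring.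
have cN : cc (fun x => z x ^+ 2 * (th x ^+ 2 * N x)).
  apply: (cc_dom Cz sz); first by rewrite /N; cts.
  by move=> x z0 dz0; rewrite z0; ring.
suff : I A1 + I A2 <= 2 * C * I (test_energy z dz) + I (fun x => z x ^+ 2 * (th x ^+ 2 * N x)).
  by have := addr_ge0 i1 i2; set J := I (test_energy _ _); set Q := 2 * C * J; lra.
rewrite -integral3D// -integral3Z// -integral3D//; last exact: ccZ.
apply: le_integral3; [exact: ccD|by apply: ccD => //; exact: ccZ|].
move=> x; set xi := fun i => dz i x * th x + z x * (alpha * (u x * dv i x + v x * du i x)).
have key i : xi i ^+ 2 <= 2 * D ^+ 2 * dz i x ^+ 2 + 4 * alpha ^+ 2 * M ^+ 2 * (z x ^+ 2 * (du i x ^+ 2 + dv i x ^+ 2)).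
  have th2 : th x ^+ 2 <= D ^+ 2.
    have D0 : 0 <= D by apply: le_trans (WuD x).1.
    rewrite -(real_normK (num_real (th x))) ler_pXn2r ?nnegrE//.
    exact: le_trans (SM x).2 dD.
  apply: (le_trans (y := 2 * (dz i x * th x) ^+ 2 + 2 * (z x * (alpha * (u x * dv i x + v x * du i x))) ^+ 2)).
    rewrite -subr_ge0 (_ : _ - _ = (dz i x * th x - z x * (alpha * (u x * dv i x + v x * du i x))) ^+ 2); last by rewrite /xi; ring.
    exact: sqr_ge0.
  apply: lerD.
    rewrite exprMn (_ : 2 * D ^+ 2 * _ = 2 * (dz i x ^+ 2 * D ^+ 2)); last by ring.
    by rewrite ler_pM2l// ler_wpM2l// sqr_ge0.
  have b1 : (u x * dv i x + v x * du i x) ^+ 2 <= 2 * M ^+ 2 * (du i x ^+ 2 + dv i x ^+ 2).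
    have u2 : u x ^+ 2 <= M ^+ 2 by rewrite ler_pXn2r// nnegrE// ltW.
    have v2 : v x ^+ 2 <= M ^+ 2 by rewrite ler_pXn2r// nnegrE// ltW.
    apply: (le_trans (y := 2 * (u x ^+ 2 * dv i x ^+ 2 + v x ^+ 2 * du i x ^+ 2))).
      rewrite -subr_ge0 (_ : _ - _ = (u x * dv i x - v x * du i x) ^+ 2); last by ring.
      exact: sqr_ge0.
    rewrite -mulrA ler_pM2l// mulrDr addrC.
    by rewrite lerD// ler_wpM2r// sqr_ge0.
  rewrite !exprMn (_ : 2 * _ = 2 * z x ^+ 2 * alpha ^+ 2 * (u x * dv i x + v x * du i x) ^+ 2); last by ring.
  rewrite (_ : 4 * _ * _ * _ = 2 * z x ^+ 2 * alpha ^+ 2 * (2 * M ^+ 2 * (du i x ^+ 2 + dv i x ^+ 2))); last by ring.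
  by rewrite ler_wpM2l// mulr_ge0 ?sqr_ge0// mulr_ge0// sqr_ge0.
(* With phi = d_3 u and psi = - d_3 v, the bound psi / phi + phi / psi >= 2, multiplied by Wuv >= 0,
   replaces the quotient potentials by W_uu + W_vv - 2 W_uv. *)
have A12 : A1 x + A2 x <= 2 * (xi ord0 ^+ 2 + xi (inord 1) ^+ 2 + xi ord_max ^+ 2) + z x ^+ 2 * (th x ^+ 2 * N x).
  rewrite /A1 /A2 /dot3 -/(xi ord0) -/(xi (inord 1)) -/(xi ord_max) -subr_ge0.
  rewrite (_ : _ - _ = Wuv x * ((z x * th x) ^+ 2 * ((du ord_max x + dv ord_max x) ^+ 2 / (du ord_max x * - dv ord_max x)))).
    rewrite mulr_ge0// mulr_ge0 ?sqr_ge0// divr_ge0 ?sqr_ge0// mulr_ge0// ?oppr_ge0 ltW//.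
  rewrite /N /Wuu /Wvv /Wuv /S; field.
  by rewrite phin0 -oppr_eq0 psin0.
apply: (le_trans A12); rewrite lerD2r.
have e0 := key ord0; have e1 := key (inord 1); have e2 := key ord_max.
have := ler_wpM2l (ler0n R 2) (lerD (lerD e0 e1) e2).
move=> /le_trans; apply; rewrite -[X in _ <= X]mulrA ler_pM2l//.
rewrite [X in X <= _](_ : _ = 2 * D ^+ 2 * dot3 (dz ^~ x) (dz ^~ x) + 4 * alpha ^+ 2 * M ^+ 2 * (z x ^+ 2 * grad_sqr x)); last by rewrite /grad_sqr /dot3; ring.
have g0 : 0 <= z x ^+ 2 * grad_sqr x by rewrite mulr_ge0 ?sqr_ge0// /grad_sqr /dot3 !addr_ge0// -expr2 sqr_ge0.
have g1 : 0 <= dot3 (dz ^~ x) (dz ^~ x) by rewrite /dot3 !addr_ge0// -expr2 sqr_ge0.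
have c1 : 0 <= 2 * D ^+ 2 by rewrite mulr_ge0 ?sqr_ge0.
have c2 : 0 <= 4 * alpha ^+ 2 * M ^+ 2 by apply: mulr_ge0; [apply: mulr_ge0|]; rewrite ?sqr_ge0.
by rewrite /test_energy [X in _ <= X]mulrDr [X in X <= _]addrC; apply: lerD; rewrite ler_wpM2r// /C ?lerDl ?lerDr.
Qed.

(** [potential_le] integrated against z^2: the squares of W_u and W_v are squares of Laplacians, and
    the subtracted term is bounded below by stability. *)
Lemma potential_integral : exists2 C, 0 <= C & forall z dz, C1 z dz -> csupp z ->
  I (fun x => z x ^+ 2 * W alpha omega (u x) (v x)) <= C * I (test_energy z dz).
Proof.
have [K K0 [k k0 hW]] := potential_le omega_gt0 omega_lt M_ge1.
have D0 : 0 <= D by apply: le_trans (WuD 0).1.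
pose C1c := 1 + 2 * D + D ^+ 2; pose C2c := 2 * D ^+ 2 + 4 * alpha ^+ 2 * M ^+ 2.
have C1c0 : 0 <= C1c by rewrite /C1c addr_ge0 ?sqr_ge0// addr_ge0// mulr_ge0.
have C2c0 : 0 <= C2c.
  by apply: addr_ge0; [|apply: mulr_ge0]; rewrite ?sqr_ge0//; apply: mulr_ge0; rewrite ?sqr_ge0.
exists (2 * K * C1c + k * (2 * C2c)).
  by apply: addr_ge0; apply: mulr_ge0 => //; apply: mulr_ge0.
move=> z dz Cz sz.
have hu : I (fun x => z x ^+ 2 * Wu x ^+ 2) <= C1c * I (test_energy z dz).
  apply: (sqr_laplace_bound Cu CWu Cz sz equ _ (@cWuu) (@cWuv)).
  - by move=> i x; rewrite lerDl sqr_ge0.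
  - by move=> x; case: (WuD x).
  - by move=> x; case: (WuuD x).
  - by move=> x; case: (WuuD x).
have hv : I (fun x => z x ^+ 2 * Wv x ^+ 2) <= C1c * I (test_energy z dz).
  apply: (sqr_laplace_bound Cv CWv Cz sz eqv _ (@cWuv) (@cWvv)).
  - by move=> i x; rewrite lerDr sqr_ge0.
  - by move=> x; case: (WuD x).
  - by move=> x; case: (WuuD x).
  - by move=> x; case: (WuuD x).
have hs := stability_bound Cz sz; rewrite -/C2c in hs.
have [cz cdz _] := Cz.
have ccz f : continuous f -> cc (fun x => z x ^+ 2 * f x).
  move=> cf; apply: (cc_dom Cz sz); first by cts.
  by move=> x z0 _; rewrite z0; ring.
have cW : continuous (fun x => W alpha omega (u x) (v x)) by rewrite /W; cts.
have c1 := ccz _ (contX (n := 2) (@cWu)); have c2 := ccz _ (contX (n := 2) (@cWv)).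
have cN : continuous (fun x => th x ^+ 2 * N x) by rewrite /N; cts.
have c3 := ccz _ cN.
have : I (fun x => z x ^+ 2 * W alpha omega (u x) (v x)) <=
    K * I (fun x => z x ^+ 2 * Wu x ^+ 2) + K * I (fun x => z x ^+ 2 * Wv x ^+ 2) + - k * I (fun x => z x ^+ 2 * (th x ^+ 2 * N x)).
  rewrite -!integral3Z// -!integral3D//; try (by do ?[apply: ccD | apply: ccZ]).
  apply: le_integral3; [exact: ccz|by do ?[apply: ccD | apply: ccZ]|].
  move=> x; have hx := hW (u x) (v x).
  have := ler_wpM2l (sqr_ge0 (z x)) (hx _ _ (uv_low x)).
  rewrite !u_gt0 !v_gt0 uM vM => /(_ isT isT) /le_trans; apply.
  by rewrite /N /Wu /Wv /S /th le_eqVlt; apply/orP; left; apply/eqP; ring.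
move=> /le_trans; apply.
have := ler_wpM2l K0 hu; have := ler_wpM2l K0 hv; have := ler_wpM2l k0 hs.
set E := I (test_energy _ _); set X := I _; set Y := I _; set Q := I _.
rewrite mulrN => a1 a2 a3.
rewrite (_ : (_ + _) * E = K * (C1c * E) + K * (C1c * E) + k * (2 * C2c * E)); last by ring.
rewrite mulNr; apply: lerD; first exact: lerD.
by rewrite lerNl.
Qed.

Lemma linearised_system : exists a b c : space3 R -> R, [/\ continuous a, continuous b & continuous c] /\
  [/\ forall x, 0 <= b x,
      exists2 A, 0 <= A & forall x, a x <= A /\ c x <= A,
      forall i, weak_solution a b (du i) (fun x => - dv i x) (ddu i)
    & forall i, weak_solution c b (fun x => - dv i x) (du i) (fun j x => - ddv i j x)].
Proof.
exists Wuu, Wuv, Wvv; split; first by split; [exact: cWuu|exact: cWuv|exact: cWvv].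
split; [exact: Wuv_ge0| |exact: weak_u|exact: weak_v].
exists D; first by apply: le_trans (WuD 0).1.
by move=> x; have [h1 h2 _] := WuuD x; split; apply: le_trans (ler_norm _) _.
Qed.

Definition energy x := grad_sqr x / 2 + W alpha omega (u x) (v x).

Definition flux x (i : 'I_3) := du ord_max x * du i x + dv ord_max x * dv i x.

Let CW : C1 (fun x => W alpha omega (u x) (v x)) (fun i x => Wu x * du i x + Wv x * dv i x).
Proof.
have C2S := C1M (C1_cst 4^-1) (C1M CS CS).
have C2t := C1M (C1_cst (2 * alpha)^-1) (C1M Cth Cth).
apply: (eq_C1 (C1D C2S C2t)).
  by move=> x; rewrite /W /S /th; ring.
by move=> i x; rewrite /Wu /Wv /S /th; field; rewrite gt_eqF.
Qed.

Let Cgrad : C1 grad_sqr (fun i x => 2 * (dot3 (du ^~ x) (fun j => ddu j i x) + dot3 (dv ^~ x) (fun j => ddv j i x))).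
Proof.
have Cu0 := C1D (C1D (C1M (Cu.2 ord0) (Cu.2 ord0)) (C1M (Cu.2 (inord 1)) (Cu.2 (inord 1))))
  (C1M (Cu.2 ord_max) (Cu.2 ord_max)).
have Cv0 := C1D (C1D (C1M (Cv.2 ord0) (Cv.2 ord0)) (C1M (Cv.2 (inord 1)) (Cv.2 (inord 1))))
  (C1M (Cv.2 ord_max) (Cv.2 ord_max)).
apply: (eq_C1 (C1D Cu0 Cv0)); first by [].
by move=> i x; rewrite /dot3; ring.
Qed.

(** The conservation law attached to translations in x_3: by symmetry of second derivatives, d_3 e -
    div flux = d_3 u (W_u - Δu) + d_3 v (W_v - Δv) = 0. *)
Lemma flux_identity z dz : C1 z dz -> csupp z ->
  I (fun x => dz ord_max x * energy x) = I (fun x => dot3 (dz ^~ x) (flux x)).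
Proof.
move=> Cz sz.
have Ce := C1D (C1M Cgrad (C1_cst 2^-1)) CW.
have CX i := C1D (C1M (Cu.2 ord_max) (Cu.2 i)) (C1M (Cv.2 ord_max) (Cv.2 i)).
have CF := C1M Cz Ce; have CG i := C1M Cz (CX i).
have szM f : csupp (fun x => z x * f x).
  by have [r hr] := sz; exists r => x /hr ->; rewrite mul0r.
have F0 := integral3_derive_eq0 ord_max CF (szM _).
have G0 i := integral3_derive_eq0 i (CG i) (szM _).
have ccF : cc _ := conj (let: And3 _ h _ := CF in h ord_max) (csupp_derive ord_max CF (szM _)).
have ccG i : cc _ := conj (let: And3 _ h _ := CG i in h i) (csupp_derive i (CG i) (szM _)).
have [cz cdz _] := Cz; have [ce _ _] := Ce.
have cE : cc (fun x => -1 * (dz ord_max x * energy x)).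
  apply: (cc_dom Cz sz); last by move=> x _ dz0; rewrite dz0; ring.
  apply: contM; first exact: cst_continuous.
  by apply: contM => //; exact: ce.
have cX : cc (fun x => dot3 (dz ^~ x) (flux x)).
  apply: (cc_dom Cz sz); first by rewrite /flux /dot3 /=; cts.
  by move=> x _ dz0; rewrite /dot3 !dz0; ring.
have s0 := integral3D (ccG ord0) (ccG (inord 1)).
have s1 := integral3D (ccD (ccG ord0) (ccG (inord 1))) (ccG ord_max).
have s2 := integral3D ccF cE.
have s3 := integral3D (ccD ccF cE) cX.
rewrite s0 !G0 !addr0 in s1.
have cE' : cc (fun x => dz ord_max x * energy x).
  by have := ccZ (-1) cE; congr cc; apply/funext => x; ring.
have E : I (fun x => -1 * (dz ord_max x * energy x)) + I (fun x => dot3 (dz ^~ x) (flux x)) = 0.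
  rewrite -[LHS]add0r -{1}F0 addrA -s2 -s3 -[RHS]s1.
  congr integral3; apply/funext => x.
  rewrite /energy /flux /dot3 (Schwarz Cu.1 Cu.2 ord_max ord0) (Schwarz Cu.1 Cu.2 ord_max (inord 1)).
  rewrite (Schwarz Cv.1 Cv.2 ord_max ord0) (Schwarz Cv.1 Cv.2 ord_max (inord 1)).
  rewrite -equ -eqv /lap3; by field.
by move: E; rewrite integral3Z// mulN1r addrC => /eqP; rewrite subr_eq0 => /eqP ->.
Qed.

Let C1u : C1 u du. Proof. by case: Cu. Qed.
Let C1v : C1 v dv. Proof. by case: Cv. Qed.
Let C1Nv : C1 (fun x => - v x) (fun i x => - dv i x). Proof. exact: C1N. Qed.
Let Cdu i : C1 (du i) (ddu i). Proof. by case: Cu. Qed.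
Let uN x : `|u x| <= M. Proof. by rewrite gtr0_norm. Qed.
Let vN x : `|- v x| <= M. Proof. by rewrite normrN gtr0_norm. Qed.

(** Growth of order a c, one power of [a] below the volume. [C] is uniform in [a], while the
    threshold [c0] may depend on it, as the height required by [log_cutoff] does. *)
Let quadratic (f : space3 R -> R) := exists C, forall a, 1 <= a -> exists c0, forall c,
  c0 <= c -> a <= c -> I (fun x => cut a c x ^+ 2 * f x) <= C * (a * c).

Let quadraticD (f g : space3 R -> R) : continuous f -> continuous g -> quadratic f -> quadratic g ->
  quadratic (fun x => f x + g x).
Proof.
move=> cf cg [C hC] [B hB]; exists (C + B) => a a1.
have [c0 h0] := hC a a1; have [d0 k0] := hB a a1.
exists (Num.max c0 d0) => c; rewrite ge_max => /andP[/h0 hc /k0 kc] ac.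
have a0 : 0 < a by lra.
have cp : 0 < c by lra.
rewrite (_ : (fun x => _) = fun x => cut a c x ^+ 2 * f x + cut a c x ^+ 2 * g x).
  by rewrite integral3D ?mulrDl ?lerD ?hc ?kc//; exact: ccM_cut.
by apply/funext => x; rewrite mulrDr.
Qed.

Let quadratic_le (k : R) (f g : space3 R -> R) : 0 <= k -> continuous f -> continuous g -> (forall x, f x <= k * g x) ->
  quadratic g -> quadratic f.
Proof.
move=> k0 cf cg fg [C hC]; exists (k * C) => a a1; have [c0 h0] := hC a a1.
exists c0 => c hc ac; have a0 : 0 < a by lra.
have cp : 0 < c by lra.
apply: (le_trans (y := I (fun x => k * (cut a c x ^+ 2 * g x)))).
  apply: le_integral3; [exact: ccM_cut|by apply: ccZ; exact: ccM_cut|].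
  by move=> x; rewrite mulrCA ler_wpM2l ?sqr_ge0.
rewrite integral3Z; last exact: ccM_cut.
by rewrite -mulrA ler_wpM2l ?h0.
Qed.

Let quadratic_vertical (w : space3 R -> R) dw (s : R) : C1 w dw -> `|s| <= 1 -> (forall x, `|w x| <= M) ->
  (forall x, 0 <= s * dw ord_max x) -> quadratic (fun x => s * dw ord_max x).
Proof.
move=> Cw s1 wM sw; have [_ cdw _] := Cw; exists (4 * 512 * M) => a a1; exists a => c ac _.
have a0 : 0 < a by lra.
have cp : 0 < c by lra.
have [cx _ _] := C1_cut a c.
apply: (le_trans (y := I (fun x => cut a c x * (s * dw ord_max x)))).
  apply: le_integral3.
  - by apply: ccM_cut => //; cts.
  - split; first by cts.
    by apply: (@csupp_box3 _ _ (2 * a) (2 * a) (2 * c)) => x /(cut_eq0 a0 cp)[-> _]; rewrite mul0r.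
  - by move=> x; rewrite ler_wpM2r// expr2 ler_piMl ?cut_ge0 ?cut_le1.
apply: (le_trans (integral3_cut_derive Cw s1 wM a0 cp)).
apply: ler_wpM2l; first by move: M0; lra.
by rewrite expr2 ler_wpM2l// ltW.
Qed.

Let quadratic_derive i : quadratic (fun x => `|du i x|) /\ quadratic (fun x => `|dv i x|).
Proof.
have [im|im] := eqVneq i ord_max.
  rewrite im; split.
    rewrite (_ : (fun x => _) = fun x => 1 * du ord_max x).
      by apply: (quadratic_vertical C1u) => // [|x]; rewrite ?normr1// mul1r ltW.
    by apply/funext => x; rewrite mul1r gtr0_norm.
  rewrite (_ : (fun x => _) = fun x => -1 * dv ord_max x).
    apply: (quadratic_vertical C1v) => // [|x|x]; rewrite ?normrN ?normr1//.
      by rewrite -normrN.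
    by rewrite mulN1r oppr_ge0 ltW.
  by apply/funext => x; rewrite mulN1r ltr0_norm.
have [p [b [q [cpbq [b0 [A A0 pA] wu wv]]]]] :=
  linearised_system.
have [cp cb cq] := cpbq.
have psi0 x : 0 < - dv ord_max x by rewrite oppr_gt0.
have dvN x : `|- dv i x| <= M by rewrite normrN.
split.
  exact: (cut_abs_derive cpbq C1u (Cdu i) (CNdv i) (Cdu ord_max) (CNdv ord_max) b0 du3_gt0 psi0
    (wu _) (wv _) (wu i) (wv i) M_ge1 uN (duM i) dvN A0 (fun x => (pA x).1) im).
(* The same estimate for w = - v, with the two equations of the linearised system exchanged. *)
have [C hC] := @cut_abs_derive R q b p (fun x => - v x) _ _ (du i) (fun i x => - dv i x) _ _ _ _ i M A
  (And3 cq cb cp) C1Nv (CNdv i) (Cdu i) (CNdv ord_max) (Cdu ord_max) b0 psi0 du3_gt0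
    (wv _) (wu _) (wv i) (wu i) M_ge1 vN dvN (duM i) A0 (fun x => (pA x).2) im.
exists C => a /hC[c0 h]; exists c0 => c /h {}h /h {}h; apply: le_trans h.
by apply: eq_ler; congr integral3; apply/funext => x; rewrite normrN.
Qed.

(** Since the gradients are bounded by [M], their squares are at most [M] times their absolute
    values, which is why a bound on first powers is enough. *)
Let quadratic_grad : quadratic grad_sqr.
Proof.
pose s x := `|du ord0 x| + `|dv ord0 x| + (`|du (inord 1) x| + `|dv (inord 1) x|)
  + (`|du ord_max x| + `|dv ord_max x|).
have cs : continuous s by rewrite /s; cts.
apply: (quadratic_le (k := M) (g := s)) => //.
  move=> x; have sq t : `|t| <= M -> t * t <= M * `|t|.
    by move=> tM; rewrite -expr2 -(real_normK (num_real t)) expr2 ler_wpM2r.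
  have := (sq _ (duM ord0 x), sq _ (dvM ord0 x), sq _ (duM (inord 1) x), sq _ (dvM (inord 1) x),
    sq _ (duM ord_max x), sq _ (dvM ord_max x)).
  by move=> [[[[[]]]]]; rewrite /grad_sqr /dot3 /s; lra.
have q i : quadratic (fun x => `|du i x| + `|dv i x|).
  by have [h k] := quadratic_derive i; apply: quadraticD => //; cts.
apply: quadraticD; [by cts|by cts| |exact: q].
by apply: quadraticD; [by cts|by cts|exact: q|exact: q].
Qed.

Let cW : continuous (fun x => W alpha omega (u x) (v x)).
Proof. by rewrite /W; cts. Qed.

Lemma continuous_energy : continuous energy.
Proof. by rewrite /energy; cts. Qed.
Let ce := continuous_energy.

Lemma energy_ge0 x : 0 <= energy x.
Proof.
rewrite /energy /grad_sqr /dot3 /W; apply: addr_ge0.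
  by apply: divr_ge0 => //; rewrite !addr_ge0// -expr2 sqr_ge0.
have a2 : 0 <= (2 * alpha)^-1 by rewrite invr_ge0 mulr_ge0// ltW.
by apply: addr_ge0; apply: mulr_ge0 (sqr_ge0 _).
Qed.

Let e_ge0 := energy_ge0.

Let quadratic_energy : quadratic energy.
Proof.
apply: quadraticD => //; first by cts.
  by apply: (quadratic_le (k := 2^-1) _ _ cgrad) => //; [cts|move=> x; rewrite mulrC].
have [K K0 hK] := potential_integral.
have [C hC] := quadratic_grad; exists (K * (C + 48 * 512)) => a a1.
have [c0 h0] := hC a a1; exists c0 => c hc ac.
have a0 : 0 < a by lra.
have cp : 0 < c by lra.
have [_ cdx _] := C1_cut a c.
apply: (le_trans (hK _ _ (C1_cut a c) (csupp_cut a0 cp))).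
rewrite -mulrA ler_wpM2l// /test_energy integral3D; last first.
- apply: (cc_dom (C1_cut a c) (csupp_cut a0 cp)); first by rewrite /dot3 /=; cts.
  by move=> x _ h; rewrite /dot3 !h; ring.
- exact: ccM_cut.
rewrite mulrDl; apply: lerD; first exact: h0.
apply: (le_trans (integral3_dcut_sqr a0 ac)).
by apply: ler_wpM2l; [lra|rewrite ler_peMl// ltW].
Qed.

Let vertical_ge0 x : 0 <= du ord_max x - dv ord_max x.
Proof. by rewrite addr_ge0 ?oppr_ge0 ?ltW. Qed.

Let flux_le i x : `|flux x i| <= M * (du ord_max x - dv ord_max x).
Proof.
rewrite /flux mulrBr; apply: (le_trans (ler_normD _ _)); rewrite !normrM.
rewrite (gtr0_norm (du3_gt0 x)) (ltr0_norm (dv3_lt0 x)) mulrC -mulrN.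
apply: lerD; first by rewrite ler_wpM2r// ltW.
by rewrite mulrC ler_wpM2r// oppr_ge0 ltW.
Qed.

(** Uniform in [c], so that it serves the short ramp and the long one alike. *)
Let integral3_cut_vertical a c : 0 < a -> 0 < c ->
  I (fun x => cut a c x * (du ord_max x - dv ord_max x)) <= 8 * 512 * M * a ^+ 2.
Proof.
move=> a0 c0; have [cx _ _] := C1_cut a c.
have cc1 (s : R) (f : space3 R -> R) : continuous f -> cc (fun x => cut a c x * (s * f x)).
  move=> cf; split; first by cts.
  by apply: (@csupp_box3 _ _ (2 * a) (2 * a) (2 * c)) => x /(cut_eq0 a0 c0)[-> _]; rewrite mul0r.
have -> : (fun x => cut a c x * (du ord_max x - dv ord_max x)) =
  (fun x => cut a c x * (1 * du ord_max x) + cut a c x * (-1 * dv ord_max x)).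
  by apply/funext => x; ring.
rewrite integral3D; [|exact: cc1|exact: cc1].
have s1 : `|1 : R| <= 1 by rewrite normr1.
have s2 : `|-1 : R| <= 1 by rewrite normrN normr1.
have vM' x : `|v x| <= M by rewrite -normrN.
have h1 := integral3_cut_derive C1u s1 uN a0 c0.
have h2 := integral3_cut_derive C1v s2 vM' a0 c0.
by move: (lerD h1 h2); set p1 := I _; set p2 := I _; lra.
Qed.

(* [f] is built from the left-hand side of [flux_identity] for the test function
   [cyl r * (ramp (2 r) - ramp c)]: the first ramp has a vertical slope of order
   [1 / r] on the box, and the negative slope of the second one is compensated by
   [2 / c * cut (2 r) c ^+ 2 * energy]. *)
Lemma energy_majorant : exists2 C, 0 < C & forall r, 1 <= r ->
  exists f, [/\ cc f, forall x, 0 <= f x, forall x, box3 r r r x -> energy x <= f x & I f <= C * r ^+ 2].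
Proof.
have [C hC] := quadratic_energy.
(* 64 / 7 inverts the slope 7 / (64 r) of [ramp (2 r)] on the box. In the flux, 10 = 4 + 4 + 1 + 1
   counts the two horizontal slopes and the two ramps, and 32 = 8 * 2^2 comes from the radius 2 r; 4
   C is (2 / c) times C (2 r c), divided by r. *)
pose B := 64 / 7 * (10 * (32 * 512) * M ^+ 2 + 4 * C).
exists (`|B| + 1) => [|r r1]; first by rewrite ltr_wpDl.
have r0 : 0 < r by lra.
have r20 : 0 < 2 * r by lra.
have [|c0 hc0] := hC (2 * r); first lra.
(* [c] is not controlled by [r]; the final bound is nevertheless of order r^2 because all the
   estimates that follow are uniform in [c]. *)
pose c := Num.max c0 (2 * r).
have c0c : c0 <= c by rewrite le_max lexx.
have rc : 2 * r <= c by rewrite le_max lexx orbT.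
have cp : 0 < c by lra.
have := hc0 c c0c rc; set E := I _ => hE.
pose h x := ramp (2 * r) x - ramp c x.
pose dh x := dramp (2 * r) x - dramp c x.
have Ch : C1 h (fun j x => dh x * (ord_max == j)%:R).
  by apply: (eq_C1 (C1D (C1_ramp (2 * r)) (C1N (C1_ramp c)))) => // j x; rewrite /dh; ring.
have Cz := C1M (C1_cyl r) Ch.
set z := (X in C1 X _) in Cz; set dz := (X in C1 _ X) in Cz.
have h_out x : c <= `|coord ord_max x| -> h x = 0.
  move=> hx; rewrite /h (ramp_out cp hx).1 (ramp_out r20 (le_trans rc hx)).1.
  by rewrite subrr.
have h1 x : `|h x| <= 1.
  have /andP[a1 a2] := ramp_bound (2 * r) x; have /andP[b1 b2] := ramp_bound c x.
  by rewrite ler_norml /h; apply/andP; split; lra.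
have sz : csupp z.
  apply: (@csupp_box3 _ _ (2 * r) (2 * r) c) => x /notin_box3[] hx; rewrite /z.
  - by rewrite (cyl_eq0 r0 _).1 ?mul0r// le_max hx.
  - by rewrite (cyl_eq0 r0 _).1 ?mul0r// le_max hx orbT.
  - by rewrite h_out ?mulr0.
have dzm x : dz ord_max x = cyl r x * dh x by rewrite /dz dcyl_max eqxx mul0r add0r mulr1.
have [_ cdz _] := Cz; have [cx _ _] := C1_cut (2 * r) c; have [cx2 _ _] := C1_cut (2 * r) (2 * r).
have cut1 b x : 0 < b -> radius x < 2 * r -> `|coord ord_max x| <= b -> cut (2 * r) b x = 1.
  by move=> b0 xr xb; rewrite cut_cyl cyl_eq1 ?ltW// pl_eq1// mulr1.
have cyl01 x : 0 <= cyl r x <= 1.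
  by rewrite cyl_ge0; apply: mulr_ile1; rewrite ?pl_ge0 ?pl_le1.
have low x : cyl r x * dramp (2 * r) x <= dz ord_max x + 2 / c * cut (2 * r) c x ^+ 2.
  suff : cyl r x * dramp c x <= 2 / c * cut (2 * r) c x ^+ 2 by rewrite dzm /dh mulrBr; lra.
  have p0 : 0 <= 2 / c * cut (2 * r) c x ^+ 2.
    by apply: mulr_ge0 (sqr_ge0 _); apply: divr_ge0 => //; exact: ltW.
  have [xr|xr] := leP (2 * r) (radius x); first by rewrite (cyl_eq0 r0 xr).1 mul0r.
  have [xc|xc] := leP c `|coord ord_max x|; first by rewrite (ramp_out cp xc).2 mulr0.
  rewrite (cut1 _ _ cp xr (ltW xc)) expr1n mulr1.
  have /andP[y0 y1] := cyl01 x; have /andP[d0 d1] := dramp_bound x cp.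
  by rewrite (le_trans _ d1)// ler_piMl.
have ccE : cc (fun x => cut (2 * r) c x ^+ 2 * energy x) by apply: ccM_cut.
have ccZ3 : cc (fun x => dz ord_max x * energy x).
  apply: (cc_dom Cz sz); first by cts.
  by move=> x _ h0; rewrite h0 mul0r.
exists (fun x => 64 / 7 * r * (dz ord_max x * energy x + 2 / c * (cut (2 * r) c x ^+ 2 * energy x))).
have lowe x : cyl r x * dramp (2 * r) x * energy x <=
    dz ord_max x * energy x + 2 / c * (cut (2 * r) c x ^+ 2 * energy x).
  by rewrite [2 / c * _]mulrA -mulrDl ler_wpM2r.
have k0 : 0 <= 64 / 7 * r by rewrite mulr_ge0 ?ltW//; lra.
split.
- by apply: ccZ; apply: ccD => //; exact: ccZ.
- move=> x; apply: mulr_ge0 => //; apply: le_trans (lowe x).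
  have /andP[y0 _] := cyl01 x; have /andP[d0 _] := dramp_bound x r20.
  by apply: mulr_ge0 => //; exact: mulr_ge0.
- move=> x /box3_coord[x0 x1 x2].
  apply: (le_trans _ (ler_wpM2l k0 (lowe x))).
  have -> : cyl r x = 1 by rewrite cyl_eq1// ge_max x0.
  have x2' : `|coord ord_max x| <= 2 * r / 2 by lra.
  have := dramp_lower r20 x2'; have -> : 7 / 32 / (2 * r) = 7 / 64 / r by field; rewrite gt_eqF.
  move=> hd; rewrite mul1r mulrA ler_peMl//.
  have : 64 / 7 * r * (7 / 64 / r) <= 64 / 7 * r * dramp (2 * r) x by rewrite ler_wpM2l.
  by rewrite (_ : 64 / 7 * r * (7 / 64 / r) = 1)//; field; rewrite gt_eqF.
rewrite integral3Z; last by apply: ccD => //; exact: ccZ.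
rewrite integral3D ?integral3Z//; last exact: ccZ.
rewrite (flux_identity Cz sz) -/E.
have hflux : I (fun x => dot3 (dz ^~ x) (flux x)) <= 10 * (32 * 512) * M ^+ 2 * r.
  have cct b : 0 < b -> cc (fun x => cut (2 * r) b x * (du ord_max x - dv ord_max x)).
    move=> b0; have [cb _ _] := C1_cut (2 * r) b; split; first by cts.
    by apply: (@csupp_box3 _ _ (2 * (2 * r)) (2 * (2 * r)) (2 * b)) => x /(cut_eq0 r20 b0)[-> _]; rewrite mul0r.
  apply: (le_trans (y := I (fun x => M / r * (9 * (cut (2 * r) c x * (du ord_max x - dv ord_max x))
     + cut (2 * r) (2 * r) x * (du ord_max x - dv ord_max x))))).
    apply: le_integral3.
    - apply: (cc_dom Cz sz); first by rewrite /dot3 /flux /=; cts.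
      by move=> x _ h0; rewrite /dot3 !h0; ring.
    - by apply: ccZ; apply: ccD; [apply: ccZ; exact: cct|exact: cct].
    move=> x; set s := du ord_max x - dv ord_max x.
    have s0 : 0 <= s := vertical_ge0 x.
    have ir0 : 0 <= r^-1 by rewrite invr_ge0 ltW.
    pose k := cut (2 * r) c x; have k0' : 0 <= k by exact: cut_ge0.
    pose k2 := cut (2 * r) (2 * r) x; have k20 : 0 <= k2 by exact: cut_ge0.
    have hj j : j != ord_max -> `|dz j x| <= 4 / r * k.
      move=> jm; have dzj : dz j x = dcyl r j x * h x.
        by rewrite /dz [ord_max == j]eq_sym (negbTE jm) (_ : false%:R = 0)//; ring.
      have p0 : 0 <= 4 / r * k by apply: mulr_ge0 => //; exact: mulr_ge0.
      have [xr|xr] := leP (2 * r) (radius x).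
        by rewrite dzj (cyl_eq0 r0 xr).2 mul0r normr0.
      have [xc|xc] := leP c `|coord ord_max x|; first by rewrite dzj h_out// mulr0 normr0.
      rewrite /k (cut1 _ _ cp xr (ltW xc)) dzj normrM.
      by apply: ler_pM => //; exact: dcyl_le.
    have hm : `|dz ord_max x| <= r^-1 * k2 + r^-1 * k.
      have /andP[y0 y1] := cyl01 x; have /andP[d0 d1] := dramp_bound x r20.
      have /andP[f0 f1] := dramp_bound x cp.
      have [xr|xr] := leP (2 * r) (radius x).
        by rewrite dzm (cyl_eq0 r0 xr).1 mul0r normr0; apply: addr_ge0; exact: mulr_ge0.
      have g1 : cyl r x * dramp (2 * r) x <= r^-1 * k2.
        have [xc|xc] := leP (2 * r) `|coord ord_max x|.
          by rewrite (ramp_out r20 xc).2 mulr0; exact: mulr_ge0.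
        rewrite /k2 (cut1 _ _ r20 xr (ltW xc)) mulr1; apply: (le_trans (y := 2 / (2 * r))).
          by apply: le_trans d1; rewrite ler_piMl.
        by apply: eq_ler; field; rewrite gt_eqF.
      have g2 : cyl r x * dramp c x <= r^-1 * k.
        have [xc|xc] := leP c `|coord ord_max x|.
          by rewrite (ramp_out cp xc).2 mulr0; exact: mulr_ge0.
        rewrite /k (cut1 _ _ cp xr (ltW xc)) mulr1; apply: (le_trans (y := 2 / c)).
          by apply: le_trans f1; rewrite ler_piMl.
        by rewrite ler_pdivrMr// ler_pdivlMl// mulrC.
      rewrite dzm /dh mulrBr; apply: (le_trans (ler_normB _ _)).
      by apply: lerD; rewrite ger0_norm// mulr_ge0.
    have Ms0 : 0 <= M * s by exact: mulr_ge0.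
    have hp j b : `|dz j x| <= b -> dz j x * flux x j <= b * (M * s).
      move=> hb; by apply: (le_trans (ler_norm _)); rewrite normrM; apply: ler_pM.
    have i1m : inord 1 != ord_max :> 'I_3 by rewrite -val_eqE /= inordK.
    have i0m : ord0 != ord_max :> 'I_3 by [].
    have := lerD (lerD (hp _ _ (hj _ i0m)) (hp _ _ (hj _ i1m))) (hp _ _ hm).
    rewrite /dot3 => /le_trans; apply; rewrite -/k -/k2.
    by apply: eq_ler; ring.
  have ctc := cct _ cp; have ctr := cct _ r20.
  rewrite integral3Z; last by apply: ccD => //; exact: ccZ.
  rewrite integral3D//; last exact: ccZ.
  rewrite integral3Z//.
  have j1 := integral3_cut_vertical r20 cp; have j2 := integral3_cut_vertical r20 r20.
  apply: (le_trans (y := M / r * (10 * (8 * 512 * M * (2 * r) ^+ 2)))).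
    apply: ler_wpM2l; first by apply: divr_ge0 => //; exact: ltW.
    by move: j1 j2; set p1 := I _; set p2 := I _; set p3 := _ * (2 * r) ^+ 2; lra.
  by apply: eq_ler; field; rewrite gt_eqF.
have hE2 : 2 / c * E <= 4 * C * r.
  apply: (le_trans (y := 2 / c * (C * (2 * r * c)))).
    by apply: ler_wpM2l => //; apply: divr_ge0 => //; exact: ltW.
  by apply: eq_ler; field; rewrite gt_eqF.
apply: (le_trans (ler_wpM2l k0 (lerD hflux hE2))).
apply: (le_trans (y := B * r ^+ 2)).
  by apply: eq_ler; rewrite /B; ring.
by rewrite ler_wpM2r ?sqr_ge0//; apply: le_trans (ler_norm B) _; rewrite lerDl.
Qed.

End system.

(** * A priori bounds and the theorem *)

Section ball.
Variable R : realType.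
Local Notation mu := (lebesgue3 R).

Lemma ball3E (r : R) (x : space3 R) : 0 < r -> ball3 r x <-> sqnorm3 x < r ^+ 2.
Proof.
move=> r0; rewrite /ball3 /sqnorm3 inord1_coord /coord /=.
by rewrite -{1}(ger0_norm (ltW r0)) -sqrtr_sqr ltr_sqrt// exprn_gt0.
Qed.

Lemma measurable_ball3 (r : R) : 0 < r -> measurable (ball3 r).
Proof.
move=> r0; rewrite (_ : ball3 r = setT `&` @sqnorm3 R @^-1` `]-oo, r ^+ 2[%classic).
  apply: continuous_measurable3 => //.
  by have [[]] := C2_sqnorm3 R.
by apply/seteqP; split=> x /=; rewrite in_itv /=; [move=> /(ball3E x r0)|move=> [_] /(ball3E x r0)].
Qed.

Lemma ball3_box3 (r : R) x : 0 < r -> ball3 r x -> box3 r r r x.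
Proof.
move=> r0 /(ball3E x r0) h; apply/norm_le_box3.
rewrite -(@ler_pXn2r _ 2)// ?nnegrE ?(ltW r0)//.
exact: le_trans (sqr_norm_le_sqnorm3 x) (ltW h).
Qed.

Lemma integral_le_integral3 (A : set (space3 R)) (g f : space3 R -> R) : measurable A ->
  continuous g -> cc f -> (forall x, 0 <= g x) -> (forall x, 0 <= f x) ->
  (forall x, A x -> g x <= f x) -> (\int[mu]_(x in A) (g x)%:E <= (integral3 f)%:E)%E.
Proof.
move=> mA cg ccf g0 f0 gf; have cf := ccf.1.
have mg : measurable_fun setT (EFin \o g).
  by apply/measurable_EFinP; exact: continuous_measurable3.
have mf : measurable_fun setT (EFin \o f).
  by apply/measurable_EFinP; exact: continuous_measurable3.
have fint := cc_integrable ccf.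
apply: (le_trans (y := (\int[mu]_(x in A) (f x)%:E)%E)).
  apply: ge0_le_integral => //.
  - by move=> x _; rewrite lee_fin.
  - exact: measurable_funS mg.
  - exact: measurable_funS mf.
apply: (le_trans (y := (\int[mu]_(x in setT) (f x)%:E)%E)).
  by apply: ge0_subset_integral => // x _; rewrite lee_fin.
by rewrite /integral3 /Rintegral fineK//; exact: integrable_fin_num.
Qed.

Lemma Ck2_C2 (f : space3 R -> R) : Ck 2 f ->
  C2 f (fun i => pderiv i f) (fun i j => pderiv j (pderiv i f)).
Proof.
have h g : Ck 1 g -> C1 g (fun i => pderiv i g).
  move=> [cg hg]; split=> // i; first by case: (hg i).
  move=> x; have [dg _] := hg i; apply: DeriveDef => //; exact: dg.
move=> [cf hf]; split=> [|i]; last by apply: h; case: (hf i).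
by apply: h; split=> // i; have [df [? _]] := hf i.
Qed.

Lemma sum_ord3 (F : 'I_3 -> R) : \sum_(i < 3) F i = F ord0 + F (inord 1) + F ord_max.
Proof.
rewrite !big_ord_recl big_ord0 addr0 addrA.
have -> : lift ord0 ord0 = inord 1 :> 'I_3 by apply/val_inj; rewrite /= inordK.
by have -> : lift ord0 (lift ord0 ord0) = ord_max :> 'I_3 by exact/val_inj.
Qed.

Lemma laplacianE (f : space3 R -> R) x :
  laplacian f x = lap3 (fun i j => pderiv j (pderiv i f)) x.
Proof. by rewrite /laplacian sum_ord3. Qed.

Lemma sqr_gradE (f : space3 R -> R) x :
  sqr_grad f x = dot3 (fun i => pderiv i f x) (fun i => pderiv i f x).
Proof. by rewrite /sqr_grad sum_ord3. Qed.

End ball.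

Section bounds.
Variables (R : realType) (alpha omega : R) (u v : space3 R -> R)
  (du dv : 'I_3 -> space3 R -> R) (ddu ddv : 'I_3 -> 'I_3 -> space3 R -> R).
Hypotheses (Cu : C2 u du ddu) (Cv : C2 v dv ddv).
Hypotheses (u_gt0 : forall x, 0 < u x) (v_gt0 : forall x, 0 < v x).
Hypotheses (equ : forall x, lap3 ddu x = u x * (u x ^+ 2 + v x ^+ 2 - 1) + v x * (alpha * u x * v x - omega))
  (eqv : forall x, lap3 ddv x = v x * (u x ^+ 2 + v x ^+ 2 - 1) + u x * (alpha * u x * v x - omega)).
Hypotheses (alpha_gt0 : 0 < alpha) (omega_gt0 : 0 < omega).

(** For w = u + v the equations add up to Δw = w (S + th), with th = alpha u v - omega and S = u^2 +
    v^2 - 1. This exceeds w (w^2 / 2 - 1 - omega) by w ((u - v)^2 / 2 + alpha u v) >= 0, which is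
    the form required by [keller_osserman]. *)
Lemma sum_bound x : (u x + v x) ^+ 2 <= 2 * (1 + omega).
Proof.
have := @keller_osserman R _ _ _ (1 + omega) (C2_shift x (C2D Cu Cv)).
rewrite addr0; apply.
- by move=> y; rewrite addr_gt0.
- by rewrite addr_ge0// ltW.
move=> y; set z := x + y; have U := u_gt0 z; have V := v_gt0 z.
have -> : lap3 (fun i j x0 => ddu i j (x + x0) + ddv i j (x + x0)) y = lap3 ddu z + lap3 ddv z.
  by rewrite /lap3; ring.
rewrite equ eqv -subr_ge0.
rewrite (_ : _ - _ = (u z + v z) * ((u z - v z) ^+ 2 / 2 + alpha * (u z * v z))); last by field.
apply: mulr_ge0; first by rewrite addr_ge0// ltW.
apply: addr_ge0; first by rewrite divr_ge0 ?sqr_ge0.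
by rewrite !mulr_ge0// ltW.
Qed.

Lemma uniform_bounds : exists M, [/\ 1 <= M, forall x, u x <= M, forall x, v x <= M,
  forall i x, `|du i x| <= M & forall i x, `|dv i x| <= M].
Proof.
(* Since m >= 1, the bound (u + v)^2 <= m also gives u + v <= m, without square roots. *)
pose m := 2 * (1 + omega).
have m1 : 1 <= m by rewrite /m; move: omega_gt0; lra.
have wm x : u x + v x <= m.
  have h := sum_bound x; rewrite -(@ler_pXn2r _ 2)// ?nnegrE; last lra.
    by apply: (le_trans h); rewrite -/m expr2 ler_peMl//; lra.
  by rewrite addr_ge0// ltW.
have um x : u x <= m by have := wm x; have := v_gt0 x; lra.
have vm x : v x <= m by have := wm x; have := u_gt0 x; lra.
pose N := m * (2 * m ^+ 2 + 1) + m * (alpha * m ^+ 2 + omega).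
have m2 : 0 <= m ^+ 2 by rewrite sqr_ge0.
have m0 : 0 <= m by lra.
have key s t : 0 <= s <= m -> 0 <= t <= m ->
  `|s * (s ^+ 2 + t ^+ 2 - 1) + t * (alpha * s * t - omega)| <= N.
  move=> /andP[s0 sm] /andP[t0 tm].
  have ss : s ^+ 2 <= m ^+ 2 by rewrite ler_pXn2r// nnegrE.
  have tt : t ^+ 2 <= m ^+ 2 by rewrite ler_pXn2r// nnegrE.
  have st : 0 <= s * t <= m ^+ 2 by rewrite mulr_ge0//= expr2 ler_pM.
  move/andP: st => [st0 st1].
  have ast : 0 <= alpha * (s * t) <= alpha * m ^+ 2.
    by rewrite mulr_ge0 ?(ltW alpha_gt0)//= ler_wpM2l// ltW.
  move/andP: ast => [ast0 ast1].
  apply: (le_trans (ler_normD _ _)); rewrite !normrM (ger0_norm s0) (ger0_norm t0) /N.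
  have s2 := sqr_ge0 s; have t2 := sqr_ge0 t.
  apply: lerD; apply: ler_pM => //; rewrite ler_norml -?mulrA; apply/andP; split;
    by move: omega_gt0; lra.
have N0 : 0 <= N.
  by have := key 0 0; rewrite lexx m0 => /(_ isT isT); apply: le_trans.
have Du x : `|lap3 ddu x| <= N by rewrite equ; apply: key; rewrite ltW//=.
have Dv x : `|lap3 ddv x| <= N.
  have -> : lap3 ddv x = v x * (v x ^+ 2 + u x ^+ 2 - 1) + u x * (alpha * v x * u x - omega).
    by rewrite eqv; ring.
  by apply: key; rewrite ltW//=.
have un x : `|u x| <= m by rewrite gtr0_norm.
have vn x : `|v x| <= m by rewrite gtr0_norm.
have gu i x := gradient_bound i x Cu m0 N0 un Du.
have gv i x := gradient_bound i x Cv m0 N0 vn Dv.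
exists (3 * m + N + 1); split=> // [|x|x]; first lra.
  by have := um x; lra.
by have := vm x; lra.
Qed.

Lemma product_bound x : omega <= (2 + alpha) * (u x * v x).
Proof.
have := @product_lower_bound R _ _ _ _ _ _ alpha omega (C2_shift x Cu) (C2_shift x Cv).
by rewrite addr0; apply => // y; [exact: equ|exact: eqv].
Qed.

End bounds.

Theorem lemma4p1 (R : realType) (alpha omega : R) (u v : space3 R -> R)
  (omega_gt0 : 0 < omega) (omega_lt : omega < alpha / 2)
  (u_gt0 : forall x, 0 < u x) (v_gt0 : forall x, 0 < v x)
  (uv_sol : classical_solution alpha omega u v)
  (du3_gt0 : forall x, 0 < pderiv3 u x) (dv3_lt0 : forall x, pderiv3 v x < 0) :
  exists2 C : R, 0 < C &
    \forall r \near +oo, (J alpha omega u v (ball3 r) <= (C * r ^+ 2)%:E)%E.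
Proof.
have [/Ck2_C2 Cu /Ck2_C2 Cv equ eqv] := uv_sol.
have alpha_gt0 : 0 < alpha by lra.
have {}equ x := etrans (esym (laplacianE u x)) (equ x).
have {}eqv x := etrans (esym (laplacianE v x)) (eqv x).
have [M [M1 uM vM duM dvM]] := uniform_bounds Cu Cv u_gt0 v_gt0 equ eqv alpha_gt0 omega_gt0.
have uv_low := product_bound Cu Cv u_gt0 v_gt0 equ eqv alpha_gt0 omega_gt0.
have [C C0 hC] := energy_majorant Cu Cv u_gt0 v_gt0 equ eqv du3_gt0 dv3_lt0 omega_gt0 omega_lt
  M1 uM vM duM dvM uv_low.
exists C => //; near=> r.
have r1 : 1 <= r by near: r; exact: nbhs_pinfty_ge.
have r0 : 0 < r by lra.
have [f [ccf f0 ef If]] := hC r r1.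
apply: (@le_trans _ _ (integral3 f)%:E); last by rewrite lee_fin.
rewrite /J; under eq_integral => x _ do rewrite !sqr_gradE.
apply: (@integral_le_integral3 R (ball3 r)) => //.
- exact: measurable_ball3.
- exact: continuous_energy Cu Cv.
- move=> x; exact: (energy_ge0 u v (@pderiv R ^~ u) (@pderiv R ^~ v) omega_gt0 omega_lt x).
- by move=> x /(ball3_box3 r0); exact: ef.
Unshelve. all: by end_near.
Qed.
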